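(* There exists a Banach space $X$ such that, for all $1\le p\le2$, $X$ has the weak MAP for $\mathcal P_p$ and $X$ lacks the BAP for $\mathcal P_p$.
   Context: All Banach spaces are over the same field, real or complex. $\mathcal F(X)$ denotes the finite rank bounded operators on $X$. $\mathcal P_p$ is the Banach operator ideal of absolutely $p$-summing operators with the $p$-summing norm. For a Banach operator ideal $(\mathcal A,\|\cdot\|_{\mathcal A})$ and $1\le\lambda<\infty$: $X$ has the $\lambda$-BAP for $\mathcal A$ if for every Banach space $Y$ and each $T\in\mathcal A(X;Y)$ there is a net $(S_\alpha)$ in $\mathcal F(X)$ such that $S_\alpha\to I_X$ uniformly on compact subsets of $X$ and $\limsup_\alpha\|TS_\alpha\|_{\mathcal A}\le\lambda\|T\|_{\mathcal A}$; $X$ has the BAP for $\mathcal A$ if this holds for some $\lambda$. $X$ has the weak MAP for $\mathcal A$ if for every Banach space $Y$ and each $T\in\mathcal A(X;Y)$ there is a net $(S_\alpha)$ in $\mathcal F(X)$ such that $S_\alpha\to I_X$ pointwise and $\limsup_\alpha\|TS_\alpha\|_{\mathcal A}\le\|T\|_{\mathcal A}$. *)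

(* Defs.v *)
From mathcomp Require Import all_boot all_order all_algebra.
From mathcomp Require Import all_classical all_reals all_analysis.
From mathcomp Require Export complex.

Set Implicit Arguments.
Unset Strict Implicit.
Unset Printing Implicit Defensive.

Import Order.TTheory GRing.Theory Num.Theory.
Import numFieldNormedType.Exports.

Local Open Scope classical_set_scope.
Local Open Scope ring_scope.

Section nets.
Variables (I : Type) (le : I -> I -> Prop).

Definition directed : Prop :=
  [/\ inhabited I, forall i, le i i,
      forall i j k, le i j -> le j k -> le i k &
      forall i j, exists k, le i k /\ le j k].

Definition tails : set_system I :=
  [set A | exists i, forall j, le i j -> A j].

Definition net_limsup (R : realType) (u : I -> \bar R) : \bar R :=
  ereal_inf [set ereal_sup [set u j | j in [set j | le i j]] | i in setT].

End nets.

Definition finite_rank (K : numFieldType) (X Y : normedModType K)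
    (S : {linear X -> Y}) : Prop :=
  continuous S /\
  exists (n : nat) (v : 'I_n -> Y), forall x, exists c : 'I_n -> K,
    S x = \sum_i c i *: v i.

(* An operator ideal with its norm is encoded by a single extended-valued
   function: the component A(X;Y) consists of the bounded operators on which
   the function is finite, and there it is the ideal norm. *)
Definition ideal_norm (R : realType) (K : numFieldType) : Type :=
  forall X Y : completeNormedModType K, {linear X -> Y} -> \bar R.

Definition in_ideal (R : realType) (K : numFieldType) (A : ideal_norm R K)
    (X Y : completeNormedModType K) (T : {linear X -> Y}) : Prop :=
  continuous T /\ (@A X Y T < +oo)%E.

Section approximation_properties.
Variables (R : realType) (K : numFieldType) (A : ideal_norm R K).
Variable X : completeNormedModType K.

Definition lambda_BAP (lambda : R) : Prop :=
  forall (Y : completeNormedModType K) (T : {linear X -> Y}), in_ideal A T ->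
  exists (I : Type) (le : I -> I -> Prop) (S : I -> {linear X -> X}),
    [/\ directed le,
        forall i, finite_rank (S i),
        {family compact, (fun i => S i : X -> X) @ tails le --> @id X} &
        (net_limsup le (fun i => A (T \o S i : {linear X -> Y}))
           <= lambda%:E * A T)%E].

Definition BAP : Prop := exists2 lambda : R, 1 <= lambda & lambda_BAP lambda.

Definition weak_MAP : Prop :=
  forall (Y : completeNormedModType K) (T : {linear X -> Y}), in_ideal A T ->
  exists (I : Type) (le : I -> I -> Prop) (S : I -> {linear X -> X}),
    [/\ directed le,
        forall i, finite_rank (S i),
        {ptws, (fun i => S i : X -> X) @ tails le --> @id X} &
        (net_limsup le (fun i => A (T \o S i : {linear X -> Y}))
           <= A T)%E].

End approximation_properties.

(* In a [normedModType K] norms are K-valued.  The map [re : K -> R] reads them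
   as real numbers: it is the identity if K = R and the real part if K = R[i]. *)
Section summing.
Variables (R : realType) (K : numFieldType) (re : K -> R).

Definition strong_lp_norm (p : R) (V : normedModType K) (n : nat)
    (x : 'I_n -> V) : R :=
  (\sum_i (re `|x i|) `^ p) `^ p^-1.

Definition dual_ball (X : normedModType K) : set {linear X -> K^o} :=
  [set phi | forall x, `|phi x| <= `|x|].

Definition weak_lp_norm (p : R) (X : normedModType K) (n : nat)
    (x : 'I_n -> X) : \bar R :=
  ereal_sup
    [set (strong_lp_norm p (fun i => phi (x i)))%:E | phi in @dual_ball X].

(* +oo when T is not absolutely p-summing *)
Definition summing_norm (p : R) : ideal_norm R K := fun X Y T =>
  ereal_inf [set C%:E | C in [set C : R | 0 <= C /\
    forall (n : nat) (x : 'I_n -> X),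
      ((strong_lp_norm p (fun i => T (x i)))%:E
         <= C%:E * weak_lp_norm p x)%E]].

End summing.

(* Main.v *)
Require Import Defs.
From HB Require Import structures.
From mathcomp Require Import all_boot all_order all_algebra.
From mathcomp Require Import all_classical all_reals all_analysis.
From mathcomp Require Import complex ring lra zify.

Set Implicit Arguments.
Unset Strict Implicit.
Unset Printing Implicit Defensive.

Import Order.TTheory GRing.Theory Num.Theory.
Import numFieldNormedType.Exports.

Local Open Scope classical_set_scope.
Local Open Scope ring_scope.

(** The weak MAP only asks for pointwise convergence, and a p-summing operator with
    p <= 2 sees its domain only through a Hilbertian seminorm, where orthogonal
    projections are at hand.  So the weak MAP for the p-summing operators can hold
    on a space without the approximation property.  The space X is the subspace,
    introduced by Szankowski, of an l_2-sum Z of finite dimensional l_1-spaces whose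
    coordinates are the nodes of the binary tree.

    Weak MAP.  A p-summing T is 2-summing ([summing_inclusion]), so by Pietsch's
    theorem |T x|^2 is at most q(x) = L(|phi x|^2), where L is a positive linear
    functional on the bounded functions of phi, and phi runs through a norming set
    of functionals on Z ([pietsch_domination]).  The seminorm q ^ (1/2) is
    Hilbertian and defined on all of Z.  The q-orthogonal projection S onto a
    finite dimensional subspace of X is a finite rank operator on X, and it can be
    made to fix any given finite set.  Since Z is an l_2-sum, q has small 2-summing
    norm on the vectors supported far away ([tail_form]); the finitely many other
    coordinates are taken care of by enlarging the subspace.  Thus T - T S has small
    2-summing norm ([finite_rank_approximation]).  As Z has cotype 2, a theorem of Maurey
    makes its 1-summing norm small too ([one_summing]), hence its p-summing norm, and
    the p-summing norm of T S is almost at most that of T.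

    No BAP.  For T = 0 the BAP yields finite rank operators tending to the identity
    uniformly on compact sets.  For an operator U on X consider the average over the
    nodes t of level n of z*_t (U z_t), for a biorthogonal system z_t, z*_t in X.
    It is 1 if U is the identity and tends to 0 with n if U has finite rank.  Two
    expressions of z*_t by coordinates are available on X, and they turn the
    difference of the averages on consecutive levels into an average of j-th
    coordinates of U y_j ([trace_step]), where the y_j with j in one block have
    their supports spread over different blocks of Z.  With random signs, a block A
    contributes the value of U at one vector of norm of order |A|^(1/2), instead of
    |A| terms ([class_average], [yclass_norm]).  The block sizes grow exponentially,
    so the differences are summable, uniformly over operators that are bounded on a
    suitable compact null sequence; this excludes operators that are uniformly
    close to the identity there ([trace_bound]). *)

(** * Real and complex scalars *)

(** Both scalar fields are handled at once through real and imaginary parts.  For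
    the real field [im] and [iu] vanish, so [iuE] replaces the law iu ^ 2 = -1. *)
Record scalars (R : realType) (K : numFieldType) := Scalars {
  re : K -> R;
  im : K -> R;
  ofR : R -> K;
  iu : K;
  cj : K -> K;
  reD : forall x y, re (x + y) = re x + re y;
  imD : forall x y, im (x + y) = im x + im y;
  ofRD : forall r s, ofR (r + s) = ofR r + ofR s;
  ofRM : forall r s, ofR (r * s) = ofR r * ofR s;
  ofR1 : ofR 1 = 1;
  reR : forall r, re (ofR r) = r;
  imR : forall r, im (ofR r) = 0;
  reM : forall x y, re (x * y) = re x * re y - im x * im y;
  imM : forall x y, im (x * y) = re x * im y + im x * re y;
  reIm : forall x, x = ofR (re x) + iu * ofR (im x);
  cjE : forall x, cj x = ofR (re x) - iu * ofR (im x);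
  iuE : forall x, iu * (iu * ofR (im x)) = - ofR (im x);
  re_iu : re iu = 0;
  re_cj : forall x, re (cj x) = re x;
  im_cj : forall x, im (cj x) = - im x;
  norm_re : forall x : K, `|x| = ofR (re `|x|);
  norm_sq : forall x : K, re `|x| ^+ 2 = re x ^+ 2 + im x ^+ 2;
  ofR_le : forall r s, (ofR r <= ofR s) = (r <= s)
}.

Lemma scalars_real (R : realType) : {s : scalars R R | re s = (fun x => x)}.
Proof.
unshelve eexists (@Scalars R R (fun x => x) (fun=> 0) (fun x => x) 0 (fun x => x) _ _ _ _ _ _ _ _ _ _ _ _ _ _ _ _ _ _) => //=.
all: try by move=> *; ring.
by move=> x; rewrite real_normK ?num_real//; ring.
Qed.

Section complex_scalars.
Local Open Scope complex_scope.
Lemma scalars_complex (R : realType) :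
  {s : scalars R R[i] | re s = (fun z : R[i] => complex.Re z)}.
Proof.
unshelve eexists (@Scalars R R[i] (fun z => complex.Re z) (fun z => complex.Im z)
  (fun r => r%:C) 'i (fun z => conjc z) _ _ _ _ _ _ _ _ _ _ _ _ _ _ _ _ _ _) => //=.
- by move=> [a b] [c d].
- by move=> [a b] [c d].
- by move=> r s; rewrite rmorphD.
- by move=> r s; rewrite rmorphM.
- by move=> [a b] [c d].
- by move=> [a b] [c d].
- by move=> [a b]; apply/eqP; rewrite eq_complex /=; apply/andP; split; apply/eqP; ring.
- by move=> [a b]; apply/eqP; rewrite eq_complex /=; apply/andP; split; apply/eqP; ring.
- by move=> [a b]; apply/eqP; rewrite eq_complex /=; apply/andP; split; apply/eqP; ring.
- by move=> [a b].
- by move=> [a b].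
- by move=> [a b]; rewrite /= sqr_sqrtr // addr_ge0 ?sqr_ge0.
- by move=> r s; rewrite lecR.
Qed.
End complex_scalars.

Section scalar_theory.
Variables (R : realType) (K : numFieldType) (s : scalars R K).

Definition nm (V : normedZmodType K) (v : V) : R := re s `|v|.

Lemma ofR0 : ofR s 0 = 0.
Proof. by apply: (addrI (ofR s 0)); rewrite -ofRD !addr0. Qed.

Lemma ofRN r : ofR s (- r) = - ofR s r.
Proof. by apply: (addrI (ofR s r)); rewrite -ofRD !subrr ofR0. Qed.

Lemma ofR_sum I (l : seq I) (P : pred I) (F : I -> R) :
  ofR s (\sum_(i <- l | P i) F i) = \sum_(i <- l | P i) ofR s (F i).
Proof. exact: (big_morph (ofR s) (@ofRD _ _ s) ofR0). Qed.

Lemma re0 : re s 0 = 0. Proof. by rewrite -ofR0 reR. Qed.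
Lemma im0 : im s 0 = 0. Proof. by rewrite -ofR0 imR. Qed.
Lemma reN x : re s (- x) = - re s x.
Proof. by apply: (addrI (re s x)); rewrite -reD !subrr re0. Qed.
Lemma imN x : im s (- x) = - im s x.
Proof. by apply: (addrI (im s x)); rewrite -imD !subrr im0. Qed.

Lemma re_sum I (l : seq I) (F : I -> K) :
  re s (\sum_(i <- l) F i) = \sum_(i <- l) re s (F i).
Proof. exact: (big_morph (re s) (@reD _ _ s) re0). Qed.

Lemma eqK x y : re s x = re s y -> im s x = im s y -> x = y.
Proof. by move=> hr hi; rewrite (reIm s x) (reIm s y) hr hi. Qed.

Lemma ofR_inj : injective (ofR s).
Proof. by move=> x y /(congr1 (re s)); rewrite !reR. Qed.

Section norms.
Variable V : normedZmodType K.
Implicit Types v w : V.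

(** Norms take values in [K]; [nm] is the same norm read in [R]. *)
Lemma nmE v : `|v| = ofR s (nm v).
Proof. by rewrite -{1}(normr_id v) (norm_re s) normr_id. Qed.

Lemma nm_ge0 v : 0 <= nm v.
Proof. by rewrite -(ofR_le s) -nmE ofR0. Qed.

Lemma nm_triangle v w : nm (v + w) <= nm v + nm w.
Proof. by rewrite -(ofR_le s) ofRD -!nmE ler_normD. Qed.

Lemma nm0 : nm (0 : V) = 0. Proof. by rewrite /nm normr0 re0. Qed.

Lemma nm0_eq0 v : nm v = 0 -> v = 0.
Proof. by move=> h; apply/normr0_eq0; rewrite nmE h ofR0. Qed.

Lemma nmN v : nm (- v) = nm v. Proof. by rewrite /nm normrN. Qed.

Lemma nmB_le v w : nm (v - w) <= nm v + nm w.
Proof. by rewrite -(nmN w) nm_triangle. Qed.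

Lemma nm_sum I (l : seq I) (P : pred I) (F : I -> V) :
  nm (\sum_(i <- l | P i) F i) <= \sum_(i <- l | P i) nm (F i).
Proof.
elim/big_rec2: _ => [|i y w _ h]; first by rewrite nm0.
by apply: le_trans (nm_triangle _ _) _; rewrite lerD2l.
Qed.
End norms.

Lemma nmZ (V : normedModType K) (a : K) (v : V) : nm (a *: v) = nm a * nm v.
Proof. by apply: ofR_inj; rewrite ofRM -!nmE normrZ. Qed.

Lemma nmM (x y : K) : nm (x * y) = nm x * nm y.
Proof. by apply: ofR_inj; rewrite ofRM -!nmE normrM. Qed.

Lemma nm_sq (x : K) : nm x ^+ 2 = re s x ^+ 2 + im s x ^+ 2.
Proof. exact: norm_sq. Qed.

Lemma nm_ofR r : nm (ofR s r : K) = `|r|.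
Proof.
apply/eqP; rewrite -(@eqrXn2 _ 2)// ?nm_ge0// nm_sq reR imR.
by rewrite expr0n addr0 real_normK ?num_real.
Qed.

Lemma nm1 : nm (1 : K) = 1. Proof. by rewrite -(ofR1 s) nm_ofR normr1. Qed.

Lemma nmV (x : K) : nm x^-1 = (nm x)^-1.
Proof.
have [->|x0] := eqVneq x 0; first by rewrite invr0 nm0 invr0.
have nx0 : nm x != 0 by apply: contra_neq x0; exact: nm0_eq0.
by apply: (mulfI nx0); rewrite -nmM divff// divff// nm1.
Qed.

Lemma re_le_nm (x : K) : `|re s x| <= nm x.
Proof.
rewrite -(@ler_pXn2r _ 2) ?nnegrE ?nm_ge0// nm_sq real_normK ?num_real//.
by rewrite lerDl sqr_ge0.
Qed.

Lemma cjD x y : cj s (x + y) = cj s x + cj s y.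
Proof. by apply: eqK; rewrite ?(reD, imD, re_cj, im_cj) // opprD. Qed.

Lemma cjM x y : cj s (x * y) = cj s x * cj s y.
Proof. by apply: eqK; rewrite ?(reM, imM, re_cj, im_cj); ring. Qed.

Lemma cjK : involutive (cj s).
Proof. by move=> x; apply: eqK; rewrite ?(re_cj, im_cj) // opprK. Qed.

Lemma cjR r : cj s (ofR s r) = ofR s r.
Proof. by apply: eqK; rewrite ?(re_cj, im_cj) // imR oppr0. Qed.

Lemma cj0 : cj s 0 = 0. Proof. by rewrite -ofR0 cjR. Qed.

Lemma cj_iu : cj s (iu s) = - iu s.
Proof.
have h : iu s = iu s * ofR s (im s (iu s)).
  by rewrite {1}(reIm s (iu s)) re_iu ofR0 add0r.
by rewrite cjE re_iu ofR0 add0r -h.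
Qed.

Lemma nm_cj (x : K) : nm (cj s x) = nm x.
Proof.
by apply/eqP; rewrite -(@eqrXn2 _ 2)// ?nm_ge0// !nm_sq re_cj im_cj sqrrN.
Qed.

Lemma mul_cj x : x * cj s x = ofR s (nm x ^+ 2).
Proof.
by apply: eqK; rewrite ?(reR, imR, reM, imM, re_cj, im_cj) ?nm_sq; ring.
Qed.

Lemma nm_sqD (x y : K) :
  nm (x + y) ^+ 2 = nm x ^+ 2 + nm y ^+ 2 + 2 * re s (x * cj s y).
Proof. by rewrite !nm_sq reM reD imD re_cj im_cj; ring. Qed.

Lemma nm_sqB (x y : K) :
  nm (x - y) ^+ 2 = nm x ^+ 2 + nm y ^+ 2 - 2 * re s (x * cj s y).
Proof. by rewrite !nm_sq reM reD imD re_cj im_cj reN imN; ring. Qed.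

End scalar_theory.

(** * Linear functionals dominated by sublinear ones *)

Section mazur_orlicz.
Variables (R : realType) (D : Type).
Implicit Types (f g : D -> R) (p q S : (D -> R) -> R).

Definition bnd f := exists M, forall d, `|f d| <= M.

Lemma bnd_cst c : bnd (fun=> c).
Proof. by exists `|c|. Qed.

Lemma bndD f g : bnd f -> bnd g -> bnd (fun d => f d + g d).
Proof.
move=> [M hM] [N hN]; exists (M + N) => d.
by apply: le_trans (ler_normD _ _) _; apply: lerD.
Qed.

Lemma bndZ c f : bnd f -> bnd (fun d => c * f d).
Proof. by move=> [M hM]; exists (`|c| * M) => d; rewrite normrM ler_wpM2l. Qed.

Lemma bnd_sum I (r : seq I) (F : I -> D -> R) :
  (forall i, bnd (F i)) -> bnd (fun d => \sum_(i <- r) F i d).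
Proof.
move=> hF; elim: r => [|i r ih].
  by under [X in bnd X]eq_fun do rewrite big_nil; exact: bnd_cst.
by under [X in bnd X]eq_fun do rewrite big_cons; exact: bndD.
Qed.

Definition sublinear p :=
  (forall f g, bnd f -> bnd g -> p (fun d => f d + g d) <= p f + p g) /\
  (forall t f, 0 <= t -> bnd f -> p (fun d => t * f d) <= t * p f).

(** A pair (g, a) of the cone stands for the constraint a <= L g on a functional L
    to be found. *)
Definition cone (C : (D -> R) -> R -> Prop) :=
  [/\ C (fun=> 0) 0,
      forall g a, C g a -> bnd g,
      forall g a h b, C g a -> C h b -> C (fun d => g d + h d) (a + b) &
      forall t g a, 0 <= t -> C g a -> C (fun d => t * g d) (t * a)].

Lemma sublinear0 p : sublinear p -> p (fun=> 0) = 0.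
Proof.
move=> [hD hZ]; have b0 := bnd_cst 0; apply/eqP; rewrite eq_le; apply/andP; split.
  by have := hZ 0 _ (lexx 0) b0; rewrite !mul0r.
by have := hD _ _ b0 b0; rewrite addr0 lerDl.
Qed.

Lemma sublinearN p f : sublinear p -> bnd f -> - p (fun d => -1 * f d) <= p f.
Proof.
move=> hp bf; have := hp.1 _ _ bf (bndZ (-1) bf).
have -> : (fun d => f d + -1 * f d) = (fun=> 0) by apply/funext => d; ring.
by rewrite sublinear0// -lerBlDr sub0r.
Qed.

Section cone_inf.
Variables (S : (D -> R) -> R) (C : (D -> R) -> R -> Prop).
Hypotheses (hS : sublinear S) (hC : cone C) (CS : forall g a, C g a -> a <= S g).

Let vals f := [set r | exists g a, C g a /\ r = S (fun d => f d + g d) - a].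
Definition cone_inf f := inf (vals f).

Let vals0 f : vals f !=set0.
Proof. by case: hC => C0 _ _ _; exists (S (fun d => f d + 0) - 0), (fun=> 0), 0. Qed.

Let vals_lb f : bnd f -> has_lbound (vals f).
Proof.
move=> bf; case: hC => _ Cb _ _; exists (- S (fun d => -1 * f d)) => _ [g [a [Cga ->]]].
have := hS.1 _ _ (bndD bf (Cb _ _ Cga)) (bndZ (-1) bf).
have -> : (fun d => f d + g d + -1 * f d) = g by apply/funext => d; ring.
by move/(le_trans (CS Cga)); lra.
Qed.

Lemma cone_inf_le f g a : bnd f -> C g a ->
  cone_inf f <= S (fun d => f d + g d) - a.
Proof. by move=> bf Cga; apply: ge_inf; [exact: vals_lb | exists g, a]. Qed.

Lemma cone_inf_ge f c : (forall g a, C g a -> c <= S (fun d => f d + g d) - a) ->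
  c <= cone_inf f.
Proof. by move=> h; apply: lb_le_inf => // _ [g [a [/h ? ->]]]. Qed.

(** Infimal convolution of [S] with the constraints: a linear functional below
    [cone_inf] is below [S] and satisfies every constraint, so that constraints
    are absorbed into the sublinear bound. *)
Lemma cone_inf_sublinear : sublinear cone_inf.
Proof.
have [C0 Cb CD CZ] := hC; have [SD SZ] := hS; split=> [f g bf bg|t f t0 bf].
  rewrite -lerBlDr; apply: cone_inf_ge => h a Cha.
  rewrite lerBlDr -lerBlDl; apply: cone_inf_ge => k b Ckb.
  rewrite lerBlDl; apply: le_trans (cone_inf_le _ (CD _ _ _ _ Cha Ckb)) _.
    exact: bndD.
  rewrite addrACA -opprD lerD2r.
  have -> : (fun d => f d + g d + (h d + k d)) =
            (fun d => (f d + h d) + (g d + k d)) by apply/funext => d; ring.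
  by apply: SD; apply: bndD => //; [exact: Cb Cha|exact: Cb Ckb].
move: t0; rewrite le_eqVlt => /predU1P[<-|t0].
  rewrite mul0r; apply: le_trans (cone_inf_le _ C0) _; first exact: bndZ.
  under [X in S X]eq_fun do rewrite mul0r addr0.
  by rewrite subr0 sublinear0.
rewrite -ler_pdivrMl//; apply: cone_inf_ge => g a Cga.
rewrite ler_pdivrMl//; apply: le_trans (cone_inf_le _ (CZ _ _ _ (ltW t0) Cga)) _.
  exact: bndZ.
rewrite mulrBr lerD2r.
under [X in S X]eq_fun do rewrite -mulrDr.
by apply: SZ; [exact: ltW | apply: bndD => //; exact: Cb Cga].
Qed.

Lemma cone_inf_leS f : bnd f -> cone_inf f <= S f.
Proof.
case: hC => C0 _ _ _ bf; apply: le_trans (cone_inf_le bf C0) _.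
by under [X in S X]eq_fun do rewrite addr0; rewrite subr0.
Qed.

Lemma cone_infN g a : C g a -> cone_inf (fun d => -1 * g d) <= - a.
Proof.
case: hC => _ Cb _ _ Cga; apply: le_trans (cone_inf_le _ Cga) _.
  by apply: bndZ; exact: Cb Cga.
have -> : (fun d => -1 * g d + g d) = (fun=> 0) by apply/funext => d; ring.
by rewrite sublinear0// add0r.
Qed.
End cone_inf.

(** Zorn's lemma; the infimum of a chain of sublinear functionals is sublinear and
    is finite because p f >= - q (- f). *)
Lemma minimal_sublinear q : sublinear q ->
  exists p, [/\ sublinear p, forall f, bnd f -> p f <= q f &
    forall p', sublinear p' -> (forall f, bnd f -> p' f <= p f) ->
    forall f, bnd f -> p f <= p' f].
Proof.
move=> hq; pose T := {p | sublinear p /\ forall f, bnd f -> p f <= q f}.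
pose below (p p' : T) := `[< forall f, bnd f -> sval p' f <= sval p f >].
have q0 : T by exists q.
have [|r t u /asboolP rt /asboolP tu|A totA|p hp] := @ZL_preorder T q0 below.
- by move=> t; apply/asboolP.
- by apply/asboolP => f bf; exact: le_trans (tu f bf) (rt f bf).
- have [[a0 Aa0]|A0] := pselect (A !=set0); last first.
    by exists q0 => p Ap; exfalso; apply: A0; exists p.
  pose V f := [set sval a f | a in A].
  have V0 f : V f !=set0 by exists (sval a0 f), a0.
  have Vlb f : bnd f -> has_lbound (V f).
    move=> bf; exists (- q (fun d => -1 * f d)) => _ [a _ <-].
    have [ha haq] := svalP a; apply: le_trans (sublinearN ha bf).
    by rewrite lerN2; apply: haq; exact: bndZ.
  have m_le f a : bnd f -> A a -> inf (V f) <= sval a f.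
    by move=> bf Aa; apply: ge_inf; [exact: Vlb | exists a].
  have m_sub : sublinear (fun f => inf (V f)).
    split=> [f g bf bg|t f t0 bf].
      rewrite -lerBlDr; apply: lb_le_inf => // _ [a Aa <-].
      rewrite lerBlDr -lerBlDl; apply: lb_le_inf => // _ [b Ab <-].
      rewrite lerBlDl.
      have [/asboolP ab|/asboolP ba] := totA _ _ Aa Ab.
        apply: le_trans (m_le _ _ (bndD bf bg) Ab) _.
        apply: le_trans ((svalP b).1.1 _ _ bf bg) _.
        by rewrite lerD2r; exact: ab.
      apply: le_trans (m_le _ _ (bndD bf bg) Aa) _.
      apply: le_trans ((svalP a).1.1 _ _ bf bg) _.
      by rewrite lerD2l; exact: ba.
    have /predU1P[<-|tpos] : (0 == t) || (0 < t) by rewrite -le_eqVlt.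
      rewrite mul0r; apply: le_trans (m_le _ _ (bndZ _ bf) Aa0) _.
      by apply: le_trans ((svalP a0).1.2 _ _ (lexx 0) bf) _; rewrite mul0r.
    rewrite -ler_pdivrMl//; apply: lb_le_inf => // _ [a Aa <-].
    rewrite ler_pdivrMl//; apply: le_trans (m_le _ _ (bndZ _ bf) Aa) _.
    exact: (svalP a).1.2.
  have m_q f : bnd f -> inf (V f) <= q f.
    by move=> bf; apply: le_trans (m_le _ _ bf Aa0) _; exact: (svalP a0).2.
  have hm : sublinear (fun f => inf (V f)) /\ forall f, bnd f -> inf (V f) <= q f by [].
  exists (exist (fun p => sublinear p /\ forall f, bnd f -> p f <= q f) _ hm) => a Aa; apply/asboolP => f bf /=.
  exact: m_le.
exists (sval p); have [sp pq] := svalP p; split=> // p' sp' p'p f bf.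
have p'q : forall f, bnd f -> p' f <= q f.
  by move=> g bg; exact: le_trans (p'p g bg) (pq g bg).
by have /asboolP := hp (exist (fun p => sublinear p /\ forall f, bnd f -> p f <= q f) _ (conj sp' p'q)) (asboolT p'p); apply.
Qed.

Record functional (L : (D -> R) -> R) : Prop := Functional {
  functionalD : forall f g, bnd f -> bnd g -> L (fun d => f d + g d) = L f + L g;
  functionalZ : forall t f, bnd f -> L (fun d => t * f d) = t * L f
}.

(** A minimal sublinear functional is linear: for a fixed [v], the infimum of
    p (f + t v) - t p v over t >= 0 is sublinear and below [p], hence equal to [p],
    and t = 1 gives the missing inequality p f + p v <= p (f + v). *)
Lemma hahn_banach q : sublinear q ->
  exists2 L, functional L & forall f, bnd f -> L f <= q f.
Proof.
move=> /minimal_sublinear[p [sp pq pmin]]; exists p => //.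
have pD f v : bnd f -> bnd v -> p (fun d => f d + v d) = p f + p v.
  move=> bf bv; apply/eqP; rewrite eq_le sp.1//=.
  pose C g a := exists t, [/\ 0 <= t, g = (fun d => t * v d) & a = t * p v].
  have hC : cone C.
    split.
    - by exists 0; split=> //; [apply/funext => d; rewrite mul0r|rewrite mul0r].
    - by move=> g a [t [_ -> _]]; exact: bndZ.
    - move=> g a h b [t [t0 -> ->]] [u [u0 -> ->]]; exists (t + u).
      by split; [exact: addr_ge0|apply/funext => d; rewrite mulrDl|rewrite mulrDl].
    - move=> t g a t0 [u [u0 -> ->]]; exists (t * u).
      by split; [exact: mulr_ge0|apply/funext => d; rewrite mulrA|rewrite mulrA].
  have Cp g a : C g a -> a <= p g.
    move=> [t [t0 -> ->]]; have /predU1P[<-|tpos] : (0 == t) || (0 < t) by rewrite -le_eqVlt.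
      under eq_fun do rewrite mul0r.
      by rewrite mul0r sublinear0.
    have := sp.2 t^-1 _ _ (bndZ t bv); rewrite invr_ge0 => /(_ t0).
    rewrite -ler_pdivrMl ?invr_gt0// invrK => h; apply: le_trans h.
    rewrite le_eqVlt; apply/orP; left; apply/eqP; congr (_ * p _).
    by apply/funext => d; rewrite mulKf// gt_eqF.
  have C1 : C v (p v).
    by exists 1; split=> //; [apply/funext => d; rewrite mul1r|rewrite mul1r].
  rewrite -lerBrDr; apply: le_trans (cone_inf_le sp hC Cp bf C1).
  apply: pmin => //; first exact: cone_inf_sublinear.
  by move=> g bg; exact: cone_inf_leS.
have pN f : bnd f -> p (fun d => - f d) = - p f.
  move=> bf; apply/eqP; rewrite -addr_eq0 -pD//; last first.
    by have := bndZ (-1) bf; under [X in bnd X -> _]eq_fun do rewrite mulN1r.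
  by under [X in p X]eq_fun do rewrite addNr; rewrite sublinear0.
have pZ t f : 0 <= t -> bnd f -> p (fun d => t * f d) = t * p f.
  move=> t0 bf; apply/eqP; rewrite eq_le sp.2//=.
  have /predU1P[<-|tpos] : (0 == t) || (0 < t) by rewrite -le_eqVlt.
    have -> : (fun d => 0 * f d) = (fun=> 0) by apply/funext => d; rewrite mul0r.
    by rewrite mul0r sublinear0.
  have := sp.2 t^-1 _ _ (bndZ t bf); rewrite invr_ge0 => /(_ t0).
  rewrite -ler_pdivrMl ?invr_gt0// invrK => h; apply: le_trans h.
  rewrite le_eqVlt; apply/orP; left; apply/eqP; congr (_ * p _).
  by apply/funext => d; rewrite mulKf// gt_eqF.
split=> // t f bf; have [t0|t0] := leP 0 t; first exact: pZ.
have -> : (fun d => t * f d) = (fun d => - (- t * f d)).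
  by apply/funext => d; rewrite mulNr opprK.
by rewrite pN ?pZ ?oppr_ge0 ?ltW// ?mulNr ?opprK//; exact: bndZ.
Qed.

(** The consistency condition a <= S g on the constraints is exactly what makes
    [cone_inf] finite. *)
Lemma mazur_orlicz S C : sublinear S -> cone C -> (forall g a, C g a -> a <= S g) ->
  exists L, [/\ functional L, forall f, bnd f -> L f <= S f &
    forall g a, C g a -> a <= L g].
Proof.
move=> hS hC CS; have [L fL hL] := hahn_banach (cone_inf_sublinear hS hC CS).
exists L; split=> // [f bf|g a Cga].
  exact: le_trans (hL f bf) (cone_inf_leS hS hC CS bf).
have bg : bnd g by case: hC => _ Cb _ _; exact: Cb Cga.
have := le_trans (hL _ (bndZ (-1) bg)) (cone_infN hS hC CS Cga).
by rewrite (functionalZ fL)// mulN1r lerN2.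
Qed.

End mazur_orlicz.

Section pietsch.
Variables (R : realType) (D : Type) (d0 : D).
Implicit Types f g : D -> R.

Section domination.
Variable (c : R).
Hypothesis c0 : 0 <= c.

Definition dominated (L : (D -> R) -> R) :=
  forall f M, bnd f -> (forall d, f d <= M) -> L f <= c * M.

(** The abstract form of Pietsch's theorem: the functions on [D] are tested against
    c times their supremum, and [L] plays the part of c times a finitely
    additive probability measure on [D]. *)
Lemma pietsch C : cone C ->
  (forall g a M, C g a -> (forall d, g d <= M) -> a <= c * M) ->
  exists L, [/\ functional L, dominated L & forall g a, C g a -> a <= L g].
Proof.
move=> hC hCM; pose S f := c * sup (range f).
have r0 f : range f !=set0 by exists (f d0), d0.
have rub f : bnd f -> has_ubound (range f).
  by move=> [M hM]; exists M => _ [d _ <-]; exact: le_trans (ler_norm _) (hM d).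
have le_S f d : bnd f -> f d <= sup (range f).
  by move=> bf; apply: ub_le_sup; [exact: rub|exists d].
have S_le f M : (forall d, f d <= M) -> S f <= c * M.
  by move=> h; apply: ler_wpM2l => //; apply: ge_sup => // _ [d _ <-].
have hS : sublinear S.
  split=> [f g bf bg|t f t0 bf].
    by rewrite -mulrDr; apply: S_le => d; apply: lerD; exact: le_S.
  by rewrite mulrCA; apply: S_le => d; apply: ler_wpM2l => //; exact: le_S.
have [|L [fL LS hL]] := mazur_orlicz hS hC.
  move=> g a Cga; apply: (hCM _ _ _ Cga) => d; apply: le_S.
  by case: hC => _ Cb _ _; exact: Cb Cga.
exists L; split=> // f M bf hM; exact: le_trans (LS f bf) (S_le _ _ hM).
Qed.

Variable L : (D -> R) -> R.
Hypotheses (fL : functional L) (dL : dominated L).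

Lemma functionalN f : bnd f -> L (fun d => - f d) = - L f.
Proof.
move=> bf; rewrite -mulN1r -functionalZ//.
by congr L; apply/funext => d; rewrite mulN1r.
Qed.

Lemma functional_ge0 f : bnd f -> (forall d, 0 <= f d) -> 0 <= L f.
Proof.
move=> bf f0; rewrite -[L f]opprK -functionalN// oppr_ge0 -(mulr0 c).
apply: dL => [|d]; last by rewrite oppr_le0.
by have := bndZ (-1) bf; congr bnd; apply/funext => d; rewrite mulN1r.
Qed.

Lemma functional_le f g : bnd f -> bnd g -> (forall d, f d <= g d) -> L f <= L g.
Proof.
move=> bf bg fg; rewrite -subr_ge0.
have bN : bnd (fun d => - f d).
  by have := bndZ (-1) bf; congr bnd; apply/funext => d; rewrite mulN1r.
rewrite -functionalN// -functionalD//; apply: functional_ge0 => [|d].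
  exact: bndD.
by rewrite subr_ge0.
Qed.

Lemma functional0 : L (fun=> 0) = 0.
Proof.
have b0 := bnd_cst D (0 : R); apply: (addrI (L (fun=> 0))).
by rewrite -(functionalD fL b0 b0) !addr0.
Qed.

Lemma functional_sum I (r : seq I) (F : I -> D -> R) : (forall i, bnd (F i)) ->
  L (fun d => \sum_(i <- r) F i d) = \sum_(i <- r) L (F i).
Proof.
move=> bF; elim: r => [|i r ih].
  have -> : (fun d => \sum_(i <- [::]) F i d) = (fun=> 0).
    by apply/funext => d; rewrite big_nil.
  by rewrite functional0 big_nil.
rewrite big_cons -ih -functionalD//; last exact: bnd_sum.
by congr L; apply/funext => d; rewrite big_cons.
Qed.
End domination.
End pietsch.

(** * Semi-inner products *)

Lemma discriminant (R : realType) (a b c : R) : 0 <= c ->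
  (forall t, 0 <= a - 2 * t * b + t ^+ 2 * c) -> b ^+ 2 <= a * c.
Proof.
move=> c0 h; have [cE|cn0] := eqVneq c 0; last first.
  have cp : 0 < c by rewrite lt_def cn0.
  have := h (b / c); rewrite -(pmulr_lge0 _ cp).
  have -> : (a - 2 * (b / c) * b + (b / c) ^+ 2 * c) * c = a * c - b ^+ 2.
    by field.
  by rewrite subr_ge0.
rewrite cE mulr0; have [->|b0] := eqVneq b 0; first by rewrite expr0n.
have := h ((a + 1) / (2 * b)); rewrite cE mulr0 addr0.
have -> : a - 2 * ((a + 1) / (2 * b)) * b = -1 by field.
by rewrite lerNr oppr0 ler10.
Qed.

Section semi_inner_product.
Variables (R : realType) (K : numFieldType) (s : scalars R K) (V : lmodType K).
Variable ip : V -> V -> K.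
Implicit Types (x y z : V).

Record semi_inner : Prop := SemiInner {
  ipDl : forall x y z, ip (x + y) z = ip x z + ip y z;
  ipZl : forall a x y, ip (a *: x) y = a * ip x y;
  ipC : forall x y, ip y x = cj s (ip x y);
  ip_ge0 : forall x, 0 <= re s (ip x x)
}.
Hypothesis hip : semi_inner.

Definition qf x := re s (ip x x).

Lemma ipDr x y z : ip x (y + z) = ip x y + ip x z.
Proof. by rewrite (ipC hip) (ipDl hip) cjD -!(ipC hip). Qed.

Lemma ipZr a x y : ip x (a *: y) = cj s a * ip x y.
Proof. by rewrite (ipC hip) (ipZl hip) cjM -!(ipC hip). Qed.

Lemma ipNl x y : ip (- x) y = - ip x y.
Proof. by rewrite -scaleN1r (ipZl hip) mulN1r. Qed.

Lemma ipBl x y z : ip (x - y) z = ip x z - ip y z.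
Proof. by rewrite (ipDl hip) ipNl. Qed.

Lemma ip0l y : ip 0 y = 0.
Proof. by rewrite -(scale0r 0) (ipZl hip) mul0r. Qed.

Lemma ip0r y : ip y 0 = 0.
Proof. by rewrite (ipC hip) ip0l cj0. Qed.

Lemma ip_suml I (r : seq I) (F : I -> V) y :
  ip (\sum_(i <- r) F i) y = \sum_(i <- r) ip (F i) y.
Proof. exact: (big_morph (fun x => ip x y) (fun a b => ipDl hip a b y) (ip0l y)). Qed.

Lemma ip_diag x : ip x x = ofR s (qf x).
Proof.
apply: (eqK (s := s)); rewrite ?reR ?imR//.
by have /(congr1 (im s)) := ipC hip x x; rewrite im_cj; lra.
Qed.

Lemma qf_ge0 x : 0 <= qf x. Proof. exact: ip_ge0. Qed.

Lemma qfZ a x : qf (a *: x) = nm s a ^+ 2 * qf x.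
Proof.
by rewrite {1}/qf (ipZl hip) ipZr mulrA mul_cj ip_diag -ofRM reR.
Qed.

Lemma qfN x : qf (- x) = qf x.
Proof. by rewrite -scaleN1r qfZ nmN nm1 expr1n mul1r. Qed.

Lemma qfD x y : qf (x + y) = qf x + qf y + 2 * re s (ip x y).
Proof.
by rewrite /qf (ipDl hip) !ipDr !reD (ipC hip x y) re_cj; ring.
Qed.

Lemma qfD_le x y : qf (x + y) <= 2 * qf x + 2 * qf y.
Proof.
have := qf_ge0 (x - y); rewrite !qfD qfN.
have -> : re s (ip x (- y)) = - re s (ip x y).
  by rewrite (ipC hip) ipNl re_cj reN (ipC hip x y) re_cj.
lra.
Qed.

(** If x is nearly the shortest vector of the coset x + K y, then x is nearly
    orthogonal to y.  With delta = qf x this is the Cauchy-Schwarz inequality. *)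
Lemma near_minimizer x y delta :
  (forall t, qf x - delta <= qf (x - t *: y)) ->
  nm s (ip x y) ^+ 2 <= delta * qf y.
Proof.
move=> h; set b := nm s (ip x y) ^+ 2.
have b0 : 0 <= b by exact: sqr_ge0.
have d0 : 0 <= delta by have := h 0; rewrite scale0r subr0; lra.
have key t : 0 <= delta - 2 * t * b + t ^+ 2 * (b * qf y).
  have := h (ofR s t * ip x y).
  rewrite qfD qfN qfZ nmM nm_ofR exprMn real_normK ?num_real// -/b.
  have -> : re s (ip x (- ((ofR s t * ip x y) *: y))) = - (t * b).
    rewrite -scaleNr ipZr -mulNr -ofRN cjM cjR -mulrA (mulrC (cj _ _)) mul_cj.
    by rewrite -ofRM reR -/b mulNr.
  lra.
have := discriminant (mulr_ge0 b0 (qf_ge0 y)) key.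
have [->|bn0] := eqVneq b 0; first by rewrite mulr_ge0 ?qf_ge0.
have bp : 0 < b by rewrite lt_def bn0.
by rewrite mulrCA expr2 ler_pM2l.
Qed.

Lemma cauchy_schwarz x y : nm s (ip x y) ^+ 2 <= qf x * qf y.
Proof. by apply: near_minimizer => t; rewrite subrr qf_ge0. Qed.

End semi_inner_product.

Lemma linear_exists (K : numFieldType) (X Y : lmodType K) (f : X -> Y) :
  (forall a x y, f (a *: x + y) = a *: f x + f y) ->
  exists F : {linear X -> Y}, F =1 f.
Proof.
move=> hf; pose m := GRing.isLinear.Build K X Y *:%R f (fun a x y => hf a x y).
pose F : {linear X -> Y} := HB.pack f m.
by exists F.
Qed.

Section gram_schmidt.
Variables (R : realType) (K : numFieldType) (s : scalars R K).

Lemma nm_continuous (X Y : normedModType K) (f : {linear X -> Y}) (M : R) :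
  (forall x, nm s (f x) <= M * nm s x) -> continuous f.
Proof.
move=> hM; apply: bounded_linear_continuous; apply/linear_boundedP.
have M0 : 0 <= Num.max M 0 by rewrite le_max lexx orbT.
near=> r => x; rewrite !(nmE s).
apply: (@le_trans _ _ (ofR s (Num.max M 0) * ofR s (nm s x))).
  rewrite -ofRM ofR_le; apply: le_trans (hM x) _.
  by rewrite ler_wpM2r ?nm_ge0// le_max lexx.
apply: ler_wpM2r; first by rewrite -(ofR0 s) ofR_le nm_ge0.
near: r; apply: nbhs_pinfty_ge; rewrite ger0_real//.
by rewrite -(ofR0 s) ofR_le.
Unshelve. all: by end_near. Qed.

Variables (X : normedModType K) (ip : X -> X -> K).
Hypotheses (hip : semi_inner s ip) (separated : forall w : X, w != 0 ->
  exists f : X -> K, [/\ forall a x y, f (a *: x + y) = a * f x + f y,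
    exists B, forall x, nm s (f x) <= B * nm s x & f w = 1]).
Variable (M : R).
Hypothesis M0 : 0 <= M.
Hypothesis ip_bounded : forall x, qf s ip x <= M * nm s x ^+ 2.

(** The form may be degenerate.  A new vector w of length zero is orthogonal to
    everything, so any functional with value 1 at w can serve as its coefficient;
    this keeps [S] the identity on the whole list. *)
Lemma gram_schmidt (vs : seq X) : exists S : {linear X -> X},
  [/\ finite_rank S, forall v, v \in vs -> S v = v &
      forall x y, ip (x - S x) (S y) = 0].
Proof.
suff [S [[B hB] [n [e he]] hS1 hS2]] : exists S : {linear X -> X},
  [/\ exists B, forall x, nm s (S x) <= B * nm s x,
      exists (n : nat) (v : 'I_n -> X), forall x, exists c : 'I_n -> K,
        S x = \sum_i c i *: v i,
      forall v, v \in vs -> S v = v & forall x y, ip (x - S x) (S y) = 0].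
  exists S; split=> //; split; last by exists n, e.
  exact: nm_continuous hB.
elim: vs => [|v vs [S [[B hB] [n [e he]] hS1 hS2]]].
  have [Z hZ] := @linear_exists K X X (fun=> 0) (fun a x y => esym (eq_trans (addr0 _) (scaler0 _ a))).
  exists Z; split=> [| |//|x y].
  - by exists 0 => x; rewrite hZ nm0 mul0r.
  - exists 0%N, (fun=> 0) => x; exists (fun=> 0).
    by rewrite hZ big_ord0.
  - by rewrite [Z y]hZ (ip0r hip).
have [w wE] : exists w, w = v - S v by exists (v - S v).
have wS y : ip w (S y) = 0 by rewrite wE.
have Sw y : ip (S y) w = 0 by rewrite (ipC hip) wS cj0.
have [c [cP [B' hB'] cv cvs cw]] : exists c : X -> K,
  [/\ forall a x y, c (a *: x + y) = a * c x + c y,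
      exists B, forall x, nm s (c x) <= B * nm s x,
      c v *: w = w, forall u, u \in vs -> c u = 0 & forall x, ip x w = c x * ip w w].
  have [ww|ww] := eqVneq (ip w w) 0; last first.
    exists (fun x => ip x w / ip w w); split=> [a x y| | |u uvs|x].
    - by rewrite (ipDl hip) (ipZl hip) mulrDl mulrA.
    - exists (Num.sqrt M * Num.sqrt (qf s ip w) / nm s (ip w w)) => x.
      rewrite nmM nmV mulrAC ler_wpM2r ?invr_ge0 ?nm_ge0//.
      rewrite -(@ler_pXn2r _ 2)// ?nnegrE ?nm_ge0 ?mulr_ge0 ?sqrtr_ge0 ?nm_ge0//.
      apply: le_trans (cauchy_schwarz hip _ _) _.
      rewrite !exprMn (sqr_sqrtr M0) (sqr_sqrtr (qf_ge0 hip w)).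
      by rewrite mulrAC ler_wpM2r// qf_ge0.
    - rewrite -[X in ip X w](subrK (S v)) -wE (ipDl hip) Sw addr0 divff//.
      by rewrite scale1r.
    - by rewrite -(hS1 u uvs) Sw mul0r.
    - by rewrite divfK.
  have xw x : ip x w = 0.
    apply: (@nm0_eq0 _ _ s K); apply/eqP; rewrite -sqrf_eq0 eq_le sqr_ge0 andbT.
    by apply: le_trans (cauchy_schwarz hip _ _) _; rewrite {2}/qf ww re0 mulr0.
  have [w0|/separated[f [fP [B' hB'] fw]]] := eqVneq w 0.
    exists (fun=> 0); split=> [a x y| | |//|x].
    - by rewrite mulr0 addr0.
    - by exists 0 => x; rewrite nm0 mul0r.
    - by rewrite w0 scaler0.
    - by rewrite xw mul0r.
  exists (fun x => f (x - S x)); split=> [a x y| | |u uvs|x].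
  - by rewrite -fP linearP scalerBr opprD addrACA.
  - exists (`|B'| * (1 + B)) => x; apply: le_trans (hB' _) _.
    apply: le_trans (ler_wpM2r (nm_ge0 s _) (ler_norm B')) _.
    rewrite -mulrA ler_wpM2l//; apply: le_trans (nmB_le _ _ _) _.
    by rewrite mulrDl mul1r lerD2l.
  - by rewrite -wE fw scale1r.
  - rewrite hS1// subrr.
    have := fP 1 0 0; rewrite scale1r addr0 mul1r => /(congr1 (fun z => z - f 0)).
    by rewrite subrr addrK.
  - by rewrite xw ww mulr0.
have TP a x y : S (a *: x + y) + c (a *: x + y) *: w =
    a *: (S x + c x *: w) + (S y + c y *: w).
  by rewrite linearP cP scalerDl scalerDr scalerA addrACA.
have [T hT] := linear_exists TP.
exists T.
have T2 x y : ip (x - T x) (T y) = 0.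
  have expand z : ip (x - T x) z = ip (x - S x) z - c x * ip w z.
    by rewrite hT opprD addrA (ipBl hip) (ipZl hip).
  rewrite expand [T y]hT !(ipDr hip) !(ipZr hip) hS2 wS !add0r (ipBl hip) Sw subr0.
  by rewrite mulrCA -mulrBr -cw subrr mulr0.
split=> //.
- exists (B + nm s w * B') => x.
  rewrite hT; apply: le_trans (nm_triangle _ _ _) _.
  by rewrite mulrDl; apply: lerD => //; rewrite nmZ mulrC -mulrA ler_wpM2l ?nm_ge0.
- exists n.+1, (fun i => oapp e w (unlift ord_max i)) => x.
  have [a ha] := he x; exists (fun i => oapp a (c x) (unlift ord_max i)).
  rewrite hT ha big_ord_recr /= unlift_none /=; congr (_ + _).
  apply: eq_bigr => i _.
  have -> : widen_ord (leqnSn n) i = lift ord_max i.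
    by apply: val_inj; rewrite /= /bump leqNgt ltn_ord.
  by rewrite liftK.
- move=> u; rewrite inE => /predU1P[->|uvs]; rewrite hT.
    by rewrite cv wE addrC subrK.
  by rewrite hS1// cvs// scale0r addr0.
Qed.
End gram_schmidt.

(** * The binary tree and its blocks *)

Fixpoint level (n : nat) : seq (seq bool) :=
  if n is m.+1 then map (cons false) (level m) ++ map (cons true) (level m)
  else [:: [::]].

Fixpoint below (n : nat) : seq (seq bool) :=
  if n is m.+1 then below m ++ level m else [::].

Lemma mem_level n t : (t \in level n) = (size t == n).
Proof.
elim: n t => [|n ih] t; first by rewrite inE; case: t.
rewrite /= mem_cat; case: t => [|b t].
  by apply/negbTE; apply/negP => /orP[] /mapP[].
have memE a : (b :: t \in [seq a :: u | u <- level n]) = (b == a) && (size t == n).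
  apply/mapP/andP => [[u]|[/eqP -> ht]].
    by rewrite ih => hu [-> ->].
  by exists t; rewrite ?ih.
by rewrite !memE eqSS; clear memE; case: b; rewrite ?orbF.
Qed.

Lemma level_uniq n : uniq (level n).
Proof.
elim: n => // n ih /=; rewrite cat_uniq !map_inj_uniq ?ih => [|x y []//|x y []//].
by rewrite andbT; apply/hasPn => _ /mapP[u _ ->]; apply/mapP => -[].
Qed.

Lemma size_level n : size (level n) = (2 ^ n)%N.
Proof. by elim: n => // n ih; rewrite /= size_cat !size_map ih expnS mul2n addnn. Qed.

Lemma big_level (T : nmodType) n (F : seq bool -> T) :
  \sum_(t <- level n.+1) F t =
  \sum_(t <- level n) F (false :: t) + \sum_(t <- level n) F (true :: t).
Proof. by rewrite /= big_cat !big_map. Qed.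

Lemma mem_below n t : (t \in below n) = (size t < n)%N.
Proof. by elim: n => // n ih; rewrite mem_cat ih mem_level ltnS [RHS]leq_eqVlt orbC. Qed.

Lemma below_uniq n : uniq (below n).
Proof.
elim: n => // n ih; rewrite cat_uniq ih level_uniq andbT.
by apply/hasPn => t; rewrite mem_level mem_below => /eqP ->; rewrite ltnn.
Qed.

Lemma big_below (T : nmodType) n (F : seq bool -> T) :
  \sum_(t <- below n) F t = \sum_(k < n) \sum_(t <- level k) F t.
Proof.
elim: n => [|n ih]; first by rewrite big_nil big_ord0.
by rewrite big_cat ih big_ord_recr.
Qed.

Fixpoint mask (c : nat) (t : seq bool) : seq bool :=
  if t is x :: u then (if (size u %% 8 == c)%N then false else x) :: mask c u
  else [::].

Definition colour (a b : bool) (t : seq bool) : nat := 4 * odd (size t) + 2 * a + b.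

(** Nodes are words read from the deepest digit.  A block fixes the two deepest
    digits a, b and all other digits except those at depths congruent to the
    colour modulo 8.  The eight colours are distributed over (a, b) and the parity
    of the level, so that neighbouring nodes lie in blocks that free disjoint sets
    of digits. *)
Definition block (j : seq bool) : seq bool :=
  if j is [:: a, b & t] then [:: a, b & mask (colour a b t) t] else j.

Lemma size_mask c t : size (mask c t) = size t.
Proof. by elim: t => //= x t ->. Qed.

Lemma size_block j : size (block j) = size j.
Proof. by case: j => [//|a [//|b t]]; rewrite /= size_mask. Qed.

(** * An l_2-sum of finite dimensional l_1-spaces *)

Section sequence_space.
Variables (R : realType) (K : numFieldType) (s : scalars R K).
Implicit Types x y : seq bool -> K^o.

(** A finitely supported functional in the unit ball of the dual of the l_2-sum of
    the l_1-spaces over the blocks: [test_weight] dominates the maximum norms of its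
    restrictions to the blocks. *)
Record test := Test {
  test_rank : nat;
  test_weight : seq bool -> R;
  test_coef : seq bool -> K;
  test_weight_ge0 : forall b, 0 <= test_weight b;
  test_weight_le1 : \sum_(b <- below test_rank) test_weight b ^+ 2 <= 1;
  test_coef_le : forall j, nm s (test_coef j) <= test_weight (block j)
}.

Definition ev (d : test) x : K :=
  \sum_(j <- below (test_rank d)) test_coef d j * x j.

Lemma evP d a x y : ev d (a *: x + y) = a * ev d x + ev d y.
Proof.
by rewrite /ev mulr_sumr -big_split /=; apply: eq_bigr => j _; rewrite mulrDr mulrCA.
Qed.

Lemma evD d x y : ev d (x + y) = ev d x + ev d y.
Proof. by rewrite -[x in LHS]scale1r evP mul1r. Qed.

Lemma evZ d a x : ev d (a *: x) = a * ev d x.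
Proof. by rewrite /ev mulr_sumr; apply: eq_bigr => j _; rewrite mulrCA. Qed.

Lemma ev0 d : ev d 0 = 0.
Proof. by rewrite -(scale0r (0 : seq bool -> K^o)) evZ mul0r. Qed.

Definition bounded_seq x := exists M, forall d, nm s (ev d x) <= M.

(** Four times z*_t computed in two ways.  The vectors z_t defined below satisfy this,
    and the equality of the two formulas is what defeats finite rank operators. *)
Definition relation x := forall t,
  2 * (x (false :: t) - x (true :: t)) =
  x [:: false, false & t] + x [:: true, false & t] +
  x [:: false, true & t] + x [:: true, true & t].

(** The flag selects the whole sum or the subspace cut out by the relations. *)
Definition in_space (c : bool) x := bounded_seq x /\ (c -> relation x).

Definition in_space_pred c : pred (seq bool -> K^o) := fun x => `[< in_space c x >].

Lemma in_space_submod c : GRing.submod_closed (in_space_pred c).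
Proof.
split; first by apply/asboolP; split=> [|_ t]; [exists 0 => d; rewrite ev0 nm0
  |rewrite subrr mulr0 !addr0].
move=> a x y /asboolP[[M hM] rx] /asboolP[[N hN] ry]; apply/asboolP; split.
  exists (nm s a * M + N) => d; rewrite evP; apply: le_trans (nm_triangle _ _ _) _.
  by apply: lerD => //; rewrite nmM ler_wpM2l ?nm_ge0.
move=> hc t; have /= hx := rx hc t; have /= hy := ry hc t.
have E j : (a *: x + y) j = a * x j + y j by [].
rewrite !E.
have -> : 2 * (a * x (false :: t) + y (false :: t) - (a * x (true :: t) + y (true :: t)))
  = a * (2 * (x (false :: t) - x (true :: t))) + 2 * (y (false :: t) - y (true :: t)).
  by ring.
by rewrite hx hy; ring.
Qed.
HB.instance Definition _ c := GRing.isSubmodClosed.Build K (seq bool -> K^o)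
  (in_space_pred c) (in_space_submod c).

Record space (c : bool) := Space { coord :> seq bool -> K^o; coordP : in_space_pred c coord }.
HB.instance Definition _ c := [isSub for @coord c].
HB.instance Definition _ c := [Choice of space c by <:].
HB.instance Definition _ c := [SubChoice_isSubLmodule of space c by <:].

End sequence_space.

Section space_norm.
Variables (R : realType) (K : numFieldType) (s : scalars R K).

Lemma unit_test_exists (j : seq bool) :
  exists d : test s, forall x : seq bool -> K^o, ev d x = x j.
Proof.
pose w (b : seq bool) : R := (b == block j)%:R.
pose f (k : seq bool) : K := (k == j)%:R.
have w0 b : 0 <= w b by rewrite ler0n.
have memj N : (size j < N)%N -> j \in below N by rewrite mem_below.
have sumw : \sum_(b <- below (size j).+1) w b ^+ 2 <= 1.
  have bj : block j \in below (size j).+1 by rewrite mem_below size_block.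
  rewrite (bigD1_seq _ bj (below_uniq _)) /= big1 => [|b /negbTE bjF].
    by rewrite addr0 /w eqxx expr1n.
  by rewrite /w bjF expr0n.
have fle k : nm s (f k) <= w (block k).
  rewrite /f; have [->|_] := eqVneq k j; last by rewrite nm0.
  by rewrite /w eqxx nm1.
exists (Test w0 sumw fle) => x.
rewrite /ev (bigD1_seq _ (memj _ (ltnSn _)) (below_uniq _)) /= big1.
  by rewrite addr0 /= /f eqxx mul1r.
by move=> k /negbTE kj; rewrite /= /f kj mul0r.
Qed.

Variable c : bool.
Implicit Types x y : space s c.

Lemma coordD x y : coord (x + y) = coord x + coord y.
Proof. exact: (raddfD (val : space s c -> _)). Qed.

Lemma coordB x y : coord (x - y) = coord x - coord y.
Proof. exact: (raddfB (val : space s c -> _)). Qed.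

Lemma coordZ a x : coord (a *: x) = a *: coord x.
Proof. exact: (linearZZ (val : space s c -> _)). Qed.

Lemma coord0 : coord (0 : space s c) = 0.
Proof. exact: (raddf0 (val : space s c -> _)). Qed.

(** The dual description makes the norm axioms immediate; the description by
    block sums follows from [ev_le_section] and [norming_test]. *)
Definition snorm x : R := sup (range (fun d : test s => nm s (ev d x))).

Lemma ev_le_snorm (d : test s) x : nm s (ev d x) <= snorm x.
Proof.
apply: ub_le_sup; last by exists d.
have [/= [M hM] _] := asboolW (coordP x).
by exists M => _ [e _ <-].
Qed.

Lemma snorm_le x M : (forall d : test s, nm s (ev d x) <= M) -> snorm x <= M.
Proof.
move=> h; apply: ge_sup => [|_ [d _ <-]//].
by have [d _] := unit_test_exists [::]; exists (nm s (ev d x)), d.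
Qed.

Lemma coord_le_snorm x j : nm s (coord x j : K) <= snorm x.
Proof. by have [d <-] := unit_test_exists j; exact: ev_le_snorm. Qed.

Lemma snorm_ge0 x : 0 <= snorm x.
Proof. exact: le_trans (nm_ge0 s _) (coord_le_snorm x [::]). Qed.

Lemma snormD x y : ofR s (snorm (x + y)) <= ofR s (snorm x) + ofR s (snorm y).
Proof.
rewrite -ofRD ofR_le; apply: snorm_le => d; rewrite coordD evD.
by apply: le_trans (nm_triangle _ _ _) _; apply: lerD; exact: ev_le_snorm.
Qed.

Lemma snormZ (a : K) x : ofR s (snorm (a *: x)) = `|a| * ofR s (snorm x).
Proof.
rewrite (nmE s) -ofRM; congr (ofR s _).
have le b y : snorm (b *: y) <= nm s b * snorm y.
  apply: snorm_le => d; rewrite coordZ evZ nmM.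
  by rewrite ler_wpM2l ?nm_ge0// ev_le_snorm.
apply/eqP; rewrite eq_le le /=.
have [->|a0] := eqVneq a 0; first by rewrite nm0 mul0r snorm_ge0.
have na0 : 0 < nm s a.
  by rewrite lt_def nm_ge0 andbT; apply: contra_neq a0; exact: nm0_eq0.
rewrite -ler_pdivlMl//.
have := le a^-1 (a *: x); rewrite scalerA mulVf// scale1r.
by rewrite nmV.
Qed.

Lemma snorm_eq0 x : ofR s (snorm x) = 0 -> x = 0.
Proof.
move=> /esym; rewrite -(ofR0 s) => /ofR_inj x0; apply: val_inj; apply/funext => j.
apply: (@nm0_eq0 _ _ s K); apply/eqP; rewrite eq_le nm_ge0 andbT x0.
exact: coord_le_snorm.
Qed.

HB.instance Definition _ := Lmodule_isNormed.Build K (space s c)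
  snormD snormZ snorm_eq0.

Lemma nm_space x : nm s x = snorm x.
Proof. by apply: (ofR_inj (s := s)); rewrite -nmE. Qed.

Lemma ev_le (d : test s) x : nm s (ev d x) <= nm s x.
Proof. by rewrite nm_space ev_le_snorm. Qed.

Lemma nm_space_le x M : (forall d : test s, nm s (ev d x) <= M) -> nm s x <= M.
Proof. by rewrite nm_space; exact: snorm_le. Qed.

Lemma coord_le x j : nm s (coord x j : K) <= nm s x.
Proof. by rewrite nm_space coord_le_snorm. Qed.

End space_norm.

Section space_complete.
Variables (R : realType) (K : numFieldType) (s : scalars R K) (c : bool).

Lemma cauchy_small (V : normedModType K) (F : set_system V) : ProperFilter F ->
  cauchy F -> forall e : R, 0 < e ->
  exists2 A, F A & forall x y, A x -> A y -> nm s (x - y) <= e.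
Proof.
move=> PF Fc e e0.
have e20 : 0 < ofR s (e / 2) by rewrite lt_def -(ofR0 s) ofR_le ltW ?divr_gt0// andbT
   (inj_eq (ofR_inj (s := s))) gt_eqF ?divr_gt0.
have /cauchy_ballP/(_ _ e20) := Fc.
move=> [[A B] /= [FA FB] AB]; exists (A `&` B); first exact: filterI.
move=> x y [Ax _] [_ By]; have := AB (x, y) (conj Ax By).
rewrite /= -ball_normE /= (nmE s) => /ltW; rewrite ofR_le => h.
lra.
Qed.

Lemma real_limit (V : normedModType K) (F : set_system V) (f : V -> R) :
  ProperFilter F -> cauchy F ->
  (forall x y, `|f x - f y| <= nm s (x - y)) ->
  exists l, forall e : R, 0 < e -> F [set x | `|f x - l| <= e].
Proof.
move=> PF Fc hf; have cf : cauchy (f @ F).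
  apply: cauchy_exP => e e0.
  have [A FA hA] := cauchy_small PF Fc (divr_gt0 e0 (ltr0Sn R 1)).
  have [a Aa] := filter_ex FA.
  exists (f a); rewrite /= nbhs_filterE.
  apply: filterS FA => y Ay /=; rewrite -ball_normE /=.
  apply: le_lt_trans (hf _ _) (le_lt_trans (hA _ _ Aa Ay) _).
  lra.
have cvF : cvg (f @ F) by apply: cauchy_cvg.
have [l hl] := iffLR (cvg_ex _) cvF; exists l => e e0.
have /cvgrPdist_le/(_ _ e0) := hl.
by apply: filterS => x; rewrite distrC.
Qed.

(** Coordinatewise limits: every test reads finitely many coordinates, so the
    Cauchy estimates pass to the limit test by test. *)
Lemma space_complete (F : set_system (space s c)) : ProperFilter F -> cauchy F -> cvg F.
Proof.
move=> PF Fc.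
have lim_ex j : exists l : K, forall e : R, 0 < e ->
    F [set x : space s c | nm s (coord x j - l : K) <= e].
  have [|a ha] := @real_limit _ F (fun x => re s (coord x j)) PF Fc.
    move=> x y; rewrite -reN -reD; apply: le_trans (re_le_nm _ _) _.
    exact: (coord_le (x - y) j).
  have [|b hb] := @real_limit _ F (fun x => im s (coord x j)) PF Fc.
    move=> x y; rewrite -imN -imD; apply: le_trans (coord_le (x - y) j).
    rewrite -(@ler_pXn2r _ 2) ?nnegrE ?nm_ge0// nm_sq real_normK ?num_real//.
    by rewrite lerDr sqr_ge0.
  exists (ofR s a + iu s * ofR s b) => e e0.
  pose k := nm s (iu s) + 1.
  have k0 : 0 < k by rewrite ltr_wpDl ?nm_ge0.
  have e2 : 0 < e / 2 by rewrite divr_gt0.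
  have ek : 0 < e / 2 / k by rewrite divr_gt0.
  apply: filterS (filterI (ha _ e2) (hb _ ek)) => x [/= hxa hxb].
  rewrite {1}(reIm s (coord x j)) opprD addrACA -ofRN -ofRD -mulrBr -ofRN -ofRD.
  apply: le_trans (nm_triangle _ _ _) _; rewrite nmM !nm_ofR (splitr e).
  apply: lerD => //; apply: le_trans (_ : k * (e / 2 / k) <= _).
    by apply: ler_pM; rewrite ?nm_ge0// lerDl.
  by rewrite mulrCA divff ?lt0r_neq0// mulr1.
have [l hl] := choice lim_ex.
have close (r : seq (seq bool)) (e : R) : 0 < e ->
    F [set x : space s c | forall j, j \in r -> nm s (coord x j - l j : K) <= e].
  move=> e0; elim: r => [|k r ih]; first by apply: filterE => x j.
  apply: filterS (filterI (hl k e e0) ih) => x [h1 h2] j.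
  by rewrite inE => /predU1P[->|/h2].
have near_l A (e : R) : F A -> (forall x y, A x -> A y -> nm s (x - y) <= e) ->
    forall x, A x -> forall d : test s, nm s (ev d (coord x - l)) <= e.
  move=> FA hA x Ax d; apply/ler_addgt0Pr => h h0.
  pose B := \sum_(j <- below (test_rank d)) nm s (test_coef d j) + 1.
  have B0 : 0 < B by rewrite ltr_wpDl// sumr_ge0// => j _; exact: nm_ge0.
  have [y [Ay hy]] := filter_ex (filterI FA (close (below (test_rank d)) _ (divr_gt0 h0 B0))).
  have -> : coord x - l = coord (x - y) + (coord y - l) by rewrite coordB addrA subrK.
  rewrite evD; apply: le_trans (nm_triangle _ _ _) (lerD _ _).
    by apply: le_trans (ev_le _ _) (hA _ _ Ax Ay).
  apply: le_trans (nm_sum _ _ _ _) _.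
  apply: (@le_trans _ _ (\sum_(j <- below (test_rank d)) nm s (test_coef d j) * (h / B))).
    rewrite big_seq [leRHS]big_seq; apply: ler_sum => j jd.
    by rewrite nmM ler_wpM2l ?nm_ge0//; exact: hy.
  rewrite -mulr_suml mulrA ler_pdivrMr// mulrC ler_wpM2l ?(ltW h0)// lerDl.
  exact: ler01.
have l_in : in_space_pred s c l.
  have [A FA hA] := cauchy_small PF Fc ltr01.
  have [x Ax] := filter_ex FA.
  have [/= [M hM] rx] := asboolW (coordP x).
  apply/asboolP; split.
    exists (M + 1) => d.
    have -> : l = coord x - (coord x - l) by rewrite opprB addrC subrK.
    rewrite -[- (coord x - l)]scaleN1r evD evZ mulN1r.
    apply: le_trans (nmB_le _ _ _ ) _; apply: lerD; first exact: hM.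
    exact: near_l FA hA x Ax d.
  move=> hc t; apply/eqP; rewrite -subr_eq0; apply/eqP.
  apply: (@nm0_eq0 _ _ s K); apply/eqP; rewrite eq_le nm_ge0 andbT.
  apply/ler_addgt0Pr => e e0; rewrite add0r.
  pose js := [:: false :: t; true :: t; [:: false, false & t]; [:: true, false & t];
    [:: false, true & t]; [:: true, true & t]].
  have [y hy] := filter_ex (close js (e / 8) (divr_gt0 e0 (ltr0Sn R 7))).
  have ry := (asboolW (coordP y)).2 hc t.
  pose u j : K := coord y j - l j.
  have -> : 2 * (l (false :: t) - l (true :: t)) -
      (l [:: false, false & t] + l [:: true, false & t] +
       l [:: false, true & t] + l [:: true, true & t]) =
      (u [:: false, false & t] + u [:: true, false & t] +
       u [:: false, true & t] + u [:: true, true & t]) -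
      ((u (false :: t) - u (true :: t)) + (u (false :: t) - u (true :: t))).
    by apply/eqP; rewrite -subr_eq0; apply/eqP; move: ry; rewrite /u => /eqP;
       rewrite -subr_eq0 => /eqP ry; apply: etrans ry; rewrite /=; ring.
  have hu j : j \in js -> nm s (u j) <= e / 8 by exact: hy.
  have := hu (false :: t); rewrite !inE eqxx => /(_ isT) h1.
  have := hu (true :: t); rewrite !inE eqxx orbT => /(_ isT) h2.
  have := hu [:: false, false & t]; rewrite !inE eqxx !orbT => /(_ isT) h3.
  have := hu [:: true, false & t]; rewrite !inE eqxx !orbT => /(_ isT) h4.
  have := hu [:: false, true & t]; rewrite !inE eqxx !orbT => /(_ isT) h5.
  have := hu [:: true, true & t]; rewrite !inE eqxx !orbT => /(_ isT) h6.
  have tr (v w : K) a b : nm s v <= a -> nm s w <= b -> nm s (v + w) <= a + b.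
    by move=> ? ?; apply: le_trans (nm_triangle _ _ _) (lerD _ _).
  have trB (v w : K) a b : nm s v <= a -> nm s w <= b -> nm s (v - w) <= a + b.
    by move=> ? ?; apply: le_trans (nmB_le _ _ _) (lerD _ _).
  have h7 := trB _ _ _ _ h1 h2.
  have h8 := trB _ _ _ _ (tr _ _ _ _ (tr _ _ _ _ (tr _ _ _ _ h3 h4) h5) h6) (tr _ _ _ _ h7 h7).
  apply: le_trans h8 _; lra.
apply/cvg_ex; exists (Space l_in); apply/fcvg_ballP => e e0.
have eE : e = ofR s (nm s e) by rewrite -nmE gtr0_norm.
have ne0 : 0 < nm s e.
  rewrite lt_def nm_ge0 andbT; apply: contraTneq e0 => h.
  by rewrite eE h ofR0 ltxx.
have [A FA hA] := cauchy_small PF Fc (divr_gt0 ne0 (ltr0Sn R 1)).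
apply: filterS (FA) => x Ax; rewrite -ball_normE /= distrC (nmE s) eE.
rewrite lt_neqAle ofR_le (inj_eq (ofR_inj (s := s))) -lt_neqAle.
apply: (@le_lt_trans _ _ (nm s e / 2)); last lra.
apply: nm_space_le => d; rewrite coordB /=; exact: near_l FA hA x Ax d.
Qed.

HB.instance Definition _ := Uniform_isComplete.Build (space s c) space_complete.
Definition banach : completeNormedModType K := space s c.
End space_complete.

(** * Block sums, windows and tails *)

Lemma sum_cauchy_schwarz (R : realType) (I : Type) (r : seq I) (a b : I -> R) :
  (\sum_(i <- r) a i * b i) ^+ 2 <=
  (\sum_(i <- r) a i ^+ 2) * (\sum_(i <- r) b i ^+ 2).
Proof.
apply: discriminant => [|t]; first by apply: sumr_ge0 => i _; exact: sqr_ge0.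
rewrite mulr_sumr mulr_sumr -sumrB -big_split /=.
apply: sumr_ge0 => i _.
by have := sqr_ge0 (a i - t * b i); congr (0 <= _); ring.
Qed.

Lemma big_block (T : nmodType) N (G : seq bool -> T) :
  \sum_(j <- below N) G j =
  \sum_(b <- below N) \sum_(j <- level (size b) | block j == b) G j.
Proof.
rewrite !big_below; apply: eq_bigr => n _.
have -> : \sum_(b <- level n) \sum_(j <- level (size b) | block j == b) G j =
    \sum_(b <- level n) \sum_(j <- level n) (if block j == b then G j else 0).
  rewrite big_seq [RHS]big_seq; apply: eq_bigr => b.
  by rewrite mem_level => /eqP ->; rewrite big_mkcond.
rewrite exchange_big /= big_seq [RHS]big_seq; apply: eq_bigr => j jn.
have bj : block j \in level n by rewrite mem_level size_block -mem_level.
rewrite (bigD1_seq _ bj (level_uniq n)) /= eqxx big1 ?addr0// => b.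
by rewrite eq_sym => /negbTE ->.
Qed.

Section block_norm.
Variables (R : realType) (K : numFieldType) (s : scalars R K).
Implicit Types x y : seq bool -> K^o.

Definition block_sum x (b : seq bool) : R :=
  \sum_(j <- level (size b) | block j == b) nm s (x j : K).

Definition section N x := \sum_(b <- below N) block_sum x b ^+ 2.

Lemma block_sum_ge0 x b : 0 <= block_sum x b.
Proof. by apply: sumr_ge0 => j _; exact: nm_ge0. Qed.

Lemma section_ge0 N x : 0 <= section N x.
Proof. by apply: sumr_ge0 => b _; exact: sqr_ge0. Qed.

Lemma section_mono x : {homo section^~ x : M N / (M <= N)%N >-> M <= N}.
Proof.
apply: homo_leq => //= [|N]; first by move=> ? ? ?; exact: le_trans.
by rewrite /section /= big_cat /= lerDl sumr_ge0// => b _; exact: sqr_ge0.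
Qed.

Lemma nm_pairing_le N (w : seq bool -> R) (f : seq bool -> K) x :
  (forall b, 0 <= w b) -> (forall j, nm s (f j) <= w (block j)) ->
  nm s (\sum_(j <- below N) f j * x j) ^+ 2 <=
  (\sum_(b <- below N) w b ^+ 2) * section N x.
Proof.
move=> w0 fw; apply: le_trans (sum_cauchy_schwarz _ _ _).
rewrite ler_pXn2r// ?nnegrE ?nm_ge0//; last first.
  by apply: sumr_ge0 => b _; rewrite mulr_ge0// block_sum_ge0.
apply: le_trans (nm_sum _ _ _ _) _; rewrite big_block.
apply: ler_sum => b _; rewrite mulr_sumr; apply: ler_sum => j /eqP <-.
by rewrite nmM ler_wpM2r ?nm_ge0.
Qed.

Lemma ev_le_section (d : test s) x : nm s (ev d x) ^+ 2 <= section (test_rank d) x.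
Proof.
apply: le_trans (nm_pairing_le _ _ (test_weight_ge0 d) (@test_coef_le _ _ _ d)) _.
by rewrite ler_piMl ?section_ge0// test_weight_le1.
Qed.

Definition phase (z : K) : K := cj s z / ofR s (nm s z).

Lemma phase_le1 z : nm s (phase z) <= 1.
Proof.
rewrite /phase nmM nmV nm_cj nm_ofR ger0_norm ?nm_ge0//.
have [->|n0] := eqVneq (nm s z) 0; first by rewrite mul0r ler01.
by rewrite divff.
Qed.

Lemma phaseE z : phase z * z = ofR s (nm s z).
Proof.
rewrite /phase mulrAC (mulrC (cj s z)) mul_cj expr2 ofRM.
have [->|n0] := eqVneq (ofR s (nm s z)) 0; first by rewrite !mul0r.
by rewrite mulfK.
Qed.

(** Equality in the Cauchy-Schwarz inequality between the block sums of [x] and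
    the weights of the test. *)
Lemma norming_test N x : exists d : test s,
  [/\ test_rank d = N & ev d x = ofR s (Num.sqrt (section N x))].
Proof.
pose S := Num.sqrt (section N x).
have S2 : S ^+ 2 = section N x by rewrite sqr_sqrtr// section_ge0.
pose w b := block_sum x b / S.
pose f j : K := ofR s (w (block j)) * phase (x j).
have w0 b : 0 <= w b by rewrite divr_ge0 ?block_sum_ge0 ?sqrtr_ge0.
have w1 : \sum_(b <- below N) w b ^+ 2 <= 1.
  under eq_bigr do rewrite expr_div_n.
  rewrite -mulr_suml -/(section N x) -S2.
  by have [->|n0] := eqVneq (S ^+ 2) 0; rewrite ?mul0r ?ler01// divff.
have fw j : nm s (f j) <= w (block j).
  by rewrite nmM nm_ofR ger0_norm// ler_piMr// phase_le1.
exists (Test w0 w1 fw); split=> //; rewrite /ev /= big_block.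
transitivity (ofR s (section N x / S)).
  rewrite /section mulr_suml ofR_sum; apply: eq_bigr => b _.
  rewrite expr2 -mulrA -[in RHS]/(w b) mulrC {1}/block_sum mulr_sumr ofR_sum.
  apply: eq_bigr => j /eqP bj.
  by rewrite /f bj -mulrA phaseE -ofRM.
congr (ofR s _); rewrite -/S -S2 expr2.
by have [->|n0] := eqVneq S 0; rewrite ?mulr0 ?mul0r// mulfK.
Qed.

Section in_the_space.
Variable c : bool.
Implicit Types z : space s c.

Lemma section_le N z : section N z <= nm s z ^+ 2.
Proof.
have [d [_ dE]] := norming_test N z.
have := ev_le d z; rewrite dE nm_ofR ger0_norm ?sqrtr_ge0// => h.
by rewrite -(sqr_sqrtr (section_ge0 N z)) ler_pXn2r ?nnegrE ?sqrtr_ge0 ?nm_ge0.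
Qed.

Lemma nm_le_section z M : 0 <= M -> (forall N, section N z <= M) -> nm s z ^+ 2 <= M.
Proof.
move=> M0 h; rewrite -(sqr_sqrtr M0) ler_pXn2r ?nnegrE ?sqrtr_ge0 ?nm_ge0//.
apply: nm_space_le => d.
rewrite -(@ler_pXn2r _ 2) ?nnegrE ?sqrtr_ge0 ?nm_ge0// sqr_sqrtr//.
exact: le_trans (ev_le_section _ _) (h _).
Qed.

Lemma section_approx z e : 0 < e -> exists N, nm s z ^+ 2 <= section N z + e.
Proof.
move=> e0; apply: contrapT => h.
have hN N : section N z <= nm s z ^+ 2 - e.
  rewrite lerBrDr leNgt; apply/negP => /ltW hlt; apply: h; exists N; lra.
have h0 : 0 <= nm s z ^+ 2 - e by exact: le_trans (section_ge0 0 z) (hN 0%N).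
by have := nm_le_section h0 hN; lra.
Qed.
End in_the_space.

End block_norm.

Section windows.
Variables (R : realType) (K : numFieldType) (s : scalars R K).

Lemma space_ext c (x y : space s c) : (forall j, coord x j = coord y j :> K) -> x = y.
Proof. by move=> h; apply: val_inj; apply/funext => j; exact: h. Qed.

Lemma coordBE c (x y : space s c) j : coord (x - y) j = coord x j - coord y j :> K.
Proof. by rewrite coordB. Qed.

Lemma coordZE c a (x : space s c) j : coord (a *: x) j = a * coord x j :> K.
Proof. by rewrite coordZ. Qed.

Definition window (n N : nat) (x : seq bool -> K^o) : seq bool -> K^o :=
  fun j => if (n <= size j < N)%N then x j else 0.

Definition block_weight (d : test s) b : R :=
  if (size b < test_rank d)%N then test_weight d b else 0.

Definition window_weight n N (d : test s) : R :=
  \sum_(b <- below N | (n <= size b)%N) block_weight d b ^+ 2.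

Lemma window_weight_ge0 n N d : 0 <= window_weight n N d.
Proof. by apply: sumr_ge0 => b _; exact: sqr_ge0. Qed.

Lemma block_weight_sum_le1 N (d : test s) :
  \sum_(b <- below N) block_weight d b ^+ 2 <= 1.
Proof.
apply: le_trans (test_weight_le1 d).
rewrite (bigID (fun b => size b < test_rank d)%N) /= [X in _ + X]big1 => [|b /negbTE h]; last first.
  by rewrite /block_weight h expr0n.
rewrite addr0.
have -> : \sum_(b <- below N | (size b < test_rank d)%N) block_weight d b ^+ 2 =
    \sum_(b <- below N | (size b < test_rank d)%N) test_weight d b ^+ 2.
  by apply: eq_bigr => b h; rewrite /block_weight h.
rewrite -[X in X <= _]big_filter.
have -> : \sum_(b <- below (test_rank d)) test_weight d b ^+ 2 =
    \sum_(b <- below (test_rank d) | (size b < N)%N) test_weight d b ^+ 2 +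
    \sum_(b <- below (test_rank d) | ~~ (size b < N)%N) test_weight d b ^+ 2.
  by rewrite [LHS](bigID (fun b => size b < N)%N).
rewrite -[X in _ <= X + _]big_filter.
have PE : perm_eq [seq b <- below N | (size b < test_rank d)%N]
    [seq b <- below (test_rank d) | (size b < N)%N].
  apply: uniq_perm; rewrite ?filter_uniq ?below_uniq// => b.
  by rewrite !mem_filter !mem_below andbC.
by rewrite (perm_big _ PE) /= lerDl sumr_ge0// => b _; exact: sqr_ge0.
Qed.

Lemma window_weight_le1 n N d : window_weight n N d <= 1.
Proof.
apply: le_trans (block_weight_sum_le1 N d).
rewrite /window_weight big_mkcond /=; apply: ler_sum => b _.
by case: ifP => // _; exact: sqr_ge0.
Qed.

Lemma block_weight_ge0 d b : 0 <= block_weight d b.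
Proof. by rewrite /block_weight; case: ifP => // _; exact: test_weight_ge0. Qed.

(** Restricting a test to a window of levels gives a test times the l_2-norm of
    its weights there.  This is where the outer l_2-sum enters. *)
Lemma window_test n N (d : test s) : exists d' : test s, forall x,
  ev d (window n N x) = ofR s (Num.sqrt (window_weight n N d)) * ev d' x.
Proof.
pose S := Num.sqrt (window_weight n N d).
have S2 : S ^+ 2 = window_weight n N d by rewrite sqr_sqrtr// window_weight_ge0.
have S0 : 0 <= S by exact: sqrtr_ge0.
pose w b : R := if (n <= size b < N)%N then block_weight d b / S else 0.
pose f j : K := if (n <= size j < N)%N && (size j < test_rank d)%N
  then ofR s S^-1 * test_coef d j else 0.
have w0 b : 0 <= w b.
  by rewrite /w; case: ifP => // _; rewrite divr_ge0// block_weight_ge0.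
have w1 : \sum_(b <- below N) w b ^+ 2 <= 1.
  have -> : \sum_(b <- below N) w b ^+ 2 = window_weight n N d / S ^+ 2.
    rewrite /window_weight [in RHS]big_mkcond /= mulr_suml big_seq [RHS]big_seq.
    apply: eq_bigr => b; rewrite mem_below /w => ->; rewrite andbT.
    by case: ifP => _; rewrite ?mul0r ?expr0n// expr_div_n.
  rewrite -S2; have [->|n0] := eqVneq (S ^+ 2) 0; first by rewrite mul0r ler01.
  by rewrite divff.
have fw j : nm s (f j) <= w (block j).
  rewrite /f /w /block_weight size_block; case: (boolP (n <= size j < N)%N) => _ /=;
    last by rewrite nm0.
  case: ifP => _; last by rewrite nm0 mul0r.
  rewrite nmM nm_ofR ger0_norm ?invr_ge0// mulrC ler_wpM2r ?invr_ge0//.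
  exact: test_coef_le.
exists (Test w0 w1 fw) => x; rewrite /ev /= mulr_sumr -/S.
pose G j : K := if (n <= size j < N)%N && (size j < test_rank d)%N
  then test_coef d j * x j else 0.
have GE j : (n <= size j < N)%N -> (size j < test_rank d)%N ->
    test_coef d j * x j = ofR s S * (ofR s S^-1 * test_coef d j * x j).
  move=> jn jd; rewrite !mulrA -ofRM.
  have [S_eq0|n0] := eqVneq S 0; last by rewrite divff// ofR1 mul1r.
  suff -> : test_coef d j = 0 by rewrite mulr0 mul0r.
  apply: (@nm0_eq0 _ _ s K); apply/eqP; rewrite eq_le nm_ge0 andbT.
  apply: le_trans (test_coef_le d j) _.
  have jN : block j \in below N by rewrite mem_below size_block; case/andP: jn.
  have : test_weight d (block j) ^+ 2 <= S ^+ 2.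
    rewrite S2 /window_weight big_mkcond /= (bigD1_seq _ jN (below_uniq N)) /=.
    rewrite size_block; case/andP: jn => -> _.
    rewrite /block_weight size_block jd lerDl sumr_ge0// => b _.
    by case: ifP => // _; exact: sqr_ge0.
  by rewrite S_eq0 ler_pXn2r ?nnegrE ?test_weight_ge0.
transitivity (\sum_(j <- below (maxn N (test_rank d))) G j).
  rewrite [RHS](bigID (fun j => j \in below (test_rank d))) /= [X in _ + X]big1 ?addr0; last first.
    by move=> j; rewrite mem_below /G => /negbTE ->; rewrite andbF.
  have PE : perm_eq [seq j <- below (maxn N (test_rank d)) | j \in below (test_rank d)]
      (below (test_rank d)).
    apply: uniq_perm; rewrite ?filter_uniq ?below_uniq// => j.
    by rewrite mem_filter !mem_below leq_max; case: ltnP; rewrite ?orbT.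
  rewrite -[RHS]big_filter (perm_big _ PE) [LHS]big_seq [RHS]big_seq; apply: eq_bigr => j; rewrite mem_below /G /window => ->.
  by rewrite andbT; case: ifP => // _; rewrite mulr0.
rewrite (bigID (fun j => j \in below N)) /= [X in _ + X]big1 ?addr0; last first.
  by move=> j; rewrite mem_below /G => /negbTE ->; rewrite andbF.
have PE : perm_eq [seq j <- below (maxn N (test_rank d)) | j \in below N] (below N).
  apply: uniq_perm; rewrite ?filter_uniq ?below_uniq// => j.
  by rewrite mem_filter !mem_below leq_max; case: ltnP.
rewrite -[LHS]big_filter (perm_big _ PE); apply: eq_bigr => j _; rewrite /G /f.
case: ifP => [/andP[h1 h2]|_]; last by rewrite mul0r mulr0.
exact: GE.
Qed.

Local Notation Z := (space s false).

Lemma in_spaceP (x : seq bool -> K^o) : bounded_seq s x -> in_space_pred s false x.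
Proof. by move=> h; apply/asboolP. Qed.

Section embeddings.
Variable c : bool.
Implicit Types x : space s c.

Lemma bounded_window n N x : bounded_seq s (window n N x).
Proof.
exists (nm s x) => d; have [d' ->] := window_test n N d.
rewrite nmM nm_ofR ger0_norm ?sqrtr_ge0//; apply: le_trans (ev_le d' x).
have S1 : Num.sqrt (window_weight n N d) <= 1.
  by rewrite -sqrtr1 ler_wsqrtr// window_weight_le1.
by rewrite ler_piMl ?nm_ge0.
Qed.

Definition win n N x : Z := Space (in_spaceP (bounded_window n N x)).

Definition incl x : Z := Space (in_spaceP (asboolW (coordP x)).1).

Lemma inclP a x y : incl (a *: x + y) = a *: incl x + incl y.
Proof. exact: val_inj. Qed.

Lemma nm_incl x : nm s (incl x) = nm s x.
Proof. by rewrite !nm_space. Qed.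

Lemma window_sub n N x : (n <= N)%N -> win n N x = win 0 N x - win 0 n x.
Proof.
move=> nN; apply: space_ext => j; rewrite coordBE /= /window /=; case: (leqP n (size j)) => h /=; first by rewrite subr0.
by rewrite (leq_trans h nN) subrr.
Qed.

Lemma tail_section N M x :
  section s M (coord (incl x - win 0 N x)) + section s N x <= section s (maxn M N) x.
Proof.
set y := coord _.
have yE j : y j = if (size j < N)%N then 0 else x j.
  by rewrite /y coordBE /= /window /=; case: ifP => _; rewrite ?subrr ?subr0.
have bE b : block_sum s y b = if (size b < N)%N then 0 else block_sum s x b.
  rewrite /block_sum; case: ifP => h.
    apply: big1_seq => j /andP[_]; rewrite mem_level yE => /eqP ->.
    by rewrite h nm0.
  rewrite big_seq_cond [RHS]big_seq_cond; apply: eq_bigr => j /andP[].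
  by rewrite mem_level yE => /eqP ->; rewrite h.
apply: le_trans (lerD (section_mono s y (leq_maxl M N)) (lexx _)) _.
rewrite [leRHS](bigID (fun b => size b < N)%N) /= addrC; apply: lerD.
  rewrite /section [leRHS]big_mkcond /=; apply: ler_sum => b _; rewrite bE.
  by case: ifP => //= _; rewrite expr0n.
have PE : perm_eq [seq b <- below (maxn M N) | (size b < N)%N] (below N).
  apply: uniq_perm; rewrite ?filter_uniq ?below_uniq// => b.
  by rewrite mem_filter !mem_below leq_max; case: ltnP; rewrite ?orbT.
have -> : section s N x = \sum_(b <- below (maxn M N) | (size b < N)%N)
    block_sum s x b ^+ 2 by rewrite -[RHS]big_filter (perm_big _ PE).
exact: lexx.
Qed.

(** The outer sum is an l_2-sum, so tails are controlled by the missing part of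
    the norm. *)
Lemma tail_small x e : 0 < e -> exists N0, forall N, (N0 <= N)%N ->
  nm s (incl x - win 0 N x) ^+ 2 <= e.
Proof.
move=> e0; have [N0 hN0] := section_approx x e0; exists N0 => N N0N.
apply: nm_le_section => [|M]; first exact: ltW.
have := tail_section N M x; have := section_le (maxn M N) x.
by have := section_mono s x N0N; lra.
Qed.
End embeddings.

Lemma unit_vector_exists j : exists e : Z, forall k, coord e k = (k == j)%:R :> K.
Proof.
have h : bounded_seq s (fun k => (k == j)%:R : K^o).
  exists 1 => d; rewrite /ev.
  have [jd|jd] := boolP (j \in below (test_rank d)); last first.
    rewrite big1_seq ?nm0 ?ler01// => k /= kd.
    by have [kj|_] := eqVneq k j; [move: jd; rewrite -kj kd|rewrite mulr0].
  rewrite (bigD1_seq _ jd (below_uniq _)) /= eqxx mulr1 big1 ?addr0; last first.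
    by move=> k /negbTE ->; rewrite mulr0.
  apply: le_trans (test_coef_le _ _) _.
  rewrite -(@expr_le1 _ 2) ?test_weight_ge0//; apply: le_trans (test_weight_le1 d).
  have bj : block j \in below (test_rank d) by rewrite mem_below size_block -mem_below.
  rewrite (bigD1_seq _ bj (below_uniq _)) /= lerDl sumr_ge0// => b _.
  exact: sqr_ge0.
by exists (Space (in_spaceP h)).
Qed.

Definition unit_vector j : Z := projT1 (cid (unit_vector_exists j)).

Lemma unit_vectorE j k : coord (unit_vector j) k = (k == j)%:R :> K.
Proof. exact: projT2 (cid (unit_vector_exists j)) k. Qed.

Lemma coord_sum c I (r : seq I) (F : I -> space s c) k :
  coord (\sum_(i <- r) F i) k = \sum_(i <- r) coord (F i) k :> K.
Proof.
elim: r => [|i r ih]; first by rewrite !big_nil coord0.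
by rewrite !big_cons coordD -ih.
Qed.

Lemma win_sum c N (x : space s c) :
  win 0 N x = \sum_(j <- below N) (coord x j : K) *: unit_vector j.
Proof.
apply: space_ext => k; rewrite coord_sum.
under eq_bigr do rewrite coordZE unit_vectorE.
rewrite /= /window /=; case: ifP => h.
  have kN : k \in below N by rewrite mem_below.
  rewrite (bigD1_seq _ kN (below_uniq _)) /= eqxx mulr1 big1 ?addr0// => j jk.
  by rewrite eq_sym (negbTE jk) mulr0.
rewrite big1_seq// => j /=; rewrite mem_below => jN.
have [kj|] := eqVneq k j; last by rewrite mulr0.
by move: h; rewrite kj jN.
Qed.

End windows.

(** * Random signs *)

Section random_signs.
Variables (R : realType) (V : zmodType).
Implicit Types (vs : seq V) (G H : V -> R).

(** Expectation of G at the sum of the entries with independent random signs. *)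
Fixpoint rad vs G : R :=
  if vs is v :: us then
    (rad us (fun w => G (v + w)) + rad us (fun w => G (- v + w))) / 2
  else G 0.

Fixpoint signed_sums vs : seq V :=
  if vs is v :: us then
    map (fun w => v + w) (signed_sums us) ++ map (fun w => - v + w) (signed_sums us)
  else [:: 0].

Lemma rad_le_signed vs G c : (forall w, w \in signed_sums vs -> G w <= c) -> rad vs G <= c.
Proof.
elim: vs G => [|v vs ih] G /= h; first by apply: h; rewrite inE.
have h1 : rad vs (fun w => G (v + w)) <= c.
  by apply: ih => w hw; apply: h; rewrite mem_cat map_f.
have h2 : rad vs (fun w => G (- v + w)) <= c.
  by apply: ih => w hw; apply: h; rewrite mem_cat (map_f (fun w => - v + w)) ?orbT.
lra.
Qed.

Lemma rad_le vs G H : (forall w, G w <= H w) -> rad vs G <= rad vs H.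
Proof.
elim: vs G H => [|v vs ih] G H h /=; first exact: h.
have := ih (fun w => G (v + w)) (fun w => H (v + w)) (fun w => h _).
have := ih (fun w => G (- v + w)) (fun w => H (- v + w)) (fun w => h _).
lra.
Qed.

Lemma eq_rad vs G H : G =1 H -> rad vs G = rad vs H.
Proof. by move=> /funext ->. Qed.

Lemma radD vs G H : rad vs (fun w => G w + H w) = rad vs G + rad vs H.
Proof.
elim: vs G H => [|v vs ih] G H //=.
rewrite (ih (fun w => G (v + w)) (fun w => H (v + w))).
rewrite (ih (fun w => G (- v + w)) (fun w => H (- v + w))); lra.
Qed.

Lemma radZ vs a G : rad vs (fun w => a * G w) = a * rad vs G.
Proof.
elim: vs G => [|v vs ih] G //=.
rewrite (ih (fun w => G (v + w))) (ih (fun w => G (- v + w))); lra.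
Qed.

Lemma rad_cst vs a : rad vs (fun=> a) = a.
Proof. by elim: vs => [//|v vs /= ->]; lra. Qed.

Lemma rad_sum vs I (r : seq I) (F : I -> V -> R) :
  rad vs (fun w => \sum_(i <- r) F i w) = \sum_(i <- r) rad vs (F i).
Proof.
elim: r => [|i r ih].
  rewrite big_nil -[RHS](rad_cst vs); congr rad; apply/funext => w; exact: big_nil.
rewrite big_cons -ih -radD; apply: eq_rad => w; exact: big_cons.
Qed.

Lemma rad_jensen vs G : rad vs G ^+ 2 <= rad vs (fun w => G w ^+ 2).
Proof.
set m := rad vs G.
have : rad vs (fun=> 0) <= rad vs (fun w => G w ^+ 2 + (- (2 * m) * G w + m ^+ 2)).
  apply: rad_le => w; have := sqr_ge0 (G w - m); congr (_ <= _); ring.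
rewrite rad_cst radD radD radZ rad_cst -/m; lra.
Qed.

(** The mixed terms average out. *)
Lemma rad_bilinear vs (G : V -> V -> R) :
  (forall x y z, G (x + y) z = G x z + G y z) ->
  (forall x y z, G z (x + y) = G z x + G z y) ->
  rad vs (fun w => G w w) = \sum_(v <- vs) G v v.
Proof.
move=> GDl GDr; have Gl z : G 0 z = 0.
  by have := GDl 0 0 z; rewrite addr0; lra.
have Gr z : G z 0 = 0 by have := GDr 0 0 z; rewrite addr0; lra.
have GNl x z : G (- x) z = - G x z by have := GDl x (- x) z; rewrite subrr Gl; lra.
have GNr x z : G z (- x) = - G z x by have := GDr x (- x) z; rewrite subrr Gr; lra.
have gen : forall x, rad vs (fun w => G (x + w) (x + w)) = G x x + \sum_(v <- vs) G v v.
  elim: vs => [|v vs ih] x /=; first by rewrite big_nil !addr0.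
  under eq_rad do rewrite addrA; under [in X in _ + X]eq_rad do rewrite addrA.
  rewrite (ih (x + v)) (ih (x - v)) big_cons.
  rewrite !GDl !GDr !GNl !GNr; lra.
have := gen 0; rewrite Gl add0r => <-.
by apply: eq_rad => w; rewrite add0r.
Qed.

End random_signs.

Lemma rad_map (R : realType) (V W : zmodType) (f : V -> W) (vs : seq V) (G : W -> R) :
  f 0 = 0 -> (forall v w, f (v + w) = f v + f w) -> (forall v, f (- v) = - f v) ->
  rad (map f vs) G = rad vs (fun w => G (f w)).
Proof.
move=> f0 fD fN; elim: vs G => [|v vs ih] G /=; first by rewrite f0.
congr ((_ + _) / 2).
  by rewrite (ih (fun w => G (f v + w))); apply: eq_rad => w; rewrite fD.
by rewrite (ih (fun w => G (- f v + w))); apply: eq_rad => w; rewrite fD fN.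
Qed.

Section khintchine.
Variables (R : realType) (K : numFieldType) (s : scalars R K).
Local Notation "`n| x |" := (nm s (x : K)) (at level 0, x at level 99).

Lemma rad_second cs (x : K) :
  rad cs (fun w => nm s (x + w) ^+ 2) = nm s x ^+ 2 + \sum_(c <- cs) nm s c ^+ 2.
Proof.
elim: cs x => [|c cs ih] x /=; first by rewrite big_nil !addr0.
have e1 := ih (x + c); have e2 := ih (x - c).
under eq_rad do rewrite addrA; under [in X in _ + X]eq_rad do rewrite addrA.
rewrite e1 e2 big_cons nm_sqD nm_sqB; lra.
Qed.

(** The induction needs the starting point [x]; the constant 3 is that of the
    Gaussian fourth moment. *)
Lemma rad_fourth cs (x : K) :
  rad cs (fun w => (nm s (x + w) ^+ 2) ^+ 2) <= (nm s x ^+ 2) ^+ 2 +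
    6 * nm s x ^+ 2 * (\sum_(c <- cs) nm s c ^+ 2) + 3 * (\sum_(c <- cs) nm s c ^+ 2) ^+ 2.
Proof.
elim: cs x => [|c cs ih] x /=; first by rewrite big_nil addr0 mulr0 expr0n mulr0 !addr0.
have e1 := ih (x + c); have e2 := ih (x - c).
under eq_rad do rewrite addrA; under [in X in _ + X]eq_rad do rewrite addrA.
rewrite big_cons; set S := \sum_(c <- cs) _ in e1 e2 *.
have S0 : 0 <= S by apply: sumr_ge0 => k _; exact: sqr_ge0.
have cs2 : re s (x * cj s c) ^+ 2 <= nm s x ^+ 2 * nm s c ^+ 2.
  rewrite -exprMn -[nm s c](nm_cj s) -nmM -[X in X <= _]real_normK ?num_real//.
  by rewrite ler_pXn2r ?nnegrE ?nm_ge0// re_le_nm.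
rewrite nm_sqD in e1; rewrite nm_sqB in e2.
set a := nm s x ^+ 2 in cs2 e1 e2 *; set b := nm s c ^+ 2 in cs2 e1 e2 *.
set t := re s (x * cj s c) in cs2 e1 e2 *.
have b0 : 0 <= b by exact: sqr_ge0.
have : ((a + b + 2 * t) ^+ 2 + (a + b - 2 * t) ^+ 2) / 2 +
  6 * (a + b) * S + 3 * S ^+ 2 <= a ^+ 2 + 6 * a * (b + S) + 3 * (b + S) ^+ 2.
  have b2 : 0 <= b ^+ 2 by exact: sqr_ge0.
  rewrite -subr_ge0.
  have -> : a ^+ 2 + 6 * a * (b + S) + 3 * (b + S) ^+ 2 -
   (((a + b + 2 * t) ^+ 2 + (a + b - 2 * t) ^+ 2) / 2 +
  6 * (a + b) * S + 3 * S ^+ 2) = 4 * (a * b - t ^+ 2) + 2 * b ^+ 2 by field.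
  lra.
lra.
Qed.

(** Integrate the pointwise inequality 9 g^2 t^2 - t^4 <= 27 g^3 t, where t is the
    absolute value of the random sum and g^2 its second moment, and bound the
    fourth moment by 3 g^4. *)
Lemma khintchine (cs : seq K) : Num.sqrt (\sum_(c <- cs) nm s c ^+ 2) <= 9 / 2 * rad cs (fun w : K => nm s w).
Proof.
set S := \sum_(c <- cs) _.
have S0 : 0 <= S by apply: sumr_ge0 => k _; exact: sqr_ge0.
set g := Num.sqrt S; have g0 : 0 <= g by exact: sqrtr_ge0.
have gS : g ^+ 2 = S by exact: sqr_sqrtr.
have r0 : 0 <= rad cs (fun w : K => nm s w).
  by rewrite -(rad_cst cs 0); apply: rad_le => w; exact: nm_ge0.
have [->|gn0] := eqVneq g 0; first by rewrite mulr_ge0// divr_ge0.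
have gp : 0 < g by rewrite lt_def gn0.
have := rad_second cs 0; have := rad_fourth cs 0.
rewrite nm0 !expr0n /= mulr0 mul0r !add0r -/S.
under eq_rad do rewrite add0r; under [in X in _ -> X]eq_rad do rewrite add0r.
move=> h4 h2.
have : rad cs (fun w => 9 * S * nm s w ^+ 2 + (-1) * (nm s w ^+ 2) ^+ 2) <=
    rad cs (fun w => 27 * (S * g) * nm s w).
  apply: rad_le => w; rewrite -gS; set t := nm s w.
  have t0 : 0 <= t by exact: nm_ge0.
  have [tg|tg] := leP t (3 * g).
    have : 0 <= t * (9 * g ^+ 2) * (3 * g - t) by rewrite !mulr_ge0 ?subr_ge0// ?sqr_ge0.
    have : 0 <= (t ^+ 2) ^+ 2 by exact: sqr_ge0.
    nra.
  have h1 : 9 * g ^+ 2 <= t ^+ 2 by rewrite -[9](_ : 3 ^+ 2 = _) -?exprMn ?ler_pXn2r ?nnegrE ?mulr_ge0// ?ltW//; ring.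
  have : 0 <= t ^+ 2 * (t ^+ 2 - 9 * g ^+ 2) by rewrite mulr_ge0 ?sqr_ge0 ?subr_ge0.
  have : 0 <= 27 * (g ^+ 2 * g) * t by rewrite !mulr_ge0// ?sqr_ge0.
  nra.
rewrite radD !radZ h2 => h.
have : S * (6 * g ^+ 2) <= S * (27 * g * rad cs (fun w : K => nm s w)).
  rewrite gS; apply: le_trans (_ : 9 * S * S + -1 * (3 * S ^+ 2) <= _).
    lra.
  have -> : S * (27 * g * rad cs (fun w : K => nm s w)) = 27 * (S * g) * rad cs (fun w : K => nm s w) by ring.
  lra.
have Sp : 0 < S by rewrite -gS exprn_gt0.
rewrite ler_pM2l// => h'.
have : g * (6 * g) <= g * (27 * rad cs (fun w : K => nm s w)) by lra.
rewrite ler_pM2l//; lra.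
Qed.

End khintchine.

(** * Cotype 2 and Maurey's factorization *)

Lemma minkowski_l1l2 (R : realType) (I J : Type) (r : seq I) (q : seq J) (P : pred J)
    (a : I -> J -> R) :
  \sum_(i <- r) (\sum_(j <- q | P j) a i j) ^+ 2 <=
  (\sum_(j <- q | P j) Num.sqrt (\sum_(i <- r) a i j ^+ 2)) ^+ 2.
Proof.
have -> : \sum_(i <- r) (\sum_(j <- q | P j) a i j) ^+ 2 =
    \sum_(j <- q | P j) \sum_(k <- q | P k) \sum_(i <- r) a i j * a i k.
  under eq_bigr do rewrite expr2 big_distrlr /=.
  rewrite exchange_big /=; apply: eq_bigr => j _.
  by rewrite exchange_big.
rewrite expr2 big_distrlr /=; apply: ler_sum => j _; apply: ler_sum => k _.
apply: le_trans (ler_norm _) _.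
rewrite -(@ler_pXn2r _ 2) ?nnegrE ?mulr_ge0 ?sqrtr_ge0//.
rewrite real_normK ?num_real// exprMn !sqr_sqrtr ?sumr_ge0// => [|i _|i _]; try exact: sqr_ge0.
exact: sum_cauchy_schwarz.
Qed.

Section cotype.
Variables (R : realType) (K : numFieldType) (s : scalars R K) (c : bool).
Local Notation X := (space s c).

(** Khintchine's inequality in each coordinate, after exchanging the l_2-sum over
    the family with the l_1-sum over a block; Jensen's inequality handles the outer l_2-sum. *)
Lemma cotype2_section (xs : seq X) N :
  \sum_(x <- xs) section s N x <= (9 / 2) ^+ 2 * rad xs (fun w => section s N w).
Proof.
rewrite /section rad_sum exchange_big /= mulr_sumr; apply: ler_sum => b _.
apply: le_trans (ler_wpM2l (sqr_ge0 _) (rad_jensen _ _)).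
rewrite -exprMn; apply: le_trans (minkowski_l1l2 _ _ _ _) _.
rewrite ler_pXn2r ?nnegrE//; last 2 first.
- by apply: sumr_ge0 => j _; exact: sqrtr_ge0.
- rewrite mulr_ge0// ?divr_ge0// -(rad_cst xs 0); apply: rad_le => w.
  exact: block_sum_ge0.
rewrite /block_sum big_mkcond /=.
have -> : (fun w : X => \sum_(j <- level (size b) | block j == b) nm s (coord w j : K)) =
    (fun w : X => \sum_(j <- level (size b)) (if block j == b then nm s (coord w j : K) else 0)).
  by apply/funext => w; rewrite big_mkcond.
rewrite rad_sum mulr_sumr; apply: ler_sum => j _.
case: ifP => _; last by rewrite rad_cst mulr0.
have := khintchine s (map (fun x : X => coord x j : K) xs).
by rewrite big_map rad_map.
Qed.

Lemma sum_le_section (xs : seq X) B :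
  (forall N, \sum_(x <- xs) section s N x <= B) -> \sum_(x <- xs) nm s x ^+ 2 <= B.
Proof.
move=> h; apply/ler_addgt0Pr => e e0.
have [N hN] : exists N, \sum_(x <- xs) nm s x ^+ 2 <= \sum_(x <- xs) section s N x + e.
  elim: xs e e0 {h} => [|x xs ih] e e0; first by exists 0%N; rewrite !big_nil add0r ltW.
  have [N1 h1] := ih _ (divr_gt0 e0 (ltr0Sn R 1)).
  have [N2 h2] := section_approx x (divr_gt0 e0 (ltr0Sn R 1)).
  exists (maxn N1 N2); rewrite !big_cons.
  have := section_mono s x (leq_maxr N1 N2).
  have : \sum_(x <- xs) section s N1 x <= \sum_(x <- xs) section s (maxn N1 N2) x.
    by apply: ler_sum => y _; apply: section_mono; exact: leq_maxl.
  lra.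
by apply: le_trans hN _; rewrite lerD2r.
Qed.

Lemma cotype2 (xs : seq X) :
  \sum_(x <- xs) nm s x ^+ 2 <= (9 / 2) ^+ 2 * rad xs (fun w => nm s w ^+ 2).
Proof.
apply: sum_le_section => N; apply: le_trans (cotype2_section xs N) _.
rewrite ler_wpM2l ?sqr_ge0//; apply: rad_le => w; exact: section_le.
Qed.

End cotype.

Section maurey.
Variables (R : realType) (K : numFieldType) (s : scalars R K) (c : bool).
Local Notation X := (space s c).
Variables (m : nat) (x : 'I_m.+1 -> X).
Local Notation F := ('I_m.+1 -> K^o).

Definition synth (f : F) : X := \sum_i (f i : K) *: x i.

Lemma synthD f g : synth (f + g) = synth f + synth g.
Proof. by rewrite /synth -big_split /=; apply: eq_bigr => i _; rewrite scalerDl. Qed.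

Lemma synthN f : synth (- f) = - synth f.
Proof. by rewrite /synth -sumrN; apply: eq_bigr => i _; rewrite scaleNr. Qed.

Lemma synth0 : synth 0 = 0.
Proof. by rewrite /synth big1// => i _; rewrite scale0r. Qed.

Lemma synthZ (a : K) f : synth (fun i => a * f i) = a *: synth f.
Proof. by rewrite /synth scaler_sumr; apply: eq_bigr => i _; rewrite scalerA. Qed.

(** The operator [synth] from the m+1 dimensional maximum-norm space has squared
    2-summing norm at most k. *)
Definition two_summing (k : R) := forall (fs : seq F) W, 0 < W ->
  (forall i, \sum_(f <- fs) nm s (f i : K) ^+ 2 <= W) ->
  \sum_(f <- fs) nm s (synth f) ^+ 2 <= k * W.

Lemma two_summing_weights k : 0 <= k -> two_summing k ->
  exists mu : 'I_m.+1 -> R, [/\ forall i, 0 <= mu i, \sum_i mu i <= k &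
    forall f, nm s (synth f) ^+ 2 <= \sum_i mu i * nm s (f i : K) ^+ 2].
Proof.
move=> k0 hk.
pose g (fs : seq F) i := \sum_(f <- fs) nm s (f i : K) ^+ 2.
pose C (h : 'I_m.+1 -> R) a := exists fs : seq F,
  h = g fs /\ a = \sum_(f <- fs) nm s (synth f) ^+ 2.
have allb (h : 'I_m.+1 -> R) : bnd h.
  exists (\sum_i `|h i|) => i; rewrite (bigD1 i)//= lerDl sumr_ge0// => j _.
have hC : cone C.
  split=> //.
  - by exists [::]; split; [apply/funext => i; rewrite /g big_nil | rewrite big_nil].
  - move=> h a h' a' [fs [-> ->]] [fs' [-> ->]]; exists (fs ++ fs').
    by split; [apply/funext => i; rewrite /g big_cat|rewrite big_cat].
  - move=> t h a t0 [fs [-> ->]].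
    exists (map (fun f i => ofR s (Num.sqrt t) * f i) fs); split.
      apply/funext => i; rewrite /g big_map mulr_sumr; apply: eq_bigr => f _.
      by rewrite nmM nm_ofR ger0_norm ?sqrtr_ge0// exprMn sqr_sqrtr.
    rewrite big_map mulr_sumr; apply: eq_bigr => f _.
    by rewrite synthZ nmZ nm_ofR ger0_norm ?sqrtr_ge0// exprMn sqr_sqrtr.
have [|L [fL dL hL]] := pietsch ord0 k0 hC.
  move=> h a M [fs [-> ->]] hM; apply/ler_addgt0Pr => e e0.
  have M0 : 0 <= M by apply: le_trans (hM ord0); apply: sumr_ge0 => f _; exact: sqr_ge0.
  have e1 : 0 < e / (k + 1) by rewrite divr_gt0// ltr_wpDl.
  apply: le_trans (hk fs (M + e / (k + 1)) _ _) _.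
  - exact: ltr_wpDl.
  - by move=> i; apply: le_trans (hM i) _; rewrite lerDl ltW.
  - have k1 : 0 < k + 1 by rewrite ltr_wpDl.
    rewrite mulrDr lerD2l mulrA ler_pdivrMr//; lra.
pose mu i := L (fun j => (j == i)%:R).
have LE h : L h = \sum_i mu i * h i.
  transitivity (L (fun j => \sum_i h i * (j == i)%:R)).
    congr L; apply/funext => j; rewrite (bigD1 j)//= eqxx mulr1 big1 ?addr0// => i.
    by rewrite eq_sym => /negbTE ->; rewrite mulr0.
  rewrite (functional_sum fL)//; apply: eq_bigr => i _.
  by rewrite (functionalZ fL)// mulrC.
exists mu; split=> [i| |f].
- by apply: (functional_ge0 fL dL) => // j; rewrite ler0n.
- have -> : \sum_i mu i = L (fun=> 1) by rewrite LE; apply: eq_bigr => i _; rewrite mulr1.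
  by rewrite -[leRHS]mulr1; apply: dL.
- rewrite -LE; apply: hL; exists [:: f]; split; last by rewrite big_seq1.
  by apply/funext => i; rewrite /g big_seq1.
Qed.

Hypothesis x_weak : forall f : F, (forall i, nm s (f i : K) <= 1) -> nm s (synth f) <= 1.

Lemma synth_sup (f : F) T : 0 < T -> (forall i, nm s (f i : K) <= T) ->
  nm s (synth f) <= T.
Proof.
move=> T0 hf; have -> : f = (fun i => ofR s T * (ofR s T^-1 * f i)).
  by apply/funext => i; rewrite mulrA -ofRM divff ?gt_eqF// ofR1 mul1r.
rewrite synthZ nmZ nm_ofR gtr0_norm// ger_pMr//; apply: x_weak => i.
by rewrite nmM nm_ofR gtr0_norm ?invr_gt0// ler_pdivrMl// mulr1.
Qed.

Lemma two_summing_start : exists2 k, 0 <= k & two_summing k.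
Proof.
exists (m.+1%:R * m.+1%:R) => [|fs W W0 hW]; first by rewrite mulr_ge0.
have hx i : nm s (x i) <= 1.
  have -> : x i = synth (fun j => (j == i)%:R).
    rewrite /synth (bigD1 i)//= eqxx scale1r big1 ?addr0// => j /negbTE ->.
    by rewrite scale0r.
  apply: x_weak => j; case: (j == i); rewrite ?nm0 ?ler01//.
  by rewrite [X in X <= _]nm1.
have hs f : nm s (synth f) ^+ 2 <= m.+1%:R * \sum_i nm s (f i : K) ^+ 2.
  apply: (@le_trans _ _ ((\sum_i 1 * nm s (f i : K)) ^+ 2)).
    rewrite ler_pXn2r ?nnegrE ?nm_ge0//; last first.
      by apply: sumr_ge0 => i _; rewrite mul1r nm_ge0.
    apply: le_trans (nm_sum _ _ _ _) _; apply: ler_sum => i _.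
    by rewrite nmZ mulrC ler_wpM2r ?nm_ge0.
  apply: le_trans (sum_cauchy_schwarz _ _ _) _.
  under eq_bigr do rewrite expr1n.
  by rewrite sumr_const card_ord.
apply: le_trans (ler_sum _ (fun f _ => hs f)) _.
rewrite -mulr_sumr -mulrA ler_wpM2l// exchange_big /=.
apply: le_trans (ler_sum _ (fun i _ => hW i)) _.
by rewrite sumr_const card_ord mulr_natl.
Qed.

(** By cotype 2, the sum is bounded by the average of the squared norm of synth w
    over random w.  Cut w at height T: the bounded part costs at most T^2, the large
    part is controlled by the weights, which gain a factor T^-2 from the fourth
    moment.  A suitable T turns the bound k into a constant plus k / 2. *)
Lemma two_summing_improve k : 0 <= k -> two_summing k ->
  two_summing (24 * ((9 / 2) ^+ 2) ^+ 2 + k / 2).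
Proof.
move=> k0 hk fs W W0 hW.
have [mu [mu0 muk hmu]] := two_summing_weights k0 hk.
set A : R := (9 / 2) ^+ 2.
have A0 : 0 < A by rewrite exprn_gt0// divr_gt0.
(* the height T of the cut; 12 A makes the coefficient of k equal to 1 / 2 *)
pose T2 := 12 * A * W; have T20 : 0 < T2 by rewrite !mulr_gt0.
pose T := Num.sqrt T2; have T0 : 0 < T by rewrite sqrtr_gt0.
have T0' := ltW T0.
have TT : T ^+ 2 = T2 by rewrite sqr_sqrtr// ltW.
have trunc (w : F) : nm s (synth w) ^+ 2 <=
    2 * T2 + 2 / T2 * \sum_i mu i * (nm s (w i : K) ^+ 2) ^+ 2.
  pose w1 : F := fun i => if nm s (w i : K) <= T then w i else 0.
  pose w2 : F := fun i => if nm s (w i : K) <= T then 0 else w i.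
  have -> : synth w = synth w1 + synth w2.
    rewrite -synthD; congr synth; apply/funext => i.
    by rewrite /w1 /w2 /GRing.add /=; case: ifP; rewrite ?addr0 ?add0r.
  have h1 : nm s (synth w1) ^+ 2 <= T2.
    rewrite -TT ler_pXn2r ?nnegrE ?nm_ge0//; apply: synth_sup => // i.
    by rewrite /w1; case: ifP => // _; rewrite [X in X <= _]nm0.
  have h2 : nm s (synth w2) ^+ 2 <= T2^-1 * \sum_i mu i * (nm s (w i : K) ^+ 2) ^+ 2.
    apply: le_trans (hmu w2) _; rewrite mulr_sumr; apply: ler_sum => i _.
    rewrite [leRHS]mulrCA; apply: ler_wpM2l => //; rewrite /w2 ler_pdivlMl//; case: ifPn => [_|].
      by rewrite [nm s _]nm0 expr0n mulr0 sqr_ge0.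
    rewrite -ltNge => hT; rewrite expr2 ler_wpM2r ?sqr_ge0// -TT.
    by rewrite ler_pXn2r ?nnegrE ?nm_ge0 ?ltW.
  apply: (@le_trans _ _ (2 * nm s (synth w1) ^+ 2 + 2 * nm s (synth w2) ^+ 2)).
    apply: le_trans (_ : (nm s (synth w1) + nm s (synth w2)) ^+ 2 <= _).
      by rewrite ler_pXn2r ?nnegrE ?addr_ge0 ?nm_ge0// nm_triangle.
    by have := sqr_ge0 (nm s (synth w1) - nm s (synth w2)); lra.
  have -> u : 2 / T2 * u = 2 * (T2^-1 * u) by ring.
  lra.
have := cotype2 (map synth fs); rewrite big_map rad_map; first last.
- exact: synthN.
- exact: synthD.
- exact: synth0.
move=> h; apply: le_trans h _; rewrite -/A.
have h : rad fs (fun w => nm s (synth w) ^+ 2) <= 2 * T2 + 2 / T2 * (k * (3 * W ^+ 2)).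
  apply: le_trans (rad_le _ trunc) _.
  have c0 : 0 <= 2 / T2 by rewrite divr_ge0// ltW.
  rewrite radD rad_cst radZ lerD2l; apply: ler_wpM2l => //.
  rewrite rad_sum; apply: (@le_trans _ _ (\sum_i mu i * (3 * W ^+ 2))); last first.
    by rewrite -mulr_suml ler_wpM2r// mulr_ge0 ?sqr_ge0.
  apply: ler_sum => i _; rewrite radZ; apply: ler_wpM2l => //.
  have := rad_fourth s (map (fun f : F => f i : K) fs) 0.

  rewrite big_map rad_map//= nm0 !expr0n /= mulr0 mul0r !add0r => hf.
  have -> : (fun w : F => (nm s (w i : K) ^+ 2) ^+ 2) =
            (fun w : F => (nm s (0 + w i : K) ^+ 2) ^+ 2).
    by apply/funext => w; rewrite add0r.
  apply: le_trans hf _; rewrite ler_wpM2l//.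
  by rewrite ler_pXn2r ?nnegrE ?sumr_ge0// => [f _|]; [exact: sqr_ge0|exact: ltW].
apply: le_trans (ler_wpM2l (ltW A0) h) _.
rewrite le_eqVlt; apply/orP; left; apply/eqP; rewrite /T2.
field.
by rewrite !gt_eqF.
Qed.

(** The infimum v of the admissible constants is finite and satisfies
    v <= 24 B + v / 2, hence v <= 48 B; 49 leaves room for an infimum that is not attained. *)
Lemma two_summing_universal : two_summing (49 * ((9 / 2) ^+ 2) ^+ 2).
Proof.
set B : R := ((9 / 2) ^+ 2) ^+ 2.
have B0 : 0 < B by rewrite !exprn_gt0// divr_gt0.
pose V := [set k | 0 <= k /\ two_summing k].
have [k1 k10 hk1] := two_summing_start.
have Vi : has_inf V by split; [exists k1|exists 0 => k []].
have hv : inf V <= 48 * B.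
  suff : 2 * inf V - 48 * B <= inf V by lra.
  apply: lb_le_inf; first by exists k1.
  move=> k [k0 hk]; have := two_summing_improve k0 hk; rewrite -/B => hk'.
  have : inf V <= 24 * B + k / 2.
    by apply: ge_inf; [exact: Vi.2|split=> //; rewrite addr_ge0 ?mulr_ge0 ?divr_ge0// ltW].
  lra.
have [k [k0 hk] hlt] := inf_adherent B0 Vi.
move=> fs W W0 hW; apply: le_trans (hk fs W W0 hW) _.
apply: ler_wpM2r; lra.
Qed.

End maurey.

Section one_summing.
Variables (R : realType) (K : numFieldType) (s : scalars R K) (c : bool).
Local Notation X := (space s c).

Lemma ev_sum (d : test s) I (r : seq I) (F : I -> X) :
  ev d (coord (\sum_(i <- r) F i)) = \sum_(i <- r) ev d (coord (F i)).
Proof.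
elim: r => [|i r ih]; first by rewrite !big_nil coord0 ev0.
by rewrite !big_cons coordD evD ih.
Qed.

(** The summand 1 pays for the perturbation of the weights in
    [maurey_factorization]. *)
Definition maurey_constant : R := 49 * ((9 / 2) ^+ 2) ^+ 2 + 1.

Lemma maurey_constant_ge0 : 0 <= maurey_constant.
Proof. by rewrite addr_ge0// mulr_ge0 ?sqr_ge0. Qed.

(** Splitting x i = l i * y i according to the square roots of the weights; the
    perturbation by 1 / (m + 1) keeps the l i positive. *)
Lemma maurey_factorization m (x : 'I_m.+1 -> X) :
  (forall f : 'I_m.+1 -> K^o, (forall i, nm s (f i : K) <= 1) -> nm s (synth x f) <= 1) ->
  exists (l : 'I_m.+1 -> R) (y : 'I_m.+1 -> X),
  [/\ forall i, 0 < l i, \sum_i l i ^+ 2 <= maurey_constant,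
      forall i, x i = ofR s (l i) *: y i &
      forall d : test s, \sum_i nm s (ev d (y i)) ^+ 2 <= 1].
Proof.
move=> hx; have k0 : 0 <= 49 * ((9 / 2) ^+ 2) ^+ 2 :> R by rewrite mulr_ge0 ?sqr_ge0.
have [mu [mu0 muk hmu]] := two_summing_weights k0 (two_summing_universal hx).
pose l i := Num.sqrt (mu i + m.+1%:R^-1).
have l0 i : 0 < l i by rewrite sqrtr_gt0 ltr_wpDl// invr_gt0.
have l2 i : l i ^+ 2 = mu i + m.+1%:R^-1.
  by rewrite sqr_sqrtr// addr_ge0// invr_ge0.
exists l, (fun i => ofR s (l i)^-1 *: x i); split=> //.
- under eq_bigr do rewrite l2.
  rewrite big_split /= sumr_const card_ord -[X in _ + X]mulr_natr mulVf ?pnatr_eq0//.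
  by rewrite lerD2r.
- by move=> i; rewrite scalerA -ofRM divff ?gt_eqF// ofR1 scale1r.
move=> d; set S := \sum_i _.
have S0 : 0 <= S by apply: sumr_ge0 => i _; exact: sqr_ge0.
pose a i : K^o := cj s (ev d (ofR s (l i)^-1 *: x i)) * ofR s (l i)^-1.
have evS : ev d (coord (synth x a)) = ofR s S.
  rewrite /synth ev_sum /S ofR_sum; apply: eq_bigr => i _.
  by rewrite coordZ evZ -mulrA -evZ -coordZ mulrC mul_cj.
have h : nm s (synth x a) ^+ 2 <= S.
  apply: le_trans (hmu a) _; apply: ler_sum => i _.
  rewrite /a nmM nm_cj nm_ofR gtr0_norm ?invr_gt0// exprMn mulrCA.
  rewrite ler_piMr ?sqr_ge0// exprVn l2 ler_pdivrMr ?mul1r.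
    by rewrite lerDl invr_ge0.
  by rewrite ltr_wpDl// invr_gt0.
have : S ^+ 2 <= S.
  apply: le_trans h; rewrite ler_pXn2r ?nnegrE ?nm_ge0//.
  by have := ev_le d (synth x a); rewrite evS nm_ofR ger0_norm.
have [S1|S1] := leP S 1; first by [].
by rewrite expr2 ger_pMl ?(lt_trans ltr01 S1)// leNgt S1.
Qed.

Variable N : X -> R.
Hypotheses (N0 : forall x, 0 <= N x)
  (NZ : forall t x, 0 <= t -> N (ofR s t *: x) = t * N x).

(** On a space of cotype 2, small 2-summing norm implies small 1-summing norm: a
    weakly summable family is an l_2-sequence times a weakly 2-summable family. *)
Lemma one_summing E : 0 <= E ->
  (forall xs : seq X, (forall d : test s, \sum_(x <- xs) nm s (ev d x) ^+ 2 <= 1) ->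
     \sum_(x <- xs) N x ^+ 2 <= E) ->
  forall (xs : seq X) w, 0 < w ->
    (forall d : test s, \sum_(x <- xs) nm s (ev d x) <= w) ->
    \sum_(x <- xs) N x <= Num.sqrt (maurey_constant * E) * w.
Proof.
move=> E0 hN xs w w0 hxs.
case: xs hxs => [|x0 xs] hxs; first by rewrite big_nil mulr_ge0 ?sqrtr_ge0 ?ltW.
set r := x0 :: xs in hxs *; pose m := size xs.
have sum_r (T : nmodType) (F : X -> T) : \sum_(x <- r) F x = \sum_(i < m.+1) F (nth 0 r i).
  by rewrite (big_nth 0) big_mkord.
pose x (i : 'I_m.+1) := ofR s w^-1 *: nth 0 r i.
have [|l [y [l0 lk xl hy]]] := @maurey_factorization m x.
  move=> f hf; apply: nm_space_le => d; rewrite /synth ev_sum.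
  apply: le_trans (nm_sum _ _ _ _) _.
  apply: (@le_trans _ _ (\sum_(i < m.+1) w^-1 * nm s (ev d (nth 0 r i)))).
    apply: ler_sum => i _; rewrite coordZ evZ nmM coordZ evZ nmM nm_ofR.
    rewrite gtr0_norm ?invr_gt0// ler_piMl// mulr_ge0 ?nm_ge0// invr_ge0 ltW//.
  rewrite -mulr_sumr -(sum_r _ (fun x => nm s (ev d x))) ler_pdivrMl// mulr1.
  exact: hxs.
have xE (i : 'I_m.+1) : nth 0 r i = ofR s (w * l i) *: y i :> X.
  by rewrite ofRM -scalerA -xl /x scalerA -ofRM divff ?gt_eqF// ofR1 scale1r.
rewrite sum_r (_ : \sum_(i < m.+1) _ = w * \sum_i l i * N (y i)); last first.
  rewrite mulr_sumr; apply: eq_bigr => i _.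
  by rewrite [nth _ _ _]xE NZ ?mulrA// mulr_ge0 ?ltW.
rewrite mulrC ler_pM2r//.
have S0 : 0 <= \sum_i l i * N (y i).
  by apply: sumr_ge0 => i _; rewrite mulr_ge0// ltW.
rewrite -(@ler_pXn2r _ 2) ?nnegrE ?sqrtr_ge0// sqr_sqrtr ?mulr_ge0 ?maurey_constant_ge0//.
apply: le_trans (sum_cauchy_schwarz _ _ _) _.
apply: ler_pM => //; [by apply: sumr_ge0 => i _; exact: sqr_ge0| |].
  by apply: sumr_ge0 => i _; exact: sqr_ge0.
have := hN (map y (index_enum 'I_m.+1)); rewrite big_map; apply => d.
by rewrite big_map.
Qed.

End one_summing.

(** * Inclusion and sum of summing seminorms *)

Section inclusion.
Variables (R : realType) (K : numFieldType) (s : scalars R K) (V : lmodType K).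

Definition homogeneous (g : V -> R) :=
  (forall x, 0 <= g x) /\ forall t x, 0 <= t -> g (ofR s t *: x) = t * g x.

(** p-summability of [N] with constant [C], where weak norms are computed with the
    gauges in [G].  Requiring it only for w > 0 loses nothing, by continuity in w. *)
Definition summing (G : set (V -> R)) (p C : R) (N : V -> R) :=
  forall (xs : seq V) w, 0 < w ->
    (forall g, G g -> \sum_(x <- xs) g x `^ p <= w `^ p) ->
    \sum_(x <- xs) N x `^ p <= (C * w) `^ p.

(** Apply p-summability to the family rescaled by N x ^ (q / p - 1) and use
    Young's inequality, normalized so that both sides sum to at most 1. *)
Lemma summing_inclusion G p q C N : 0 < p -> p <= q -> 0 <= C ->
  homogeneous N -> (forall g, G g -> homogeneous g) ->
  summing G p C N -> summing G q C N.
Proof.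
move=> p0 pq C0 [N0 NZ] hG hp xs w w0 hxs.
have [pE|pNq] := eqVneq p q; first by rewrite -pE in hxs *; exact: hp.
have q0 : 0 < q by exact: lt_le_trans p0 pq.
have pltq : p < q by rewrite lt_neqAle pNq.
set S := \sum_(x <- xs) N x `^ q.
have S0 : 0 <= S by apply: sumr_ge0 => x _; exact: powR_ge0.
have [->|Sn0] := eqVneq S 0; first exact: powR_ge0.
have Sp : 0 < S by rewrite lt_def Sn0.
pose al x := N x `^ (q / p - 1).
have al0 x : 0 <= al x by exact: powR_ge0.
have qp0 : 0 < q / p - 1 by rewrite subr_gt0 ltr_pdivlMr// mul1r.
have Nal x : (al x * N x) `^ p = N x `^ q.
  rewrite mulrC mulr_powRB1 ?divr_gt0// -powRrM divfK//.
  by rewrite gt_eqF.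
pose w' := (S `^ (1 - p / q) * w `^ p) `^ p^-1.
have w'0 : 0 < w' by rewrite powR_gt0// mulr_gt0// powR_gt0.
have w'p : w' `^ p = S `^ (1 - p / q) * w `^ p.
  rewrite -powRrM mulVf ?gt_eqF// powRr1// mulr_ge0 ?powR_ge0//.
have pq1 : 0 < 1 - p / q by rewrite subr_gt0 ltr_pdivrMr// mul1r.
have pq0 : 0 < p / q by rewrite divr_gt0.
have := hp (map (fun x => ofR s (al x) *: x) xs) w' w'0.
rewrite big_map; under eq_bigr do rewrite NZ// Nal.
have hG' g : G g -> \sum_(x <- map (fun x => ofR s (al x) *: x) xs) g x `^ p <= w' `^ p.
  move=> Gg; have [g0 gZ] := hG g Gg; rewrite big_map w'p.
  pose D := S `^ (1 - p / q) * w `^ p.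
  have D0 : 0 < D by rewrite mulr_gt0 ?powR_gt0.
  rewrite -/D -[leRHS]mul1r -ler_pdivrMr// mulr_suml.
  apply: (@le_trans _ _ (\sum_(x <- xs) ((1 - p / q) * (N x `^ q / S) + (p / q) * (g x `^ q / w `^ q)))).
    apply: ler_sum => x _; rewrite gZ// powRM//.
    have := @conjugate_powR _ (al x `^ p / S `^ (1 - p / q)) (g x `^ p / w `^ p)
      (1 - p / q)^-1 (p / q)^-1.
    rewrite !divr_ge0 ?powR_ge0// !invr_gt0 pq1 pq0 !invrK subrK => /(_ isT isT isT isT erefl).
    have e1 : (al x `^ p / S `^ (1 - p / q)) `^ (1 - p / q)^-1 = N x `^ q / S.
      rewrite powRM ?powR_ge0 ?invr_ge0 ?powR_ge0//; congr (_ * _).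
        rewrite /al -!powRrM; congr (_ `^ _); field.
        by rewrite !gt_eqF ?subr_gt0.
      rewrite -powRN -powRrM mulNr divff ?gt_eqF// powRN powRr1//.
    have e2 : (g x `^ p / w `^ p) `^ (p / q)^-1 = g x `^ q / w `^ q.
      rewrite powRM ?powR_ge0 ?invr_ge0 ?powR_ge0//; congr (_ * _).
        by rewrite -powRrM; congr (_ `^ _); field; rewrite !gt_eqF.
      rewrite -!powRN -powRrM; congr (_ `^ _); field; by rewrite !gt_eqF.
    rewrite e1 e2 => h; apply: le_trans (_ : _ <= al x `^ p / S `^ (1 - p / q) * (g x `^ p / w `^ p)) _.
      rewrite /D invfM le_eqVlt; apply/orP; left; apply/eqP; ring.
    apply: le_trans h _; rewrite le_eqVlt; apply/orP; left; apply/eqP; ring.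
  rewrite big_split /= -!mulr_sumr -!mulr_suml -/S divff// mulr1.
  have : (\sum_(x <- xs) g x `^ q) / w `^ q <= 1.
    by rewrite ler_pdivrMr ?powR_gt0// mul1r; exact: hxs.
  by move=> h; rewrite -[leRHS](subrK (p / q)) lerD2l ler_piMr// ltW.
move=> /(_ hG'); rewrite -/S powRM//; last exact: ltW.
rewrite w'p => h.
have h1 : S `^ (p / q) <= (C * w) `^ p.
  rewrite powRM//; last exact: ltW.
  rewrite -(ler_pM2l (powR_gt0 (1 - p / q) Sp)) -powRD; last by rewrite (gt_eqF Sp) implybT.
  rewrite subrK powRr1//; apply: le_trans h _.
  by rewrite mulrCA.
have -> : S = (S `^ (p / q)) `^ (q / p).
  have -> : S `^ (p / q) `^ (q / p) = S `^ 1.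
    by rewrite -powRrM; congr (_ `^ _); field; rewrite !gt_eqF.
  by rewrite powRr1.
apply: le_trans (ge0_ler_powR _ _ _ h1) _.
- by rewrite divr_ge0// ltW.
- by rewrite nnegrE powR_ge0.
- by rewrite nnegrE powR_ge0.
by rewrite -powRrM mulrCA divff ?gt_eqF// mulr1.
Qed.

(** Convexity with weights proportional to a and b; this yields the triangle
    inequality for sums of p-th powers without extracting roots. *)
Lemma powR_convex_sum (p a b u v : R) : 1 <= p -> 0 < a -> 0 < b -> 0 <= u -> 0 <= v ->
  (u + v) `^ p <= (a + b) `^ (p - 1) *
    (a * (u / a) `^ p + b * (v / b) `^ p).
Proof.
move=> p1 a0 b0 u0 v0; have ab0 : 0 < a + b by exact: addr_gt0.
have t0 : 0 <= a / (a + b) by rewrite divr_ge0 ?ltW.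
have t1 : a / (a + b) <= 1 by rewrite ler_pdivrMr// mul1r lerDl ltW.
have := @convex_powR R p p1 (Itv01 t0 t1) (u / a) (v / b).
have ua0 : 0 <= u / a by rewrite divr_ge0// ltW.
have vb0 : 0 <= v / b by rewrite divr_ge0// ltW.
rewrite !inE /= !in_itv /= !andbT => /(_ ua0 vb0).
move=> h; rewrite convRE [X in X `^ _ <= _]convRE /= in h.
have e : a / (a + b) * (u / a) + (1 - a / (a + b)) * (v / b) = (u + v) / (a + b).
  by field; rewrite !gt_eqF.
rewrite /unstable.onem e in h.
have e2 : u + v = (a + b) * ((u + v) / (a + b)) by field; rewrite gt_eqF.
have abn := ltW ab0; have uv0 : 0 <= (u + v) / (a + b) by rewrite divr_ge0// addr_ge0.
rewrite {1}e2 powRM//.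
apply: le_trans (ler_wpM2l (powR_ge0 _ _) h) _.
rewrite -(mulr_powRB1 (ltW ab0) (lt_le_trans ltr01 p1)).
by rewrite le_eqVlt; apply/orP; left; apply/eqP; field; rewrite gt_eqF.
Qed.

Lemma summingD G p C1 C2 (N N1 N2 : V -> R) : 1 <= p -> 0 < C1 -> 0 < C2 ->
  (forall x, 0 <= N x) -> (forall x, 0 <= N1 x) -> (forall x, 0 <= N2 x) ->
  (forall x, N x <= N1 x + N2 x) ->
  summing G p C1 N1 -> summing G p C2 N2 -> summing G p (C1 + C2) N.
Proof.
move=> p1 C10 C20 N0 N10 N20 NN h1 h2 xs w w0 hxs.
have p0 : 0 < p by exact: lt_le_trans ltr01 p1.
have CC0 : 0 < C1 + C2 by exact: addr_gt0.
have b1 := h1 _ _ w0 hxs; have b2 := h2 _ _ w0 hxs.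
apply: (@le_trans _ _ (\sum_(x <- xs) (C1 + C2) `^ (p - 1) *
    (C1 * (N1 x / C1) `^ p + C2 * (N2 x / C2) `^ p))).
  apply: ler_sum => x _; apply: le_trans (powR_convex_sum p1 C10 C20 (N10 x) (N20 x)).
  by apply: ge0_ler_powR; rewrite ?nnegrE ?addr_ge0// ltW.
rewrite -mulr_sumr big_split /= -!mulr_sumr.
have scale (C : R) (F : V -> R) : 0 < C -> (forall x, 0 <= F x) ->
    \sum_(x <- xs) F x `^ p <= (C * w) `^ p ->
    \sum_(x <- xs) (F x / C) `^ p <= w `^ p.
  move=> C0 F0 hF; have Cn := ltW C0; have wn := ltW w0.
  have Ci : 0 <= C^-1 by rewrite invr_ge0.
  under eq_bigr do rewrite powRM//.
  rewrite -mulr_suml -(powR_inv1 Cn) powRAC powR_inv1 ?powR_ge0//.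
  by rewrite ler_pdivrMr ?powR_gt0// mulrC -powRM.
apply: (@le_trans _ _ ((C1 + C2) `^ (p - 1) * (C1 * w `^ p + C2 * w `^ p))).
  apply: ler_wpM2l; first exact: powR_ge0.
  by apply: lerD; apply: ler_wpM2l; rewrite ?(ltW C10) ?(ltW C20)//; exact: scale.
rewrite -mulrDl mulrA [_ `^ _ * _]mulrC mulr_powRB1 ?(ltW CC0)//.
have CCn := ltW CC0; have wn := ltW w0.
by rewrite powRM.
Qed.

End inclusion.

(** * The Hilbertian seminorm of a 2-summing operator *)

Section integral_form.
Variables (R : realType) (K : numFieldType) (s : scalars R K).
Local Notation Z := (space s false).
Variables (L : (test s -> R) -> R) (P : R).
Hypotheses (P0 : 0 <= P) (fL : functional L) (dL : dominated P L).

Definition bndK (f : test s -> K) := bnd (fun d => re s (f d)) /\ bnd (fun d => im s (f d)).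

Definition LK (f : test s -> K) : K :=
  ofR s (L (fun d => re s (f d))) + iu s * ofR s (L (fun d => im s (f d))).

Lemma LKD f g : bndK f -> bndK g -> LK (fun d => f d + g d) = LK f + LK g.
Proof.
move=> [f1 f2] [g1 g2]; rewrite /LK.
under [X in L X]eq_fun do rewrite reD.
under [X in iu s * ofR s (L X)]eq_fun do rewrite imD.
by rewrite !(functionalD fL)// !ofRD mulrDr addrACA.
Qed.

Lemma LKZ a f : bndK f -> LK (fun d => a * f d) = a * LK f.
Proof.
move=> [f1 f2]; rewrite /LK.
have -> : (fun d => re s (a * f d)) =
    (fun d => re s a * re s (f d) + (- im s a) * im s (f d)).
  by apply/funext => d; rewrite reM mulNr.
have -> : (fun d => im s (a * f d)) =
    (fun d => re s a * im s (f d) + im s a * re s (f d)).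
  by apply/funext => d; rewrite imM.
rewrite !(functionalD fL) ?(functionalZ fL)//; try exact: bndZ.
rewrite !ofRD !ofRM ofRN [in RHS](reIm s a).
set A := ofR s (re s a); set B := ofR s (im s a).
set u := ofR s (L _); set v := ofR s (L _).
have iB : iu s * (iu s * B) = - B by exact: iuE.
have -> : (A + iu s * B) * (u + iu s * v) =
  A * u + iu s * (A * v + B * u) + (iu s * (iu s * B)) * v by ring.
rewrite iB; ring.
Qed.

Lemma LK_cj f : bndK f -> LK (fun d => cj s (f d)) = cj s (LK f).
Proof.
move=> [f1 f2]; rewrite /LK.
have -> : (fun d => re s (cj s (f d))) = (fun d => re s (f d)).
  by apply/funext => d; rewrite re_cj.
have -> : (fun d => im s (cj s (f d))) = (fun d => -1 * im s (f d)).
  by apply/funext => d; rewrite im_cj mulN1r.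
rewrite (functionalZ fL)// mulN1r ofRN mulrN.
by rewrite cjD cjM cj_iu !cjR mulNr.
Qed.

Lemma bndK_ev (x y : Z) : bndK (fun d => ev d x * cj s (ev d y)).
Proof.
have h (d : test s) : nm s (ev d x * cj s (ev d y)) <= nm s x * nm s y.
  by rewrite nmM nm_cj; apply: ler_pM; rewrite ?nm_ge0 ?ev_le.
split; exists (nm s x * nm s y) => d; apply: le_trans (h d).
  exact: re_le_nm.
rewrite -(@ler_pXn2r _ 2) ?nnegrE ?nm_ge0// nm_sq real_normK ?num_real//.
by rewrite lerDr sqr_ge0.
Qed.

(** The inner product of x and y in L_2 of the measure that [L] stands for, when
    vectors are viewed as functions on the set of tests. *)
Definition form (x y : Z) : K := LK (fun d => ev d x * cj s (ev d y)).

Lemma bnd_ev (x : Z) : bnd (fun d : test s => nm s (ev d x) ^+ 2).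
Proof.
exists (nm s x ^+ 2) => d; rewrite ger0_norm ?sqr_ge0//.
by rewrite ler_pXn2r ?nnegrE ?nm_ge0// ev_le.
Qed.

Lemma formE (x : Z) : qf s form x = L (fun d => nm s (ev d x) ^+ 2).
Proof.
rewrite /qf /form /LK reD reR reM.
set v := ofR s _; have -> : v = 0.
  rewrite /v -(ofR0 s); congr (ofR s _); rewrite -(functional0 fL).
  by congr L; apply/funext => d; rewrite mul_cj imR.
rewrite re0 im0 !mulr0 subrr addr0; congr L; apply/funext => d.
by rewrite mul_cj reR.
Qed.

Lemma form_semi_inner : semi_inner s form.
Proof.
split=> [x y z|a x y|x y|x].
- rewrite /form -LKD; [|exact: bndK_ev..].
  by congr LK; apply/funext => d; rewrite coordD evD mulrDl.
- rewrite /form -LKZ; last exact: bndK_ev.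
  by congr LK; apply/funext => d; rewrite coordZ evZ mulrA.
- rewrite /form -LK_cj; last exact: bndK_ev.
  by congr LK; apply/funext => d; rewrite cjM cjK mulrC.
- have := formE x; rewrite /qf => ->.
  apply: (functional_ge0 fL dL); first exact: bnd_ev.
  by move=> d; exact: sqr_ge0.
Qed.

Lemma form_le (x : Z) : qf s form x <= P * nm s x ^+ 2.
Proof.
rewrite formE; apply: dL; first exact: bnd_ev.
by move=> d; rewrite ler_pXn2r ?nnegrE ?nm_ge0// ev_le.
Qed.

(** The images under [L] of the squared weights of the single blocks are summable,
    because the squared weights of a test sum to at most 1.  Since [L] need not be
    countably additive, only windows of finitely many levels are estimated. *)
Lemma tail_weight e : 0 < e -> exists n, forall N, (n <= N)%N ->
  L (window_weight n N) <= e.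
Proof.
move=> e0; pose a b := L (fun d => block_weight d b ^+ 2).
have ba b : bnd (fun d : test s => block_weight d b ^+ 2).
  exists 1 => d; rewrite ger0_norm ?sqr_ge0//.
  apply: le_trans (block_weight_sum_le1 (size b).+1 d).
  have bb : b \in below (size b).+1 by rewrite mem_below.
  rewrite (bigD1_seq _ bb (below_uniq _)) lerDl sumr_ge0// => k _.
  exact: sqr_ge0.
have a0 b : 0 <= a b by apply: (functional_ge0 fL dL) => // d; exact: sqr_ge0.
have aE n N : L (window_weight n N) = \sum_(b <- below N | (n <= size b)%N) a b.
  rewrite -big_filter -(functional_sum fL)//; congr L; apply/funext => d.
  by rewrite big_filter.
pose A N := \sum_(b <- below N) a b.
have AP N : A N <= P.
  rewrite /A -(functional_sum fL)// -[leRHS]mulr1; apply: dL.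
    exact: bnd_sum.
  exact: block_weight_sum_le1.
have split n N : (n <= N)%N -> A N = A n + L (window_weight n N).
  move=> nN; rewrite aE /A (bigID (fun b => size b < n)%N) /=; congr (_ + _).
    have PE : perm_eq [seq b <- below N | (size b < n)%N] (below n).
      apply: uniq_perm; rewrite ?filter_uniq ?below_uniq// => b.
      rewrite mem_filter !mem_below andb_idr// => h; exact: leq_trans h nN.
    by rewrite -big_filter (perm_big _ PE).
  by apply: eq_bigl => b; rewrite -leqNgt.
have hs : has_sup [set A N | N in setT].
  by split; [exists (A 0%N), 0%N | exists P => _ [N _ <-]].
have [_ [n _ <-] hn] := sup_adherent e0 hs.
exists n => N nN.
have : A N <= sup [set A N | N in setT] by apply: ub_le_sup; [exact: hs.2|exists N].
have := split n N nN; lra.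
Qed.

(** On vectors supported beyond level n, the form has small 2-summing norm: a
    window first, then the rest of the tail by continuity. *)
Lemma tail_form c e : 0 < e -> exists n, forall (xs : seq (space s c)),
  (forall d : test s, \sum_(x <- xs) nm s (ev d x) ^+ 2 <= 1) ->
  \sum_(x <- xs) qf s form (incl x - win 0 n x) <= e.
Proof.
move=> e0; have e4 : 0 < e / 4 by rewrite divr_gt0.
have [n hn] := tail_weight e4; exists n => xs hxs.
have [N nN hN] : exists2 N, (n <= N)%N &
    P * \sum_(x <- xs) nm s (incl x - win 0 N x) ^+ 2 <= e / 4.
  suff [N0 hN0] : exists N0, forall N, (N0 <= N)%N ->
      P * \sum_(x <- xs) nm s (incl x - win 0 N x) ^+ 2 <= e / 4.
    by exists (maxn n N0); [exact: leq_maxl|apply: hN0; exact: leq_maxr].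
  elim: xs (e / 4) e4 {hxs} => [|x xs ih] f f0.
    by exists 0%N => N _; rewrite big_nil mulr0 ltW.
  have f2 : 0 < f / 2 by rewrite divr_gt0.
  have [N1 h1] := ih _ f2.
  have fP : 0 < f / 2 / (P + 1) by rewrite divr_gt0// ltr_wpDl.
  have [N2 h2] := tail_small x fP.
  exists (maxn N1 N2) => N; rewrite geq_max => /andP[n1 n2].
  rewrite big_cons mulrDr; have := h1 N n1; have := h2 N n2.
  rewrite ler_pdivlMr ?ltr_wpDl// => h.
  have : 0 <= nm s (incl x - win 0 N x) ^+ 2 by exact: sqr_ge0.
  lra.
apply: (@le_trans _ _ (\sum_(x <- xs) (2 * qf s form (win n N x) +
    2 * qf s form (incl x - win 0 N x)))).
  apply: ler_sum => x _; have -> : incl x - win 0 n x = win n N x + (incl x - win 0 N x).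
    by rewrite (window_sub _ nN) [RHS]addrC addrA subrK.
  exact: (qfD_le form_semi_inner).
rewrite big_split /= -!mulr_sumr.
have h1 : \sum_(x <- xs) qf s form (incl x - win 0 N x) <= e / 4.
  apply: le_trans hN; rewrite mulr_sumr; apply: ler_sum => x _; exact: form_le.
have h2 : \sum_(x <- xs) qf s form (win n N x) <= e / 4.
  apply: le_trans (hn N nN); under eq_bigr do rewrite formE.
  rewrite -(functional_sum fL); last by move=> x; exact: bnd_ev.
  apply: (functional_le fL dL).
  - by apply: bnd_sum => x; exact: bnd_ev.
  - exists 1 => d; rewrite ger0_norm ?window_weight_ge0//; exact: window_weight_le1.
  move=> d; have [d' hd'] := window_test n N d.
  have -> : \sum_(x <- xs) nm s (ev d (win n N x)) ^+ 2 =
      \sum_(x <- xs) window_weight n N d * nm s (ev d' x) ^+ 2.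
    apply: eq_bigr => x _; rewrite /= hd' nmM nm_ofR ger0_norm ?sqrtr_ge0//.
    by rewrite exprMn sqr_sqrtr// window_weight_ge0.
  by rewrite -mulr_sumr ler_piMr ?window_weight_ge0.
lra.
Qed.

End integral_form.

(** * Finite rank approximation of 2-summing operators *)

Section finite_rank_approximation.
Variables (R : realType) (K : numFieldType) (s : scalars R K) (c : bool).
Local Notation X := (space s c).
Local Notation Z := (space s false).

Lemma inclD (x y : X) : incl (x + y) = incl x + incl y.
Proof. by have := inclP 1 x y; rewrite !scale1r. Qed.

Lemma inclZ a (x : X) : incl (a *: x) = a *: incl x.
Proof. exact: val_inj. Qed.

Lemma inclB (x y : X) : incl (x - y) = incl x - incl y.
Proof. exact: val_inj. Qed.

Lemma coord_separates (w : X) : w != 0 ->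
  exists f : X -> K, [/\ forall a x y, f (a *: x + y) = a * f x + f y,
    exists B, forall x, nm s (f x) <= B * nm s x & f w = 1].
Proof.
move=> w0; have [j wj] : exists j, (coord w j : K) != 0.
  apply: contrapT => h; move/eqP: w0; apply; apply: space_ext => j.
  rewrite coord0; apply/eqP; apply: contrapT => wj; apply: h; exists j.
  exact/negP.
exists (fun x => (coord x j : K) / (coord w j : K)); split=> [a x y| |].
- have -> : (coord (a *: x + y) j : K) = a * coord x j + coord y j.
    by rewrite coordD coordZ.
  by rewrite mulrDl mulrA.
- exists (nm s (coord w j : K))^-1 => x; rewrite nmM nmV mulrC.
  by rewrite ler_wpM2l ?invr_ge0 ?nm_ge0// coord_le.
- by rewrite divff.
Qed.

Variable N : X -> R.
Hypothesis NZ : forall t x, 0 <= t -> N (ofR s t *: x) = t * N x.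
Variable P : R.
Hypothesis P0 : 0 <= P.
Hypothesis hN : forall (xs : seq X) W, 0 < W ->
  (forall d : test s, \sum_(x <- xs) nm s (ev d x) ^+ 2 <= W) ->
  \sum_(x <- xs) N x ^+ 2 <= P * W.

Lemma pietsch_domination : exists L : (test s -> R) -> R,
  [/\ functional L, dominated P L &
      forall x : X, N x ^+ 2 <= L (fun d => nm s (ev d x) ^+ 2)].
Proof.
pose g (xs : seq X) (d : test s) := \sum_(x <- xs) nm s (ev d x) ^+ 2.
pose C (h : test s -> R) a := exists xs : seq X,
  h = g xs /\ a = \sum_(x <- xs) N x ^+ 2.
have [d0 _] := unit_test_exists s [::].
have hC : cone C.
  split.
  - by exists [::]; split; [apply/funext => d; rewrite /g big_nil|rewrite big_nil].
  - move=> h a [xs [-> _]]; apply: bnd_sum => x.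
    exists (nm s x ^+ 2) => d; rewrite ger0_norm ?sqr_ge0//.
    by rewrite ler_pXn2r ?nnegrE ?nm_ge0// ev_le.
  - move=> h a h' a' [xs [-> ->]] [ys [-> ->]]; exists (xs ++ ys).
    by split; [apply/funext => d; rewrite /g big_cat|rewrite big_cat].
  - move=> t h a t0 [xs [-> ->]].
    exists (map (fun x => ofR s (Num.sqrt t) *: x) xs); split.
      apply/funext => d; rewrite /g big_map mulr_sumr; apply: eq_bigr => x _.
      by rewrite coordZ evZ nmM nm_ofR ger0_norm ?sqrtr_ge0// exprMn sqr_sqrtr.
    rewrite big_map mulr_sumr; apply: eq_bigr => x _.
    by rewrite NZ ?sqrtr_ge0// exprMn sqr_sqrtr.
have [|L [fL dL hL]] := pietsch d0 P0 hC.
  move=> h a M [xs [-> ->]] hM; apply/ler_addgt0Pr => e e0.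
  have M0 : 0 <= M by apply: le_trans (hM d0); apply: sumr_ge0 => x _; exact: sqr_ge0.
  have P1 : 0 < P + 1 by rewrite ltr_wpDl.
  have e1 : 0 < e / (P + 1) by rewrite divr_gt0.
  apply: le_trans (hN (W := M + e / (P + 1)) _ _) _.
  - exact: ltr_wpDl.
  - by move=> d; apply: le_trans (hM d) _; rewrite lerDl ltW.
  - rewrite mulrDr lerD2l mulrA ler_pdivrMr//; lra.
exists L; split=> // x; apply: hL; exists [:: x]; split; last by rewrite big_seq1.
by apply/funext => d; rewrite /g big_seq1.
Qed.

Lemma near_minimum (I : Type) (F : I -> R) (i0 : I) e : 0 < e -> (forall i, 0 <= F i) ->
  exists i, forall k, F i - e <= F k.
Proof.
move=> e0 F0; have hi : has_inf (range F).
  by split; [exists (F i0), i0|exists 0 => _ [i _ <-]].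
have [_ [i _ <-] hlt] := inf_adherent e0 hi.
exists i => k; rewrite lerBlDr; apply: le_trans (ltW hlt) _; rewrite lerD2r.
by apply: ge_inf; [exact: hi.2|exists k].
Qed.

(** S is the form-orthogonal projection of X onto the span of fs and of almost
    best approximations z j in X of the unit vectors e j of low level.  The error
    v = x - S x is orthogonal to the z j, and e j - z j is almost orthogonal to X,
    so in the form of x with v only the tail of x counts. *)
Lemma finite_rank_approximation (fs : seq X) E : 0 < E ->
  exists S : {linear X -> X}, [/\ finite_rank S, forall x, x \in fs -> S x = x &
    forall xs : seq X, (forall d : test s, \sum_(x <- xs) nm s (ev d x) ^+ 2 <= 1) ->
      \sum_(x <- xs) N (x - S x) ^+ 2 <= E].
Proof.
move=> E0; have [L [fL dL hL]] := pietsch_domination.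
pose ip := form (s := s) L; pose q := qf s ip.
have hip : semi_inner s ip := form_semi_inner fL dL.
have E4 : 0 < E / 4 by rewrite divr_gt0.
have [n hn] := tail_form P0 fL dL c E4.
pose k := size (below n).
(* the errors at the k low coordinates enter with a factor at most k ^ 2 *)
pose dl := E / 4 / (k%:R ^+ 2 + 1).
have k0 : 0 < k%:R ^+ 2 + 1 :> R by rewrite ltr_wpDl// sqr_ge0.
have dl0 : 0 < dl by rewrite divr_gt0.
have near_ex j : exists x : X, forall y : X,
    q (unit_vector s j - incl x) - dl <= q (unit_vector s j - incl y).
  have [x hx] := @near_minimum X (fun x => q (unit_vector s j - incl x)) 0 dl dl0
    (fun x => ip_ge0 hip _).
  by exists x.
have [z hz] := choice near_ex.
pose ipX (x y : X) := ip (incl x) (incl y).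
have hipX : semi_inner s ipX.
  split=> [x y w|a x y|x y|x]; rewrite /ipX.
  - by rewrite inclD (ipDl hip).
  - by rewrite inclZ (ipZl hip).
  - exact: ipC hip _ _.
  - exact: ip_ge0 hip _.
have ipX_le x : qf s ipX x <= P * nm s x ^+ 2.
  by rewrite -nm_incl; exact: form_le.
have [S [S_fin S_id S_orth]] := gram_schmidt hipX coord_separates P0 ipX_le
  (fs ++ [seq z j | j <- below n]).
exists S; split=> // [x xfs|xs hxs]; first by apply: S_id; rewrite mem_cat xfs.
have key x : q (incl (x - S x)) <=
    2 * (k%:R * \sum_(j <- below n) nm s (coord x j : K) ^+ 2) * dl
    + 2 * q (incl x - win 0 n x).
  set v := incl (x - S x); set t := incl x - win 0 n x.
  have Sv y : ip (incl (S y)) v = 0.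
    by rewrite (ipC hip) [ip _ _]S_orth cj0.
  have qv : ip v v = ip (incl x) v by rewrite {1}/v inclB (ipBl hip) Sv subr0.
  have zv j : j \in below n -> ip (incl (z j)) v = 0.
    move=> jn; rewrite -(S_id (z j)) ?Sv// mem_cat; apply/orP; right; exact: map_f.
  pose a := Num.sqrt (q v); have a0 : 0 <= a by exact: sqrtr_ge0.
  have a2 : a ^+ 2 = q v by rewrite sqr_sqrtr// (ip_ge0 hip).
  pose b := Num.sqrt (q t); have b0 : 0 <= b by exact: sqrtr_ge0.
  have b2 : b ^+ 2 = q t by rewrite sqr_sqrtr// (ip_ge0 hip).
  pose g := Num.sqrt dl; have g0 : 0 <= g by exact: sqrtr_ge0.
  have g2 : g ^+ 2 = dl by rewrite sqr_sqrtr// ltW.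
  pose A := \sum_(j <- below n) nm s (coord x j : K).
  have A0 : 0 <= A by apply: sumr_ge0 => j _; exact: nm_ge0.
  have ev_le j : j \in below n -> nm s (ip (unit_vector s j) v) <= g * a.
    move=> jn; rewrite -(@ler_pXn2r _ 2) ?nnegrE ?nm_ge0 ?mulr_ge0// exprMn g2 a2.
    have -> : ip (unit_vector s j) v = ip (unit_vector s j - incl (z j)) v.
      by rewrite (ipBl hip) zv// subr0.
    apply: (near_minimizer hip) => u.
    by have := hz j (z j + u *: (x - S x)); rewrite inclD inclZ opprD addrA.
  have qv_le : q v <= (A * g + b) * a.
    have -> : q v = nm s (ip v v) by rewrite (ip_diag hip) nm_ofR ger0_norm ?(ip_ge0 hip).
    have -> : ip v v = \sum_(j <- below n) (coord x j : K) * ip (unit_vector s j) v + ip t v.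
      rewrite qv -[incl x](subrK (win 0 n x)) (ipDl hip) addrC; congr (_ + _).
      by rewrite win_sum (ip_suml hip); apply: eq_bigr => j _; rewrite (ipZl hip).
    rewrite mulrDl; apply: le_trans (nm_triangle _ _ _) _; apply: lerD.
      apply: le_trans (nm_sum _ _ _ _) _; rewrite -mulrA mulr_suml.
      rewrite big_seq [leRHS]big_seq; apply: ler_sum => j jn.
      by rewrite nmM ler_wpM2l ?nm_ge0// ev_le.
    rewrite -(@ler_pXn2r _ 2) ?nnegrE ?nm_ge0 ?mulr_ge0// exprMn b2 a2.
    exact: cauchy_schwarz hip _ _.
  have a_le : a <= A * g + b.
    have [->|an0] := eqVneq a 0; first by rewrite addr_ge0// mulr_ge0.
    have ap : 0 < a by rewrite lt_def an0.
    by rewrite -(ler_pM2r ap) -expr2 a2.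
  have A2 : A ^+ 2 <= k%:R * \sum_(j <- below n) nm s (coord x j : K) ^+ 2.
    have := sum_cauchy_schwarz (below n) (fun=> 1) (fun j => nm s (coord x j : K)).
    under eq_bigr do rewrite mul1r.
    by under [X in _ <= X * _ -> _]eq_bigr do rewrite expr1n; rewrite big_const_seq count_predT iter_addr_0.
  rewrite -a2 -b2 -g2; apply: (@le_trans _ _ ((A * g + b) ^+ 2)).
    by rewrite ler_pXn2r ?nnegrE ?addr_ge0 ?mulr_ge0.
  have := sqr_ge0 (A * g - b).
  have := ler_wpM2r (sqr_ge0 g) A2; lra.
apply: (@le_trans _ _ (\sum_(x <- xs) q (incl (x - S x)))).
  by apply: ler_sum => x _; apply: le_trans (hL _) _; rewrite /q /ip (formE fL).
apply: le_trans (ler_sum _ (fun x _ => key x)) _.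
rewrite big_split /= -mulr_sumr -mulr_suml -!mulr_sumr exchange_big /=.
have h1 : \sum_(x <- xs) q (incl x - win 0 n x) <= E / 4 by exact: hn.
have h2 : \sum_(j <- below n) \sum_(x <- xs) nm s (coord x j : K) ^+ 2 <= k%:R.
  apply: le_trans (_ : \sum_(j <- below n) 1 <= _).
    apply: ler_sum => j _; have [d hd] := unit_test_exists s j.
    by under eq_bigr do rewrite -hd.
  by rewrite big_const_seq count_predT iter_addr_0.
have h3 : k%:R * (\sum_(j <- below n) \sum_(x <- xs) nm s (coord x j : K) ^+ 2) * dl <= E / 4.
  apply: (@le_trans _ _ (k%:R ^+ 2 * dl)).
    by rewrite expr2; apply: ler_wpM2r; [exact: ltW|exact: ler_wpM2l].
  by rewrite /dl mulrA ler_pdivrMr//; lra.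
lra.
Qed.

End finite_rank_approximation.

Lemma tails_filter (I : Type) (le : I -> I -> Prop) : directed le ->
  ProperFilter (tails le).
Proof.
move=> [[i0] le_refl le_trans' le_dir]; split.
  by move=> [i hi]; exact: hi i (le_refl i).
split=> [|A B [i hi] [j hj]|A B AB [i hi]].
- by exists i0.
- have [k [ik jk]] := le_dir i j; exists k => l kl.
  by split; [apply: hi; exact: le_trans' kl|apply: hj; exact: le_trans' kl].
- by exists i => j /hi/AB.
Qed.

Section summing_norms.
Variables (R : realType) (K : numFieldType) (s : scalars R K).

Definition functionals (X : normedModType K) : set (X -> R) :=
  [set g | exists2 phi : {linear X -> K^o}, dual_ball phi & g = fun x => nm s (phi x)].

Lemma functionals_homogeneous (X : normedModType K) g :
  @functionals X g -> homogeneous s g.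
Proof.
move=> [phi _ ->]; split=> [x|t x t0]; first exact: nm_ge0.
by rewrite linearZ nmZ nm_ofR ger0_norm.
Qed.

Lemma summing_le (V : lmodType K) (G : set (V -> R)) p C C' N : 0 <= p -> 0 <= C -> C <= C' ->
  summing G p C N -> summing G p C' N.
Proof.
move=> p0 C0 CC' h xs w w0 hxs; apply: le_trans (h xs w w0 hxs) _.
apply: ge0_ler_powR => //; rewrite ?nnegrE ?mulr_ge0 ?(ltW w0) ?(le_trans C0)//.
by apply: ler_wpM2r => //; exact: ltW.
Qed.

Section unfolding.
Variables (X Y : completeNormedModType K) (T : {linear X -> Y}) (p C : R).
Hypotheses (p0 : 0 < p) (C0 : 0 <= C).

Let bound := forall (n : nat) (x : 'I_n -> X),
  ((strong_lp_norm (re s) p (fun i => T (x i)))%:E <= C%:E * weak_lp_norm (re s) p x)%E.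

Lemma strong_powR (V : normedModType K) n (x : 'I_n -> V) :
  strong_lp_norm (re s) p x `^ p = \sum_i nm s (x i) `^ p.
Proof.
rewrite /strong_lp_norm -powRrM mulVf ?gt_eqF// powRr1//.
by apply: sumr_ge0 => i _; exact: powR_ge0.
Qed.

Lemma strong_le (V : normedModType K) n (x : 'I_n -> V) w : 0 <= w ->
  (strong_lp_norm (re s) p x <= w) = (\sum_i nm s (x i) `^ p <= w `^ p).
Proof.
move=> w0; have st0 : 0 <= strong_lp_norm (re s) p x by exact: powR_ge0.
rewrite -strong_powR; apply/idP/idP => h.
  by apply: ge0_ler_powR; rewrite ?nnegrE// ltW.
rewrite leNgt; apply/negP => h'; move: h; rewrite leNgt => /negP; apply.
by apply: gt0_ltr_powR.
Qed.

(** Together with [summing_bound], the definition of absolutely p-summing operators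
    read without suprema and roots. *)
Lemma bound_summing : bound -> summing (@functionals X) p C (fun x => nm s (T x)).
Proof.
move=> hb xs w w0 hxs; have w0' := ltW w0.
have sumE (F : X -> R) : \sum_(x <- xs) F x = \sum_(i < size xs) F (tnth (in_tuple xs) i).
  by rewrite big_tnth.
rewrite sumE -strong_le ?mulr_ge0// -lee_fin; apply: le_trans (hb _ _) _.
rewrite EFinM; apply: lee_wpmul2l; first by rewrite lee_fin.
apply: ge_ereal_sup => _ [phi hphi <-]; rewrite lee_fin strong_le//.
rewrite -(sumE (fun x => nm s (phi x : K^o) `^ p)).
by apply: hxs; exists phi.
Qed.

Lemma summing_bound : summing (@functionals X) p C (fun x => nm s (T x)) -> bound.
Proof.
move=> hs n x; set W := weak_lp_norm _ _ _.
have [z hz] : exists z : {linear X -> K^o}, z =1 (fun=> 0).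
  by apply: linear_exists => a u v; rewrite scaler0 addr0.
have W0 : (0 <= W)%E.
  apply: le_trans (ereal_sup_ubound _); last first.
    by exists z => // u; rewrite hz normr0.
  by rewrite lee_fin powR_ge0.
have Wle : (W <= (strong_lp_norm (re s) p x)%:E)%E.
  apply: ge_ereal_sup => _ [phi hphi <-]; rewrite lee_fin.
  rewrite strong_le; last exact: powR_ge0.
  rewrite strong_powR; apply: ler_sum => i _.
  apply: ge0_ler_powR; rewrite ?nnegrE ?nm_ge0 ?(ltW p0)//.
  by have := hphi (x i); rewrite (nmE s) [leRHS](nmE s) ofR_le.
have [w w0 WE] : exists2 w, 0 <= w & W = w%:E.
  move: W0 Wle; case: W => [w| |]; rewrite ?lee_fin// => w0 _.
  by exists w.
rewrite WE -EFinM lee_fin; apply/ler_addgt0Pr => e e0.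
have C1 : 0 < C + 1 by rewrite ltr_wpDl.
have e1 : 0 < e / (C + 1) by rewrite divr_gt0.
have we : 0 < w + e / (C + 1) by rewrite ltr_wpDl.
have sumE (F : X -> R) : \sum_i F (x i) = \sum_(y <- map x (enum 'I_n)) F y.
  by rewrite big_map big_enum.
apply: (@le_trans _ _ (C * (w + e / (C + 1)))).
  have we' := ltW we; rewrite strong_le ?mulr_ge0//.
  have /= -> := sumE (fun y => nm s (T y) `^ p).
  apply: hs => // g [phi hphi ->].
  have /= <- := sumE (fun y => nm s (phi y : K^o) `^ p).
  rewrite -strong_le//.
  apply: (@le_trans _ _ w); last by rewrite lerDl ltW.
  by rewrite -lee_fin -WE; apply: ereal_sup_ubound; exists phi.
by rewrite mulrDr lerD2l mulrA ler_pdivrMr//; lra.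
Qed.

End unfolding.

(** * The weak metric approximation property *)

Section weak_map.
Variable c : bool.
Local Notation X := (banach s c).

Lemma ev_functional (d : test s) : @functionals X (fun x : space s c => nm s (ev d x)).
Proof.
have [phi hphi] : exists phi : {linear X -> K^o}, phi =1 (fun x : space s c => ev d x).
  by apply: linear_exists => a x y; rewrite coordD coordZ evD evZ.
exists phi; last by apply/funext => x; rewrite hphi.
by move=> x; rewrite hphi (nmE s) [leRHS](nmE s) ofR_le; exact: (ev_le d (x : space s c)).
Qed.

(** The weak l_2-norm of a family is the norm of its synthesis operator, so it
    can be computed on any norming set of functionals. *)
Lemma weak_l2_tests (xs : seq (space s c)) W g : 0 <= W ->
  (forall d : test s, \sum_(x <- xs) nm s (ev d x) ^+ 2 <= W) ->
  @functionals X g -> \sum_(x <- xs) g x ^+ 2 <= W.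
Proof.
move=> W0 hxs [phi hphi ->]; set S := \sum_(x <- xs) _.
have S0 : 0 <= S by apply: sumr_ge0 => x _; exact: sqr_ge0.
pose z : space s c := \sum_(x <- xs) cj s (phi x) *: x.
have phiz : phi z = ofR s S.
  rewrite /z linear_sum /S ofR_sum; apply: eq_bigr => x _.
  by rewrite linearZ /= /GRing.scale /= mulrC mul_cj.
have hz : nm s z ^+ 2 <= S * W.
  have SW : 0 <= S * W by exact: mulr_ge0.
  rewrite -(sqr_sqrtr SW) ler_pXn2r ?nnegrE ?nm_ge0 ?sqrtr_ge0//.
  apply: nm_space_le => d; rewrite -(@ler_pXn2r _ 2) ?nnegrE ?nm_ge0 ?sqrtr_ge0//.
  rewrite sqr_sqrtr// /z ev_sum.
  apply: (@le_trans _ _ ((\sum_(x <- xs) nm s (phi x) * nm s (ev d x)) ^+ 2)).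
    rewrite ler_pXn2r ?nnegrE ?nm_ge0//; last first.
      by apply: sumr_ge0 => x _; rewrite mulr_ge0 ?nm_ge0.
    apply: le_trans (nm_sum _ _ _ _) _; apply: ler_sum => x _.
    by rewrite coordZ evZ nmM nm_cj.
  apply: le_trans (sum_cauchy_schwarz _ _ _) _.
  by apply: ler_wpM2l => //; exact: hxs.
have : S ^+ 2 <= S * W.
  apply: le_trans hz; rewrite ler_pXn2r ?nnegrE ?nm_ge0//.
  have := hphi z; rewrite (nmE s) [leRHS](nmE s) ofR_le phiz.
  by rewrite [X in X <= _ -> _](nm_ofR s S) ger0_norm.
have [->//|Sn0] := eqVneq S 0.
by rewrite expr2 ler_pM2l// lt_def Sn0.
Qed.

(** The error T - T S has small 2-summing norm, hence small 1-summing norm by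
    [one_summing], hence small p-summing norm. *)
Lemma summing_approximation (Y : completeNormedModType K) (T : {linear X -> Y}) p C e
    (fs : seq X) : 1 <= p <= 2 -> 0 <= C -> 0 < e ->
  summing (@functionals X) p C (fun x => nm s (T x)) ->
  exists S : {linear X -> X}, [/\ finite_rank S, forall x, x \in fs -> S x = x &
    summing (@functionals X) p (C + e) (fun x => nm s (T (S x)))].
Proof.
move=> /andP[p1 p2] C0 e0 hT; have p0 : 0 < p by exact: lt_le_trans p1.
have homT : homogeneous s (fun x : X => nm s (T x)).
  split=> [x|t x t0]; first exact: nm_ge0.
  by rewrite linearZ nmZ nm_ofR ger0_norm.
have hT2 := summing_inclusion p0 p2 C0 homT (@functionals_homogeneous X) hT.
have hN (xs : seq (space s c)) W : 0 < W ->
    (forall d : test s, \sum_(x <- xs) nm s (ev d x) ^+ 2 <= W) ->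
    \sum_(x <- xs) nm s (T x) ^+ 2 <= C ^+ 2 * W.
  move=> W0 hxs; have sW0 : 0 < Num.sqrt W by rewrite sqrtr_gt0.
  have sW2 : Num.sqrt W ^+ 2 = W by rewrite sqr_sqrtr// ltW.
  have := hT2 xs (Num.sqrt W) sW0.
  rewrite (powR_mulrn 2 (ltW sW0)) (powR_mulrn 2 (mulr_ge0 C0 (ltW sW0))) exprMn sW2.
  under eq_bigr do rewrite (powR_mulrn 2 (nm_ge0 s _)).
  apply => g Gg; under eq_bigr do rewrite (powR_mulrn 2 ((functionals_homogeneous Gg).1 _)).
  exact: weak_l2_tests (ltW W0) hxs Gg.
pose M : R := maurey_constant R.
have M1 : 0 < M + 1 by rewrite ltr_wpDl// maurey_constant_ge0.
(* one_summing multiplies the squared 2-summing norm by M *)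
pose d2 := (e / 2) ^+ 2 / (M + 1).
have e2 : 0 < e / 2 by rewrite divr_gt0.
have d20 : 0 < d2 by rewrite divr_gt0// exprn_gt0.
have [S [S_fin S_id hS]] := @finite_rank_approximation R K s c (fun x : X => nm s (T x))
  homT.2 _ (sqr_ge0 C) hN fs _ d20.
exists S; split=> //.
pose N' (x : X) := nm s (T (x - S x)).
have homN' : homogeneous s N'.
  split=> [x|t x t0]; first exact: nm_ge0.
  by rewrite /N' linearZ -scalerBr linearZ nmZ nm_ofR ger0_norm.
have h1 : summing (@functionals X) 1 (e / 2) N'.
  move=> xs w w0 hxs; have w0' := ltW w0; have e2' := ltW e2.
  rewrite [leRHS](powRr1 (mulr_ge0 e2' w0')).
  under eq_bigr do rewrite (powRr1 (homN'.1 _)).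
  have := @one_summing _ _ s c N' homN'.1 homN'.2 d2 (ltW d20) hS xs w w0.
  have hle : Num.sqrt (maurey_constant R * d2) <= e / 2.
    rewrite -(@ler_pXn2r _ 2) ?nnegrE ?sqrtr_ge0 ?(ltW e2)//.
    rewrite sqr_sqrtr; last by rewrite mulr_ge0 ?maurey_constant_ge0 ?ltW.
    rewrite /d2 -/M mulrCA ler_piMr ?sqr_ge0// ler_pdivrMr// mul1r.
    by rewrite lerDl.
  move=> h; apply: le_trans (h _) _.
    move=> d; have := hxs _ (ev_functional d); rewrite [leRHS](powRr1 w0').
    by under eq_bigr do rewrite (powRr1 (nm_ge0 s _)).
  by apply: ler_wpM2r => //; exact: ltW.
have hp := summing_inclusion ltr01 p1 (ltW e2) homN' (@functionals_homogeneous X) h1.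
have Ce : C <= C + e / 2 by rewrite lerDl ltW.
have C1 : 0 < C + e / 2 by rewrite ltr_wpDl.
have -> : C + e = (C + e / 2) + e / 2 by lra.
apply: (summingD (N1 := fun x => nm s (T x)) (N2 := N')) hp => //; try by move=> x; exact: nm_ge0.
- move=> x; rewrite /N' linearB.
  have {1}-> : T (S x) = T x - (T x - T (S x)) by rewrite opprB addrC subrK.
  exact: nmB_le.
- exact: summing_le (ltW p0) C0 Ce hT.
Qed.

Lemma summing_norm_le (Y : completeNormedModType K) (T : {linear X -> Y}) p C : 0 < p -> 0 <= C ->
  summing (@functionals X) p C (fun x => nm s (T x)) -> (summing_norm (re s) p T <= C%:E)%E.
Proof.
move=> p0 C0 hT; apply: ereal_inf_lbound; exists C => //; split=> //.
exact: summing_bound.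
Qed.

(** The net is indexed by finite subsets of the space, which S fixes, and by the
    allowed excess of the norm. *)
Theorem space_weak_MAP (p : R) : 1 <= p <= 2 -> weak_MAP (summing_norm (re s) p) X.
Proof.
move=> hp Y T [_ Tfin]; have /andP[p1 _] := hp.
have p0 : 0 < p by exact: lt_le_trans p1.
set A := summing_norm (re s) p T in Tfin *.
have A0 : (0 <= A)%E by apply: le_ereal_inf_tmp => _ [C [C0 _] <-]; rewrite lee_fin.
have [a a0 AE] : exists2 a : R, 0 <= a & A = a%:E.
  by move: A0 Tfin; case: A => [a| |]//; rewrite lee_fin => a0 _; exists a.
have step (i : seq X * nat) : exists S : {linear X -> X},
  [/\ finite_rank S, forall x, x \in i.1 -> S x = x &
   (summing_norm (re s) p (T \o S : {linear X -> Y}) <= (a + i.2.+1%:R^-1)%:E)%E].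
  have e0 : 0 < i.2.+1%:R^-1 / 2 :> R by rewrite divr_gt0// invr_gt0.
  have [_ [C [C0 hC] <-] Clt] : exists2 y, [set C%:E | C in [set C : R | 0 <= C /\
    forall (n : nat) (x : 'I_n -> X),
      ((strong_lp_norm (re s) p (fun i => T (x i)))%:E
         <= C%:E * weak_lp_norm (re s) p x)%E]] y & (y < A + (i.2.+1%:R^-1 / 2)%:E)%E.
    by apply: lb_ereal_inf_adherent => //; rewrite [ereal_inf _]AE.
  have [S [S1 S2 S3]] := summing_approximation i.1 hp C0 e0 (bound_summing p0 C0 hC).
  exists S; split=> //; apply: le_trans (@summing_norm_le Y (T \o S : {linear X -> Y}) p _ p0 _ S3) _.
    by rewrite addr_ge0// ltW.
  by move: Clt; rewrite AE -EFinD lte_fin lee_fin; set t := _^-1; move: t => t; lra.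
have [S hS] := choice step.
pose le (i j : seq X * nat) := {subset i.1 <= j.1} /\ (i.2 <= j.2)%N.
have dir : directed le.
  split=> [|i|i j k [h1 h2] [h3 h4]|i j].
  - by constructor; exact: ([::], 0%N).
  - by split.
  - by split; [move=> x /h1/h3|exact: leq_trans h4].
  - exists (i.1 ++ j.1, maxn i.2 j.2); split; split=> /=.
    + by move=> x xi; rewrite mem_cat xi.
    + exact: leq_maxl.
    + by move=> x xi; rewrite mem_cat xi orbT.
    + exact: leq_maxr.
exists (seq X * nat)%type, le, S; split=> //.
- by move=> i; have [] := hS i.
- have tF := tails_filter dir.
  apply/pointwise_cvgP => x U Ux; exists ([:: x], 0%N) => i [xi _].
  have [_ Sid _] := hS i; have Six : S i x = x by apply: Sid; apply: xi; rewrite inE.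
  suff : U (S i x) by [].
  by rewrite Six; exact: nbhs_singleton Ux.
apply/lee_addgt0Pr => e e0.
have [n hn] : exists n : nat, n.+1%:R^-1 <= e.
  have [n _ hn] := near_infty_natSinv_lt (PosNum e0); exists n; apply/ltW.
  exact: hn (leqnn n).
apply: le_trans (ereal_inf_lbound _) _; first by exists ([::], n).
apply: ge_ereal_sup => _ [j [_ /= nj] <-].
have [_ _ h] := hS j; apply: le_trans h _; rewrite AE -EFinD lee_fin lerD2l.
apply: le_trans hn; rewrite lef_pV2 ?posrE//.
by rewrite ler_nat ltnS.
Qed.

End weak_map.
End summing_norms.

(** * Blocks meet the neighbours of a block at most once *)

Section combinatorics.

(** Different colours free disjoint sets of digits. *)
Lemma mask_inj c c' t u : c != c' -> mask c t = mask c u -> mask c' t = mask c' u -> t = u.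
Proof.
move=> cc'; elim: t u => [|x t ih] [|y u] //= [h1 h2] [h3 h4].
have tu := ih u h2 h4; congr (_ :: _) => //.
move: h1 h3; rewrite -tu; have [e|_] := eqVneq (size t %% 8)%N c; last by [].
by rewrite e (negbTE cc').
Qed.

Lemma size_mask_eq c t u : mask c t = mask c u -> size t = size u.
Proof. by move/(congr1 size); rewrite !size_mask. Qed.

Definition col (a b odd_n : bool) : nat := 4 * odd_n + 2 * a + b.

Lemma colourE a b t : colour a b t = col a b (odd (size t)).
Proof. by []. Qed.

Lemma col_inj a b o a' b' o' : col a b o = col a' b' o' -> [/\ a = a', b = b' & o = o'].
Proof. by case: a b o a' b' o' => [] [] [] [] [] []. Qed.

(** The three lemmas [block_inj_same], [block_inj_up], [block_inj_down] say that the
    nodes next to those of one block lie in pairwise different blocks. *)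
Lemma block_inj_same a b a' b' t u : (a', b') != (a, b) ->
  mask (colour a b t) t = mask (colour a b t) u ->
  block [:: a', b' & t] = block [:: a', b' & u] -> t = u.
Proof.
move=> ne h1 [h2]; have tu := size_mask_eq h1; rewrite !colourE -tu in h2.
apply: mask_inj h1 h2; apply: contra ne => /eqP; rewrite !colourE.
by move=> /col_inj[-> -> _].
Qed.

Lemma block_inj_up a b a' b' t u :
  mask (colour a b t) t = mask (colour a b t) u ->
  block [:: a', b', b & t] = block [:: a', b', b & u] -> t = u.
Proof.
move=> h1 h; have tu := size_mask_eq h1; move: h => /= [_ h2].
rewrite /colour /= -tu in h2.
apply: mask_inj h1 h2; apply/eqP; rewrite colourE => /(@col_inj a b _ a' b' (~~ _)) [_ _].
by case: (odd (size t)).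
Qed.

Lemma block_inj_down a b a' t u :
  mask (colour a b t) t = mask (colour a b t) u ->
  block (a' :: t) = block (a' :: u) -> t = u.
Proof.
move=> h1 h; have := size_mask_eq h1; move: h1 h.
case: t => [|d t]; case: u => [|d' u] //= [_ h1] [dd' h2] [tu]; rewrite -dd'.
congr (_ :: _); rewrite -dd' /colour -tu in h2.
apply: mask_inj h1 h2; apply/eqP => /(@col_inj a b (~~ _) a' d _) [_ _].
by change (~~ odd (size t) = odd (size t) -> False); case: (odd (size t)).
Qed.

Definition class_size c n m := count (fun t => mask c t == m) (level n).

Fixpoint masked (c n : nat) : nat := if n is m.+1 then (m %% 8 == c)%N + masked c m else 0.

Lemma class_sizeE c n t : t \in level n -> class_size c n (mask c t) = (2 ^ masked c n)%N.
Proof.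
rewrite /class_size mem_level => /eqP <- {n}.
elim: t => [//|x t ih] /=; rewrite count_cat !count_map.
have E y : count (preim (cons y) (fun u => mask c u == mask c (x :: t))) (level (size t)) =
   (((if (size t %% 8 == c)%N then false else y) == (if (size t %% 8 == c)%N then false else x)) *
    2 ^ masked c (size t))%N.
  rewrite -ih; case: eqP => [e|e].
    rewrite mul1n; apply: eq_in_count => u; rewrite mem_level => /eqP su /=.
    by rewrite su e eqseq_cons eqxx.
  rewrite mul0n; apply/eqP; rewrite -leqn0 leqNgt -has_count; apply/hasPn => u.
  rewrite mem_level => /eqP su /=; rewrite su eqseq_cons.
  by apply/negP => /andP[/eqP].
rewrite !E; case: (size t %% 8 == c)%N; rewrite /= ?eqxx ?mul1n.
  by rewrite addnn -mul2n add1n expnS.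
by case: x {ih E}; rewrite /= ?mul1n ?mul0n ?addn0 ?add0n.
Qed.

Lemma masked_ge c n : (c < 8)%N -> (n %/ 8 <= masked c n)%N.
Proof.
move=> c8; have mono k l : (k <= l)%N -> (masked c k <= masked c l)%N.
  by elim: l => [|l ih]; [rewrite leqn0 => /eqP ->|rewrite leq_eqVlt => /predU1P[->//|/ih h]; exact: leq_trans h (leq_addl _ _)].
have step q : (q <= masked c (q * 8))%N.
  elim: q => // q ih.
  have h : (q * 8 + c < q.+1 * 8)%N by rewrite mulSn addnC ltn_add2r.
  apply: leq_trans (mono _ _ h); rewrite /= modnMDl modn_small// eqxx add1n ltnS.
  by apply: leq_trans ih _; apply: mono; exact: leq_addr.
by apply: leq_trans (step _) (mono _ _ (leq_trunc_div _ _)).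
Qed.

End combinatorics.

Section decay.
Variable R : realType.

(** A geometric scale with sum at most 64 whose fourth power still dominates the
    inverse block sizes, which are at most 2 ^ - (n %/ 8). *)
Definition decay n : R := 2^-1 ^+ (n %/ 32).

Lemma decay_gt0 n : 0 < decay n.
Proof. by rewrite exprn_gt0. Qed.

Lemma decay_sum N : \sum_(n < N) decay n <= 64.
Proof.
have E : \sum_(n < N) decay n = 64 - (64 - (N %% 32)%:R) * decay N.
  elim: N => [|N ih]; first by rewrite big_ord0 /decay div0n mod0n expr0 subr0 mulr1 subrr.
  rewrite big_ord_recr /= ih; have [h|h] := ltnP (N %% 32).+1 32.
    have q : (N.+1 %/ 32 = N %/ 32)%N by lia.
    have r : (N.+1 %% 32 = (N %% 32).+1)%N by lia.
    by rewrite /decay q r -natr1; ring.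
  have q : (N.+1 %/ 32 = (N %/ 32).+1)%N by lia.
  have r : (N.+1 %% 32 = 0)%N by lia.
  have r' : (N %% 32 = 31)%N by lia.
  by rewrite /decay q r r' exprS; field.
rewrite E gerBl mulr_ge0 ?(ltW (decay_gt0 N))// subr_ge0 ler_nat.
by apply: ltnW; apply: ltn_trans (ltn_pmod N _) _.
Qed.

Lemma decay_small e : 0 < e -> exists n0, forall n, (n0 <= n)%N -> decay n <= e.
Proof.
move=> e0.
have [k hk] : exists k : nat, k.+1%:R^-1 <= e.
  have [k _ hk] := near_infty_natSinv_lt (PosNum e0); exists k; apply/ltW.
  exact: hk (leqnn k).
exists (32 * k.+1)%N => n kn; apply: le_trans hk.
have kq : (k.+1 <= n %/ 32)%N by lia.
rewrite /decay exprVn lef_pV2 ?posrE ?exprn_gt0//.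
rewrite -natrX ler_nat; apply: leq_trans kq _.
by apply: ltnW; exact: ltn_expl.
Qed.

Lemma class_decay c n : (c < 8)%N -> (2 ^ masked c n)%:R^-1 <= decay n ^+ 4.
Proof.
move=> c8; rewrite /decay -exprM exprVn lef_pV2 ?posrE ?exprn_gt0// ?ltr0n ?expn_gt0//.
rewrite -natrX ler_nat leq_exp2l//; apply: leq_trans (masked_ge n c8).
lia.
Qed.

End decay.

(** * The vectors of Szankowski's subspace *)

Section szankowski.
Variables (R : realType) (K : numFieldType) (s : scalars R K).
Local Notation Z := (space s false).
Local Notation X := (space s true).
Local Notation e := (unit_vector s).

Definition zvec (t : seq bool) : Z :=
  e (false :: t) - e (true :: t) +
  (e [:: false, false & t] + e [:: true, false & t] +
   e [:: false, true & t] + e [:: true, true & t]).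

Lemma coordDE c (x y : space s c) j : coord (x + y) j = coord x j + coord y j :> K.
Proof. by rewrite coordD. Qed.

Lemma zvec_relation t : relation (coord (zvec t)).
Proof.
move=> u; rewrite /zvec !(coordBE, coordDE, unit_vectorE) !eqseq_cons /=.
set p := u == t; case: u @p => [|b u] p; first by rewrite /= ; ring.
by rewrite !eqseq_cons; case: b @p => p /=; ring.
Qed.

Lemma zvec_in_space t : in_space_pred s true (coord (zvec t)).
Proof.
apply/asboolP; split=> [|_]; last exact: zvec_relation.
exact: (asboolW (coordP (zvec t))).1.
Qed.

Definition zX t : X := Space (zvec_in_space t).

Lemma incl_zX t : incl (zX t) = zvec t.
Proof. exact: val_inj. Qed.

Definition sgn (a : bool) : K := (-1) ^+ a.

(** With j = a b t, this vector measures the difference of the two formulas for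
    z*; its coordinate at j vanishes, see [incl_yX]. *)
Definition yX (a b : bool) t : X := sgn a *: zX (b :: t) - zX t.

Lemma incl_yX a b t : incl (yX a b t) =
  (- 2) *: e [:: ~~ a, b & t] - e [:: false, ~~ b & t] - e [:: true, ~~ b & t]
  + sgn a *: (e [:: false, false, b & t] + e [:: true, false, b & t] +
              e [:: false, true, b & t] + e [:: true, true, b & t])
  - e (false :: t) + e (true :: t).
Proof.
have -> : incl (yX a b t) = sgn a *: zvec (b :: t) - zvec t.
  by rewrite -!incl_zX; exact: val_inj.
apply: space_ext => j; rewrite /zvec.
rewrite !(coordBE, coordDE, coordZE).
by case: a b => [] [] /=; rewrite /sgn /= ?expr1 ?expr0; ring.
Qed.

(** The words t for which the nodes a b t fill one block, when c is the colour
    of a, b and n. *)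
Definition class c n m : seq (seq bool) := [seq t <- level n | mask c t == m].

Lemma class_uniq c n m : uniq (class c n m).
Proof. by rewrite filter_uniq// level_uniq. Qed.

(** Unit vectors in distinct blocks span an l_2-space. *)
Lemma unit_combination_le (r : seq (seq bool)) (f : seq bool -> seq bool) (w : seq bool -> K) :
  uniq r -> {in r &, injective (fun t => block (f t))} ->
  (forall t, nm s (w t) <= 1) ->
  nm s (\sum_(t <- r) w t *: e (f t)) <= Num.sqrt (size r)%:R.
Proof.
move=> ru finj w1; apply: nm_space_le => d.
have evE t : nm s (ev d (e (f t))) <= block_weight d (block (f t)).
  rewrite /ev /block_weight size_block.
  under eq_bigr do rewrite unit_vectorE.
  case: ifP => h.
    have ft : f t \in below (test_rank d) by rewrite mem_below.
    rewrite (bigD1_seq _ ft (below_uniq _)) /= eqxx mulr1 big1 ?addr0.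
      exact: test_coef_le.
    by move=> j /negbTE ->; rewrite mulr0.
  rewrite big1_seq ?nm0// => j /=; rewrite mem_below => jd.
  have [jf|_] := eqVneq j (f t); last by rewrite mulr0.
  by rewrite jf h in jd.
have evS : ev d (coord (\sum_(t <- r) w t *: e (f t))) =
    \sum_(t <- r) w t * ev d (e (f t)).
  elim: r {ru finj} => [|t r ih]; first by rewrite !big_nil coord0 ev0.
  by rewrite !big_cons coordD evD coordZ evZ ih.
rewrite evS; apply: le_trans (nm_sum _ _ _ _) _.
apply: (@le_trans _ _ (\sum_(t <- r) 1 * block_weight d (block (f t)))).
  apply: ler_sum => t _; rewrite nmM.
  by apply: ler_pM; rewrite ?nm_ge0.
have S0 : 0 <= \sum_(t <- r) 1 * block_weight d (block (f t)).
  by apply: sumr_ge0 => t _; rewrite mul1r block_weight_ge0.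
rewrite -(@ler_pXn2r _ 2) ?nnegrE ?sqrtr_ge0// sqr_sqrtr//.
apply: le_trans (sum_cauchy_schwarz _ _ _) _.
have -> : \sum_(i <- r) (1 : R) ^+ 2 = (size r)%:R.
  by under eq_bigr do rewrite expr1n; rewrite big_const_seq count_predT iter_addr_0.
rewrite ler_piMr//.
pose bs := map (fun t => block (f t)) r.
have bsu : uniq bs by rewrite map_inj_in_uniq.
pose N := (\max_(b <- bs) size b).+1.
rewrite -(big_map (fun t => block (f t)) predT (fun b => block_weight d b ^+ 2)) -/bs.
apply: le_trans (block_weight_sum_le1 N d).
rewrite [leRHS](bigID (fun b => b \in bs)) /= -[X in _ <= X + _]big_filter.
have PE : perm_eq [seq b <- below N | b \in bs] bs.
  apply: uniq_perm; rewrite ?filter_uniq ?below_uniq// => b.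
  rewrite mem_filter mem_below andb_idr// => bbs.
  by rewrite ltnS; apply: (@leq_bigmax_seq _ bs xpredT size).
by rewrite (perm_big _ PE) /= lerDl sumr_ge0// => b _; exact: sqr_ge0.
Qed.

Section one_class.
Variables (a b : bool) (n : nat) (m : seq bool).
Let c := col a b (odd n).
Let A := class c n m.
Variable w : seq bool -> K^o.
Hypothesis w1 : forall t, nm s (w t : K) <= 1.

Definition yclass : X := \sum_(t <- A) (w t : K) *: yX a b t.

Let class_mask t u : t \in A -> u \in A -> mask (colour a b t) t = mask (colour a b t) u.
Proof.
rewrite !mem_filter !mem_level colourE => /andP[/eqP h1 /eqP ->] /andP[/eqP h2 _].
by rewrite -/c h1 h2.
Qed.

(** Each y vector is a combination of nine unit vectors with coefficients of total
    size 10, and each of the nine families runs through different blocks. *)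
Lemma yclass_norm : nm s yclass <= 10 * Num.sqrt (size A)%:R.
Proof.
set q := Num.sqrt _.
have piece (f : seq bool -> seq bool) : {in A &, injective (fun t => block (f t))} ->
    nm s (\sum_(t <- A) (w t : K) *: e (f t)) <= q.
  by move=> hf; exact: unit_combination_le (class_uniq _ _ _) hf w1.
have same a' b' : (a', b') != (a, b) ->
    nm s (\sum_(t <- A) (w t : K) *: e [:: a', b' & t]) <= q.
  move=> ne; apply: piece => t u tA uA; exact: block_inj_same ne (class_mask tA uA).
have up a' b' : nm s (\sum_(t <- A) (w t : K) *: e [:: a', b', b & t]) <= q.
  apply: (piece (fun t => [:: a', b', b & t])) => t u tA uA.
  exact: block_inj_up (class_mask tA uA).
have down a' : nm s (\sum_(t <- A) (w t : K) *: e (a' :: t)) <= q.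
  by apply: piece => t u tA uA; exact: block_inj_down (class_mask tA uA).
have h1 := same (~~ a) b; have h2 := same false (~~ b); have h3 := same true (~~ b).
have {}h1 : nm s (\sum_(t <- A) (w t : K) *: e [:: ~~ a, b & t]) <= q.
  by apply: h1; rewrite xpair_eqE; case: (a).
have {}h2 : nm s (\sum_(t <- A) (w t : K) *: e [:: false, ~~ b & t]) <= q.
  by apply: h2; rewrite xpair_eqE andbC; case: (b).
have {}h3 : nm s (\sum_(t <- A) (w t : K) *: e [:: true, ~~ b & t]) <= q.
  by apply: h3; rewrite xpair_eqE andbC; case: (b).
have E : incl yclass =
    (- 2) *: (\sum_(t <- A) (w t : K) *: e [:: ~~ a, b & t])
    - (\sum_(t <- A) (w t : K) *: e [:: false, ~~ b & t])
    - (\sum_(t <- A) (w t : K) *: e [:: true, ~~ b & t])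
    + sgn a *: ((\sum_(t <- A) (w t : K) *: e [:: false, false, b & t]) +
                (\sum_(t <- A) (w t : K) *: e [:: true, false, b & t]) +
                (\sum_(t <- A) (w t : K) *: e [:: false, true, b & t]) +
                (\sum_(t <- A) (w t : K) *: e [:: true, true, b & t]))
    - (\sum_(t <- A) (w t : K) *: e (false :: t))
    + (\sum_(t <- A) (w t : K) *: e (true :: t)).
  rewrite /yclass; elim: A => [|t r ih].
    by rewrite !big_nil !scaler0 !subr0 !addr0 scaler0 addr0; exact: val_inj.
  rewrite !big_cons.
  have -> : incl ((w t : K) *: yX a b t + \sum_(j <- r) (w j : K) *: yX a b j) =
     (w t : K) *: incl (yX a b t) + incl (\sum_(j <- r) (w j : K) *: yX a b j).
    exact: inclP.
  rewrite ih incl_yX; apply: space_ext => j.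
  rewrite !(coordBE, coordDE, coordZE); ring.
have sgn1 : nm s (sgn a) = 1.
  by rewrite /sgn; case: (a); rewrite ?expr1 ?expr0 ?nmN nm1.
have nm2 : nm s (- 2 : K) = 2.
  have -> : (- 2 : K) = - ofR s 2 by rewrite -[2 in RHS]/(1 + 1) ofRD ofR1.
  by rewrite nmN nm_ofR ger0_norm.
rewrite -nm_incl E.
have tr (u v : Z) : nm s (u + v) <= nm s u + nm s v by exact: nm_triangle.
have trB (u v : Z) : nm s (u - v) <= nm s u + nm s v by exact: nmB_le.
set u1 := \sum_(t <- A) _ in h1 *; set u2 := \sum_(t <- A) _ in h2 *.
set u3 := \sum_(t <- A) _ in h3 *.
have h4 := up false false; have h5 := up true false; have h6 := up false true.
have h7 := up true true; have h8 := down false; have h9 := down true.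
set u4 := \sum_(t <- A) _ in h4 *; set u5 := \sum_(t <- A) _ in h5 *.
set u6 := \sum_(t <- A) _ in h6 *; set u7 := \sum_(t <- A) _ in h7 *.
set u8 := \sum_(t <- A) _ in h8 *; set u9 := \sum_(t <- A) _ in h9 *.
have k1 : nm s ((- 2 : K) *: u1) <= 2 * q by rewrite nmZ nm2 ler_wpM2l.
have k2 : nm s (sgn a *: (u4 + u5 + u6 + u7)) <= 4 * q.
  rewrite nmZ sgn1 mul1r; have := tr (u4 + u5 + u6) u7; have := tr (u4 + u5) u6.
  by have := tr u4 u5; lra.
have := tr ((- 2 : K) *: u1 - u2 - u3 + sgn a *: (u4 + u5 + u6 + u7) - u8) u9.
have := trB ((- 2 : K) *: u1 - u2 - u3 + sgn a *: (u4 + u5 + u6 + u7)) u8.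
have := tr ((- 2 : K) *: u1 - u2 - u3) (sgn a *: (u4 + u5 + u6 + u7)).
have := trB ((- 2 : K) *: u1 - u2) u3; have := trB ((- 2 : K) *: u1) u2.
lra.
Qed.

(** All the coordinates involved lie in one block, where the dual norm is the
    maximum norm. *)
Lemma class_functional_le (x : X) :
  nm s (\sum_(t <- A) (w t : K) * (coord x [:: a, b & t] : K)) <= nm s x.
Proof.
pose b0 := [:: a, b & m].
pose wt k : R := (k == b0)%:R.
pose f (j : seq bool) : K := if block j == b0 then w (drop 2 j) else 0.
have wt0 k : 0 <= wt k by rewrite ler0n.
have [sm|hA] := pselect (size m = n); last first.
  rewrite /A /class big_filter big1_seq ?nm0 ?nm_ge0// => t /andP[/eqP tm].
  by rewrite mem_level => /eqP tn; exfalso; apply: hA; rewrite -tm size_mask.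
have wt1 : \sum_(k <- below n.+3) wt k ^+ 2 <= 1.
  have b0in : b0 \in below n.+3 by rewrite mem_below /= sm.
  rewrite (bigD1_seq _ b0in (below_uniq _)) /= big1 => [|k /negbTE kb].
    by rewrite addr0 /wt eqxx expr1n.
  by rewrite /wt kb expr0n.
have fw j : nm s (f j) <= wt (block j).
  by rewrite /f /wt; case: eqP => _; [exact: w1|rewrite nm0].
pose d := Test wt0 wt1 fw.
suff <- : ev d x = \sum_(t <- A) (w t : K) * (coord x [:: a, b & t] : K) by exact: ev_le.
have F a' b' : \sum_(t <- level n) f [:: a', b' & t] * coord x [:: a', b' & t] =
    if (a' == a) && (b' == b) then \sum_(t <- A) (w t : K) * (coord x [:: a, b & t] : K)
    else 0.
  case: ifP => [/andP[/eqP -> /eqP ->]|ne].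
    rewrite /A /class big_filter [RHS]big_mkcond /= big_seq [RHS]big_seq.
    apply: eq_bigr => t; rewrite mem_level => /eqP tn.
    rewrite /f /= drop0 !eqseq_cons !eqxx /= colourE tn.
    by case: ifP => // _; rewrite mul0r.
  by apply: big1 => t _; rewrite /f /= !eqseq_cons andbA ne mul0r.
rewrite /ev -[below _]/(below n.+2 ++ level n.+2) big_cat /= [X in X + _]big1_seq; last first.
  move=> j /= jn; rewrite /f; case: eqP => [jb|_]; last by rewrite mul0r.
  have := size_block j; rewrite jb /= sm => sj.
  have : j \in below n.+2 by [].
  by rewrite mem_below -sj ltnn.
rewrite add0r -[map _ _ ++ _]/(level n.+2) !big_level !F.
by case: (a) (b) => [] [] /=; rewrite ?addr0 ?add0r.
Qed.

End one_class.
End szankowski.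

(** * Failure of the approximation property *)

Section approximation_fails.
Variables (R : realType) (K : numFieldType) (s : scalars R K).
Local Notation X := (space s true).

Definition delta (t : seq bool) : seq bool -> K^o := fun u => (u == t)%:R.

Lemma signed_delta_le (r : seq (seq bool)) w : uniq r ->
  w \in signed_sums (map delta r) ->
  forall t, nm s (w t : K) <= (t \in r)%:R.
Proof.
elim: r w => [|v r ih] w /=.
  by move=> _; rewrite inE => /eqP -> t; rewrite [leLHS]nm0.
move=> /andP[vr ru]; rewrite mem_cat => hw t.
have [w' hw' [sg sg1 wE]] : exists2 w', w' \in signed_sums (map delta r) &
    exists2 sg : K, nm s sg = 1 & (w t : K) = sg * (t == v)%:R + w' t.
  case/orP: hw => /mapP[w' hw' ->]; exists w' => //.
    by exists 1; rewrite ?nm1// mul1r.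
  by exists (-1); rewrite ?nmN ?nm1// mulN1r.
have := ih w' ru hw' t; rewrite inE wE; have [->|_] /= := eqVneq t v.
  rewrite (negbTE vr) => h.
  have -> : (w' v : K) = 0.
    by apply: (@nm0_eq0 _ _ s K); apply/eqP; rewrite eq_le nm_ge0 andbT.
  by rewrite mulr1 addr0 sg1.
by rewrite mulr0 add0r.
Qed.

Section operator.
Variable U : {linear X -> X}.

Lemma yclassD a b n m v w :
  yclass s a b n m (v + w) = yclass s a b n m v + yclass s a b n m w.
Proof. by rewrite /yclass -big_split; apply: eq_bigr => t _; rewrite /= -scalerDl. Qed.

(** Averaging w_t w_u over random signs keeps only the diagonal terms, and for each
    choice of signs the double sum is a functional of norm at most 1 applied to
    the image of a single vector. *)
Lemma class_average a b n m eta :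
  let A := class (col a b (odd n)) n m in
  (forall w, w \in signed_sums (map delta A) -> nm s (U (yclass s a b n m w)) <= eta) ->
  nm s (\sum_(t <- A) (coord (U (yX s a b t)) [:: a, b & t] : K)) <= eta.
Proof.
move=> A hU; set S := \sum_(t <- A) _; pose om := phase s S.
pose F (v w : seq bool -> K^o) : K :=
  \sum_(t <- A) (v t : K) * (coord (U (yclass s a b n m w)) [:: a, b & t] : K).
pose G v w := re s (om * F v w).
have GDl x y z : G (x + y) z = G x z + G y z.
  rewrite /G -reD -mulrDr /F -big_split; congr (re s (_ * _)).
  by apply: eq_bigr => t _; exact: mulrDl.
have GDr x y z : G z (x + y) = G z x + G z y.
  rewrite /G -reD -mulrDr /F -big_split; congr (re s (_ * _)).
  by apply: eq_bigr => t _; rewrite yclassD linearD coordDE mulrDr.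
have Au : uniq A := class_uniq _ _ _.
have Gd : \sum_(v <- map delta A) G v v = nm s S.
  rewrite big_map /G -re_sum -mulr_sumr.
  have -> : \sum_(t <- A) F (delta t) (delta t) = S.
    rewrite /S big_seq [RHS]big_seq; apply: eq_bigr => t tA.
    rewrite /F (bigD1_seq _ tA Au) /= /delta eqxx mul1r big1 ?addr0.
      congr (coord (U _) _ : K).
      rewrite /yclass -/A (bigD1_seq _ tA Au) /= eqxx scale1r big1 ?addr0//.
      by move=> u /negbTE ->; rewrite scale0r.
    by move=> u /negbTE ->; rewrite mul0r.
  by rewrite phaseE reR.
rewrite -Gd -(rad_bilinear _ GDl GDr); apply: rad_le_signed => w hw.
apply: le_trans (ler_norm _) (le_trans (re_le_nm _ _) _).
rewrite nmM; apply: le_trans (hU w hw).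
apply: (@le_trans _ _ (1 * nm s (F w w))).
  by rewrite ler_wpM2r ?nm_ge0// phase_le1.
rewrite mul1r; apply: class_functional_le => t.
by apply: le_trans (signed_delta_le Au hw t) _; rewrite lern1; case: (_ \in _).
Qed.

(** The normalization shares the factor 1 / sqrt (size A), gained from the
    spreading, between the norm of the test vectors and the differences of traces. *)
Definition test_vector a b n m w : X :=
  let A := class (col a b (odd n)) n m in
  ofR s (decay R n * (size A)%:R)^-1 *: yclass s a b n m w.

Lemma big_class c n (G : seq bool -> K) :
  \sum_(t <- level n) G t = \sum_(m <- level n) \sum_(t <- class c n m) G t.
Proof.
have -> : \sum_(m <- level n) \sum_(t <- class c n m) G t =
    \sum_(m <- level n) \sum_(t <- level n) (if mask c t == m then G t else 0).
  by apply: eq_bigr => m _; rewrite /class big_filter big_mkcond.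
rewrite exchange_big /= big_seq [RHS]big_seq; apply: eq_bigr => t tn.
have mt : mask c t \in level n by rewrite mem_level size_mask -mem_level.
rewrite (bigD1_seq _ mt (level_uniq n)) /= eqxx big1 ?addr0// => m.
by rewrite eq_sym => /negbTE ->.
Qed.

Lemma level_average a b n eta : 0 <= eta ->
  (forall m w, m \in level n ->
     w \in signed_sums (map delta (class (col a b (odd n)) n m)) ->
     nm s (U (test_vector a b n m w)) <= eta) ->
  nm s (\sum_(t <- level n) (coord (U (yX s a b t)) [:: a, b & t] : K)) <=
    eta * decay R n * 2 ^+ n.
Proof.
move=> eta0 h; set c := col a b (odd n).
rewrite (big_class c); apply: le_trans (nm_sum _ _ _ _) _.
have -> : 2 ^+ n = \sum_(m <- level n) (size (class c n m))%:R :> R.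
  rewrite -natrX -size_level -sum1_size natr_sum.
  have -> : \sum_(t <- level n) (1 : R) =
      \sum_(m <- level n) \sum_(t <- level n) (if mask c t == m then 1 else 0).
    rewrite exchange_big /= big_seq [RHS]big_seq; apply: eq_bigr => t tn.
    have mt : mask c t \in level n by rewrite mem_level size_mask -mem_level.
    rewrite (bigD1_seq _ mt (level_uniq n)) /= eqxx big1 ?addr0// => m.
    by rewrite eq_sym => /negbTE ->.
  by apply: eq_bigr => m _; rewrite -big_mkcond -sum1_size natr_sum /class big_filter.
rewrite mulr_sumr big_seq [leRHS]big_seq; apply: ler_sum => m mn.
have [A0|A0] := eqVneq (size (class c n m)) 0%N.
  by rewrite (size0nil A0) big_nil nm0 mulr0.
have sA : 0 < (size (class c n m))%:R :> R by rewrite ltr0n lt0n.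
apply: class_average => w hw; have := h m w mn hw.
have k0 : 0 < decay R n * (size (class c n m))%:R by rewrite mulr_gt0// decay_gt0.
rewrite /test_vector -/c linearZ nmZ nm_ofR gtr0_norm ?invr_gt0//.
rewrite ler_pdivrMl// => hle; apply: le_trans hle _; rewrite le_eqVlt; apply/orP; left; apply/eqP; ring.
Qed.

Definition zfun (t : seq bool) (x : X) : K := (coord x (false :: t) - coord x (true :: t)) / 2.

(** The trace of U along level n; for the identity it is 2 ^ n. *)
Definition trace_level n : K := \sum_(t <- level n) zfun t (U (zX s t)).

Lemma zfunE t (x : X) : zfun t x =
  ((coord x [:: false, false & t] : K) + coord x [:: true, false & t] +
   coord x [:: false, true & t] + coord x [:: true, true & t]) / 4.
Proof.
have := (asboolW (coordP x)).2 isT t; rewrite /zfun => <-.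
by field.
Qed.

(** z*_(b t) is evaluated by the first formula and z*_t by the second one, so that
    both sums run over the same coordinates a b t. *)
Lemma trace_step n : trace_level n.+1 - 2 * trace_level n =
  2^-1 * (\sum_(t <- level n) (coord (U (yX s false false t)) [:: false, false & t] : K) +
          \sum_(t <- level n) (coord (U (yX s true false t)) [:: true, false & t] : K) +
          \sum_(t <- level n) (coord (U (yX s false true t)) [:: false, true & t] : K) +
          \sum_(t <- level n) (coord (U (yX s true true t)) [:: true, true & t] : K)).
Proof.
rewrite /trace_level big_level mulr_sumr -!big_split /= mulr_sumr -sumrB.
apply: eq_bigr => t _; rewrite (zfunE t) /zfun.
have UY a b j : (coord (U (yX s a b t)) j : K) =
    sgn K a * coord (U (zX s (b :: t))) j - coord (U (zX s t)) j.
  by rewrite /yX linearB linearZ coordBE coordZE.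
by rewrite !UY /sgn /= expr1 expr0; field.
Qed.

(** The normalized traces change by at most eta * decay n from level n to the
    next one, and 65 = 1 + 64. *)
Lemma trace_bound eta : 0 <= eta ->
  nm s (U (zX s [::])) <= eta ->
  (forall a b n m w, m \in level n ->
     w \in signed_sums (map delta (class (col a b (odd n)) n m)) ->
     nm s (U (test_vector a b n m w)) <= eta) ->
  forall n, nm s (trace_level n) <= 2 ^+ n * (65 * eta).
Proof.
move=> eta0 h0 h n.
have nm2 : nm s (2 : K) = 2.
  have -> : (2 : K) = ofR s 2 by rewrite -[2 in RHS]/(1 + 1) ofRD ofR1.
  by rewrite nm_ofR ger0_norm.
suff : nm s (trace_level n) <= 2 ^+ n * (eta + eta * \sum_(k < n) decay R k).
  move/le_trans; apply; rewrite ler_wpM2l ?exprn_ge0//.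
  by have := ler_wpM2l eta0 (decay_sum R n); lra.
elim: n => [|n ih].
  rewrite /trace_level /= big_seq1 big_ord0 mulr0 addr0 expr0 mul1r.
  apply: le_trans h0; rewrite /zfun nmM nmV nm2 ler_pdivrMr//.
  apply: le_trans (nmB_le _ _ _) _.
  by have := coord_le (U (zX s [::])) [:: false]; have := coord_le (U (zX s [::])) [:: true]; lra.
rewrite -[trace_level n.+1](subrK (2 * trace_level n)) trace_step.
apply: le_trans (nm_triangle _ _ _) _; rewrite !nmM nmV nm2 big_ord_recr /= exprS.
have b1 a b := level_average eta0 (h a b n).
have := b1 false false; have := b1 true false; have := b1 false true; have := b1 true true.
set v1 := \sum_(t <- level n) _; set v2 := \sum_(t <- level n) _.
set v3 := \sum_(t <- level n) _; set v4 := \sum_(t <- level n) _.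
move=> k4 k3 k2 k1.
have := nm_triangle s (v4 + v3 + v2) v1; have := nm_triangle s (v4 + v3) v2.
have := nm_triangle s v4 v3.
set D := decay R n in k1 k2 k3 k4 *; set P := 2 ^+ n in k1 k2 k3 k4 ih *.
set q := eta * D * P in k1 k2 k3 k4.
set Sg := \sum_(k < n) _ in ih *.
have -> : 2 * P * (eta + eta * (Sg + D)) = 2 * (P * (eta + eta * Sg)) + 2 * q.
  by rewrite /q; ring.
lra.
Qed.

End operator.

Lemma test_vector_small a b n m w : (forall t, nm s (w t : K) <= 1) ->
  nm s (test_vector a b n m w) <= 10 * decay R n.
Proof.
move=> w1; rewrite /test_vector; set A := class _ _ _.
have d0 := decay_gt0 R n.
have [A0|A0] := eqVneq (size A) 0%N.
  by rewrite A0 mulr0 invr0 ofR0 scale0r nm0 mulr_ge0// ltW.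
have sA : 0 < (size A)%:R :> R by rewrite ltr0n lt0n.
have k0 : 0 < decay R n * (size A)%:R by rewrite mulr_gt0.
rewrite nmZ nm_ofR gtr0_norm ?invr_gt0// ler_pdivrMl//.
apply: le_trans (yclass_norm a b n m w1) _; rewrite -/A.
set g := Num.sqrt _; have g0 : 0 < g by rewrite sqrtr_gt0.
have g2 : g ^+ 2 = (size A)%:R by rewrite sqr_sqrtr// ltW.
have size_ge : (size A)%:R^-1 <= decay R n ^+ 4.
  have [t tA] : exists t, t \in A.
    by case: (A) A0 => // t r _; exists t; rewrite inE eqxx.
  move: (tA); rewrite mem_filter => /andP[/eqP tm tn].
  have -> : size A = (2 ^ masked (col a b (odd n)) n)%N.
    by rewrite -(class_sizeE _ tn) /class_size tm /A /class size_filter.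
  by apply: class_decay; rewrite /col; case: (a); case: (b); case: (odd n).
have : g^-1 <= decay R n ^+ 2.
  rewrite -(@ler_pXn2r _ 2) ?nnegrE ?invr_ge0 ?(ltW g0) ?sqr_ge0//.
  by rewrite exprVn g2 -exprM.
rewrite -g2 => h; have : g * 1 <= g * (g * decay R n ^+ 2).
  by rewrite ler_pM2l// -ler_pdivrMl// mulr1.
lra.
Qed.

End approximation_fails.

(** A filter that does not cluster at 0 lives on finitely many of the lists. *)
Lemma compact_null_sequence (K : numFieldType) (V : normedModType K) (vs : nat -> seq V) :
  (forall B : set V, nbhs 0 B -> exists n0, forall n, (n0 <= n)%N ->
     forall x, x \in vs n -> B x) ->
  compact [set x | x = 0 \/ exists n, x \in vs n].
Proof.
move=> hvs F PF FC; set C := [set x | _] in FC *.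
have [c0|nc0] := pselect (cluster F 0); first by exists 0; split=> //; left.
have [A [B [FA B0 AB]]] : exists A B, [/\ F A, nbhs 0 B & ~ (A `&` B !=set0)].
  apply: contrapT => h; apply: nc0 => A B FA B0; apply: contrapT => hAB.
  by apply: h; exists A, B.
have [n0 hn0] := hvs B B0.
pose L := flatten [seq vs n | n <- iota 0 n0].
have FL : F [set x | x \in L].
  apply: filterS (filterI FA FC) => x [Ax Cx] /=.
  case: Cx => [x0|[n xn]].
    by exfalso; apply: AB; exists x; split=> //; rewrite x0; exact: nbhs_singleton B0.
  apply/flattenP; exists (vs n) => //; apply: map_f; rewrite mem_iota /= add0n ltnNge.
  by apply/negP => nn; apply: AB; exists x; split=> //; exact: hn0 nn _ xn.
have [x [/= /flattenP[l /mapP[n _ ->] xn] cx]] := @finite_compact _ _ (finite_seq L) F PF FL.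
by exists x; split=> //; right; exists n.
Qed.

Section finite_rank_operators.
Variables (R : realType) (K : numFieldType) (s : scalars R K) (c : bool).
Local Notation X := (space s c).

Lemma coord_null (x : X) e : 0 < e -> exists N, forall j, (N <= size j)%N ->
  nm s (coord x j : K) <= e.
Proof.
move=> e0; have [N hN] := tail_small x (exprn_gt0 2 e0); exists N => j Nj.
have := hN N (leqnn N); rewrite ler_pXn2r ?nnegrE ?nm_ge0 ?(ltW e0)//; apply: le_trans.
have -> : (coord x j : K) = coord (incl x - win 0 N x) j.
  by rewrite coordBE /= /window /= ltnNge Nj /= subr0.
exact: coord_le.
Qed.

(** A finite dimensional space of sequences is described by finitely many
    coordinates.  The gain over an arbitrary basis is that the coefficients are
    bounded by the norm.  A new vector u matters only through its error w = u - P u;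
    a coordinate where w does not vanish is added to the list. *)
Lemma coordinates_span n (v : 'I_n -> X) : exists ps : seq (seq bool * X),
  forall a : 'I_n -> K, let x := \sum_i a i *: v i in
    x = \sum_(p <- ps) (coord x p.1 : K) *: p.2.
Proof.
elim: n v => [|n ih] v.
  by exists [::] => a x; rewrite big_nil /x big_ord0.
have [ps hps] := ih (fun i => v (widen_ord (leqnSn n) i)).
set u := v ord_max; pose P (x : X) := \sum_(p <- ps) (coord x p.1 : K) *: p.2.
have PP a x y : P (a *: x + y) = a *: P x + P y.
  rewrite /P scaler_sumr -big_split; apply: eq_bigr => p _.
  have -> : (coord (a *: x + y) p.1 : K) = a * coord x p.1 + coord y p.1.
    by rewrite coordDE coordZE.
  by rewrite scalerDl scalerA.
pose w := u - P u.
have wE a (y : X) : y = P y -> y + a *: u - P (y + a *: u) = a *: w.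
  move=> yP; rewrite [y + _]addrC PP -yP opprD addrACA subrr addr0.
  by rewrite /w scalerBr.
have [w0|w0] := eqVneq w 0.
  exists ps => a x; rewrite -/(P x) /x big_ord_recr /=.
  by apply/eqP; rewrite -subr_eq0 wE ?w0 ?scaler0//; exact: hps.
have [j wj] : exists j, (coord w j : K) != 0.
  apply: contrapT => h; move/eqP: w0; apply; apply: space_ext => j.
  rewrite coord0; apply/eqP; apply: contrapT => wj; apply: h; exists j.
  exact/negP.
have [w' w'E] : exists w', w' = (coord w j : K)^-1 *: w by exists ((coord w j : K)^-1 *: w).
exists ((j, w') :: map (fun p => (p.1, p.2 - (coord p.2 j : K) *: w')) ps) => a x.
rewrite big_cons big_map /=.
have xP : x - P x = a ord_max *: w.
  by rewrite /x big_ord_recr /= wE//; exact: hps.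
have aE : a ord_max *: w = ((coord x j : K) - coord (P x) j) *: w'.
  rewrite w'E scalerA -coordBE xP coordZE mulfK//.
have PxE : P x = \sum_(p <- ps) (coord x p.1 : K) *: p.2 by [].
have cP : (coord (P x) j : K) = \sum_(p <- ps) (coord x p.1 : K) * coord p.2 j.
  by rewrite PxE coord_sum; apply: eq_bigr => p _; rewrite coordZE.
rewrite -[LHS](subrK (P x)) xP aE scalerBl -addrA; congr (_ + _).
rewrite cP scaler_suml PxE -sumrN -big_split; apply: eq_bigr => p _ /=.
rewrite scalerBr scalerA.
by rewrite addrC.
Qed.

Lemma continuous_bound (V W : normedModType K) (f : {linear V -> W}) : continuous f ->
  exists2 B, 0 <= B & forall x, nm s (f x) <= B * nm s x.
Proof.
move=> /linear_bounded_continuous/linear_boundedP fb.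
have [r [r0 hr]] : exists r : K, 0 <= r /\ forall x, `|f x| <= r * `|x|.
  near (pinfty_nbhs K) => r; exists r; split; last by near: r.
  by apply: ltW; near: r; exact: nbhs_pinfty_gt.
exists (nm s r); first exact: nm_ge0.
by move=> x; rewrite -(ofR_le s) ofRM -!nmE (ger0_norm r0).
Unshelve. all: by end_near. Qed.

(** The image of a ball under a finite rank operator is relatively compact, so its
    coordinates tend to 0 uniformly. *)
Lemma finite_rank_coord_null (S : {linear X -> X}) B e : finite_rank S -> 0 < e -> 0 <= B ->
  exists N, forall x j, nm s x <= B -> (N <= size j)%N -> nm s (coord (S x) j : K) <= e.
Proof.
move=> [Sc [n [v hv]]] e0 B0; have [M M0 hM] := continuous_bound Sc.
have [ps hps] := coordinates_span v.
have k0 : 0 < M * B * (size ps)%:R + 1 by rewrite ltr_wpDl// !mulr_ge0.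
have e1 : 0 < e / (M * B * (size ps)%:R + 1) by rewrite divr_gt0.
have [N hN] : exists N, forall p, p \in ps -> forall j, (N <= size j)%N ->
    nm s (coord p.2 j : K) <= e / (M * B * (size ps)%:R + 1).
  move: (e / _) e1 => f f0; elim: (ps) => [|p qs [N1 ih]]; first by exists 0%N.
  have [N2 h2] := coord_null p.2 f0; exists (maxn N1 N2) => q.
  rewrite inE => /predU1P[->|qqs] j; rewrite geq_max => /andP[h3 h4].
    exact: h2.
  exact: ih.
exists N => x j xB Nj; have [a ha] := hv x.
have Sx := hps a; rewrite /= -ha in Sx; rewrite Sx coord_sum.
apply: le_trans (nm_sum _ _ _ _) _.
apply: (@le_trans _ _ (\sum_(p <- ps) M * B * (e / (M * B * (size ps)%:R + 1)))).
  rewrite big_seq [leRHS]big_seq; apply: ler_sum => p pps.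
  rewrite coordZE nmM; apply: ler_pM; rewrite ?nm_ge0//; last exact: hN.
  apply: le_trans (coord_le _ _) _; apply: le_trans (hM x) _.
  exact: ler_wpM2l.
rewrite big_const_seq count_predT iter_addr_0 -[leLHS]mulr_natr.
set k := M * B * (size ps)%:R + 1 in k0 *.
have -> : M * B * (e / k) * (size ps)%:R = (M * B * (size ps)%:R * e) / k by ring.
by rewrite ler_pdivrMr// /k; lra.
Qed.

End finite_rank_operators.

Section no_BAP.
Variables (R : realType) (K : numFieldType) (s : scalars R K).
Local Notation X := (space s true).
Local Notation B := (banach s true).

Definition bits : seq (bool * bool) :=
  [:: (false, false); (false, true); (true, false); (true, true)].

Definition test_vectors n : seq X :=
  flatten [seq flatten [seq [seq test_vector s ab.1 ab.2 n m w |
      w <- signed_sums (map (@delta K) (class (col ab.1 ab.2 (odd n)) n m))] |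
    m <- level n] | ab <- bits].

Lemma mem_test_vectors a b n m w : m \in level n ->
  w \in signed_sums (map (@delta K) (class (col a b (odd n)) n m)) ->
  test_vector s a b n m w \in test_vectors n.
Proof.
move=> mn hw; apply/flattenP; exists (flatten [seq [seq test_vector s a b n m w |
      w <- signed_sums (map (@delta K) (class (col a b (odd n)) n m))] | m <- level n]).
  apply/mapP; exists (a, b) => //; by case: a {hw} b => [] [].
by apply/flattenP; eexists; [apply: map_f; exact: mn|apply: map_f].
Qed.

Lemma test_vectors_small n x : x \in test_vectors n -> nm s x <= 10 * decay R n.
Proof.
move=> /flattenP[_ /mapP[ab _ ->] /flattenP[_ /mapP[m mn ->] /mapP[w hw ->]]].
apply: test_vector_small => t; apply: le_trans (signed_delta_le s (class_uniq _ _ _) hw t) _.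
by rewrite lern1; case: (_ \in _).
Qed.

Definition test_set : set X :=
  [set x | x = 0 \/ exists n, x \in test_vectors n] `|` [set zX s [::]].

Lemma test_set_compact : compact (test_set : set B).
Proof.
apply: (@compactU B); last exact: compact_set1.
apply: compact_null_sequence => A /nbhs_ballP[e /= e0 hA].
have eE : e = ofR s (nm s e) by rewrite -nmE gtr0_norm.
have ne0 : 0 < nm s e.
  rewrite lt_def nm_ge0 andbT; apply: contraTneq e0 => h.
  by rewrite eE h ofR0 ltxx.
have [n0 hn0] := decay_small (divr_gt0 ne0 (ltr0Sn R 10)).
exists n0 => n nn x xn; apply: hA; rewrite -ball_normE /= sub0r normrN (nmE s) eE.
rewrite lt_neqAle ofR_le (inj_eq (@ofR_inj _ _ s)) -lt_neqAle.
by have := test_vectors_small xn; have := hn0 n nn; lra.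
Qed.

Lemma uniform_on_compact (I : Type) (le : I -> I -> Prop) (S : I -> {linear B -> B})
    (C : set B) (eta : R) : directed le -> compact C -> 0 < eta ->
  {family compact, (fun i => S i : B -> B) @ tails le --> @id B} ->
  exists i, forall x, C x -> nm s (S i x - x) <= eta.
Proof.
move=> dir cC eta0 hS; have tF := tails_filter dir.
have hC : {uniform C, (fun i => S i : B -> B) @ tails le --> @id B}.
  by move/fam_cvgP: hS; apply.
pose P := [set h : B -> B | forall x, C x -> nm s (h x - x) <= eta].
have e0 : 0 < ofR s eta.
  by rewrite lt_def -(ofR0 s) ofR_le (ltW eta0) (inj_eq (@ofR_inj _ _ s)) gt_eqF.
have : ((fun i => S i : B -> B) @ tails le) P.
  apply: hC; apply/uniform_nbhs; exists [set p | ball p.1 (ofR s eta) p.2]; split.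
    exact: (entourage_ball B (PosNum e0)).
  move=> h hh x Cx; have := hh x Cx; rewrite /= -ball_normE /= distrC (nmE s) => /ltW.
  by rewrite ofR_le.
move=> [i hi]; exists i; apply: hi.
by case: dir.
Qed.

(** For the zero operator the BAP is the approximation property.  With the
    accuracy 1 / 130 on the compact set, the normalized traces of S - id are at
    most 1 / 2 in absolute value on all levels, whereas they tend to - 1. *)
Theorem szankowski_not_BAP (p : R) : 1 <= p -> ~ BAP (summing_norm (re s) p) B.
Proof.
move=> p1 [lam lam1 hB]; have p0 : 0 < p by exact: lt_le_trans p1.
have [Z hZ] := @linear_exists K B B (fun=> 0) (fun a x y => esym (eq_trans (addr0 _) (scaler0 _ a))).
have Zin : in_ideal (summing_norm (re s) p) Z.
  split; first by apply: (@nm_continuous _ _ s _ _ _ 0) => x; rewrite hZ nm0 mul0r.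
  apply: (@le_lt_trans _ _ 0%:E); last exact: ltry.
  apply: (summing_norm_le (s := s)) => // xs w w0 _.
  rewrite big1 ?powR_ge0// => x _; rewrite hZ nm0 powR0// gt_eqF//.
have [I [le [S [dir Sfin Scvg _]]]] := hB B Z Zin.
have eta0 : 0 < 130^-1 :> R by rewrite invr_gt0.
have [i hi] := uniform_on_compact dir test_set_compact eta0 Scvg.
have [U hU] : exists U : {linear X -> X}, U =1 (fun x => S i x - x).
  by apply: linear_exists => a x y; rewrite linearP scalerBr opprD addrACA.
have q0 : 0 < 4^-1 :> R by rewrite invr_gt0.
have zle t : nm s (zX s t) <= 6.
  have e1 j : nm s (unit_vector s j) <= 1.
    have := @unit_combination_le _ _ s [:: j] id (fun=> 1) isT.
    rewrite big_seq1 scale1r sqrtr1; apply=> [x y|_]; last by rewrite nm1.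
    by rewrite !inE => /eqP -> /eqP ->.
  have tr (u v : space s false) x y : nm s u <= x -> nm s v <= y -> nm s (u + v) <= x + y.
    by move=> ? ?; apply: le_trans (nm_triangle _ _ _) (lerD _ _).
  have trB (u v : space s false) x y : nm s u <= x -> nm s v <= y -> nm s (u - v) <= x + y.
    by move=> ? ?; apply: le_trans (nmB_le _ _ _) (lerD _ _).
  rewrite -nm_incl incl_zX; apply: (@le_trans _ _ (1 + 1 + (1 + 1 + 1 + 1))); last by lra.
  exact: tr _ _ _ _ (trB _ _ _ _ (e1 _) (e1 _))
    (tr _ _ _ _ (tr _ _ _ _ (tr _ _ _ _ (e1 _) (e1 _)) (e1 _)) (e1 _)).
have [N hN] := finite_rank_coord_null (Sfin i) q0 (ler0n R 6).
have hU0 x : test_set x -> nm s (U x) <= 130^-1 by rewrite hU; exact: hi.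
have := @trace_bound R K s U 130^-1 (ltW eta0) _ _ N.
have h0 : nm s (U (zX s [::])) <= 130^-1 by apply: hU0; right.
move=> /(_ h0) h1.
have {}h1 : nm s (trace_level U N) <= 2 ^+ N * (65 / 130).
  apply: h1 => a b n m w mn hw; apply: hU0; left; right; exists n.
  exact: mem_test_vectors.
pose TS : K := \sum_(t <- level N) zfun t (S i (zX s t)).
have zz t : zfun t (zX s t) = 1.
  have tt : (t == false :: t) = false by apply/eqP => /(congr1 size) /= /n_Sn.
  have tt' : (t == true :: t) = false by apply/eqP => /(congr1 size) /= /n_Sn.
  have zE j : (coord (zX s t) j : K) = coord (zvec s t) j by [].
  rewrite /zfun !zE /zvec !(coordBE, coordDE, unit_vectorE) !eqseq_cons !eqxx /=.
  by rewrite tt tt' /=; field.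
have lvlE : trace_level U N = TS - 2 ^+ N.
  have -> : 2 ^+ N = \sum_(t <- level N) (1 : K).
    by rewrite big_const_seq count_predT iter_addr_0 size_level natrX.
  rewrite /trace_level /TS -sumrB; apply: eq_bigr => t _.
  by rewrite -(zz t) hU /zfun !coordBE; field.
have TS_le : nm s TS <= 2 ^+ N * 4^-1.
  apply: le_trans (nm_sum _ _ _ _) _.
  apply: (@le_trans _ _ (\sum_(t <- level N) (4^-1 : R))); last first.
    by rewrite big_const_seq count_predT iter_addr_0 size_level -[leLHS]mulr_natl natrX.
  rewrite big_seq [leRHS]big_seq; apply: ler_sum => t; rewrite mem_level => /eqP tN.
  have c1 := hN _ (false :: t) (zle t); have c2 := hN _ (true :: t) (zle t).
  rewrite /= tN in c1 c2; have {}c1 := c1 (leqnSn N); have {}c2 := c2 (leqnSn N).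
  have nm2 : nm s (2 : K) = 2.
    have -> : (2 : K) = ofR s 2 by rewrite -[2 in RHS]/(1 + 1) ofRD ofR1.
    by rewrite nm_ofR ger0_norm.
  rewrite /zfun nmM nmV nm2 ler_pdivrMr//.
  by apply: le_trans (nmB_le _ _ _) _; lra.
have N2 : nm s (2 ^+ N : K) = 2 ^+ N.
  have -> : (2 ^+ N : K) = ofR s (2 ^+ N).
    elim: (N) => [|k ih]; first by rewrite !expr0 ofR1.
    by rewrite !exprS ih ofRM -[2 in RHS]/(1 + 1) ofRD ofR1.
  by rewrite nm_ofR ger0_norm// exprn_ge0.
have P2 : 0 < 2 ^+ N :> R by rewrite exprn_gt0.
have := nmB_le s TS (trace_level U N).
rewrite lvlE opprB addrC subrK N2 -lvlE; lra.
Qed.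
End no_BAP.
Theorem proposition2p16 (R : realType) :
  (exists X : completeNormedModType R, forall p : R, 1 <= p <= 2 ->
     weak_MAP (summing_norm (fun x : R => x) p) X /\
     ~ BAP (summing_norm (fun x : R => x) p) X) /\
  (exists X : completeNormedModType R[i], forall p : R, 1 <= p <= 2 ->
     weak_MAP (summing_norm (fun z : R[i] => complex.Re z) p) X /\
     ~ BAP (summing_norm (fun z : R[i] => complex.Re z) p) X).
Proof.
split.
  have [s <-] := scalars_real R; exists (banach s true) => p hp.
  split; [exact: space_weak_MAP | apply: szankowski_not_BAP].
  by case/andP: hp.
have [s <-] := scalars_complex R; exists (banach s true) => p hp.
split; [exact: space_weak_MAP | apply: szankowski_not_BAP].
by case/andP: hp.
Qed.
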